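(* In the setting described in the context, the function $\zeta_{n}(\mathbf{s};\mathbf{P};\boldsymbol{\mu}_{n-1})$ has a meromorphic continuation to the whole space $\mathbb{C}^T$, with singularities contained in the countable union of the hyperplanes making up the sets $$\mathcal{S}_{\boldsymbol{\ell}}^{(1)}=\{ \mathbf{s} \in \mathbb{C}^T : g(s_T;-\boldsymbol{\ell}) \in \mathbb{Z}_{\leq 0} \}\quad(\boldsymbol{\ell}\in\mathbb{N}_0^{d-1}),$$ $$\mathcal{S}_{\boldsymbol{\ell}}^{(2)}=\{ \mathbf{s} \in \mathbb{C}^T : \widetilde{g}(s_T;-\boldsymbol{\ell}) \in \mathbb{Z}_{\leq 0} \}\quad(\boldsymbol{\ell}\in\mathbb{N}_0^{d-1}),$$ $$\mathcal{S}_{\mathbf{k}}^{(3)}=\{ \mathbf{s} \in \mathbb{C}^T : a_0s_T=1+\langle \boldsymbol{\alpha}|\mathbf{k} \rangle \}\quad(\mathbf{k}\in\mathbb{N}_0^{d}).$$ Furthermore, the non-positive integer points $\mathbf{s}=-\mathbf{N}\in\mathbb{Z}_{\le0}^T$ are not singularities of $\zeta_{n}(\mathbf{s};\mathbf{P};\boldsymbol{\mu}_{n-1})$.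
   Context: HDF condition: a polynomial $P\in\mathbb{R}[X_1,\ldots,X_m]$ satisfies HDF if $P(\mathbf{x})>0$ for all $\mathbf{x}\in[1,+\infty)^m$ and, for every $1\le j\le m$, there is $\varepsilon_0>0$ such that $(\partial^{\boldsymbol\beta}P/P)(\mathbf{x})\ll x_j^{-\varepsilon_0}$ on $[1,+\infty)^m$ for all $\boldsymbol\beta\in\mathbb{N}_0^m$ with $\beta_j\ge1$. Setting: $T\ge1$, $n\ge1$, $d\ge1$ are integers; $\boldsymbol{\mu}_{n-1}=(\mu_1,\ldots,\mu_{n-1})$ with $\mu_j\in\mathbb{C}$, $|\mu_j|=1$, $\mu_j\ne1$; $0\le a_0<a_1<\cdots<a_d$ are integers; $P_1,\ldots,P_{T-1},Q_0,\ldots,Q_d\in\mathbb{R}[X_1,\ldots,X_{n-1}]$ satisfy HDF; and $P_T(X_1,\ldots,X_n)=\sum_{j=0}^dQ_j(X_1,\ldots,X_{n-1})X_n^{a_j}$. If $n\ge2$, it is assumed that $P_1\cdots P_{T-1}(Q_0\cdots Q_d)^{1/(d+1)}(\mathbf{x})\to\infty$ as $x_1+\cdots+x_{n-1}\to\infty$, $\mathbf{x}\in[1,\infty)^{n-1}$. If $n=1$, the polynomials $P_1,\dots,P_{T-1},Q_0,\dots,Q_d$ are real constants (positive, by HDF). Put $\mathbf{P}=(P_1,\ldots,P_T)$, $\alpha_j=a_j-a_0$ ($1\le j\le d$), $\boldsymbol{\alpha}=(\alpha_1,\ldots,\alpha_d)$. For $\mathbf{s}\in\mathbb{C}^T$ with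 all $\Re s_t$ sufficiently large, $$\zeta_n(\mathbf{s};\mathbf{P};\boldsymbol{\mu}_{n-1})=\sum_{m_1,\ldots,m_n\ge1}\frac{\mu_1^{m_1}\cdots\mu_{n-1}^{m_{n-1}}}{\prod_{j=1}^{T-1}P_j(m_1,\ldots,m_{n-1})^{s_j}\;P_T(m_1,\ldots,m_n)^{s_T}}.$$ Notation: $\langle\mathbf{x}|\mathbf{y}\rangle=\sum x_jy_j$. For $\mathbf{z}=(z_1,\ldots,z_{d-1})\in\mathbb{C}^{d-1}$, $$g(s_T;\mathbf{z})=\frac{1-a_0s_T-\sum_{j=1}^{d-1}(a_j-a_0)z_j}{a_d-a_0},\qquad \widetilde g(s_T;\mathbf{z})=\frac{a_ds_T-\sum_{j=1}^{d-1}(a_d-a_j)z_j-1}{a_d-a_0}.$$ When $d=1$, the only $\boldsymbol{\ell}\in\mathbb{N}_0^{0}$ is the empty tuple, and the sums over $j$ vanish. *)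

(* Defs.v *)
From HB Require Import structures.
From mathcomp Require Import all_boot all_order all_algebra.
From mathcomp Require Import finmap complex.
From mathcomp Require mpoly.
(* The notations of multinomials clash with those of mathcomp-analysis. *)
Import -(notations) mpoly.
From mathcomp Require Import all_classical all_reals all_analysis.
From mathcomp Require summability.

Set Implicit Arguments.
Unset Strict Implicit.
Unset Printing Implicit Defensive.

Import Order.TTheory GRing.Theory Num.Theory.
Import numFieldNormedType.Exports.

Local Open Scope classical_set_scope.
Local Open Scope ring_scope.

(* R[i] inherits the norm and topology that every numFieldType carries. *)
#[export, non_forgetful_inheritance]
HB.instance Definition _ (R : realType) := PseudoPointedMetric.copy R[i] R[i]^o.
#[export, non_forgetful_inheritance]
HB.instance Definition _ (R : realType) := NormedModule.copy R[i] R[i]^o.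

(* [differentiable] is here complex Frechet differentiability on C^T. *)
Definition holomorphic_near (R : realType) (T : nat)
    (f : 'rV[R[i]]_T -> R[i]) (p : 'rV[R[i]]_T) : Prop :=
  \forall q \near p, differentiable f q.

(* A meromorphic function on C^T: locally a quotient [g / h] of holomorphic
   functions, the germ of [h] being nonzero.  The function is represented by a
   total one, whose values on the zeros of [h] are not constrained. *)
Definition meromorphic (R : realType) (T : nat)
    (f : 'rV[R[i]]_T -> R[i]) : Prop :=
  forall p : 'rV[R[i]]_T, exists g h : 'rV[R[i]]_T -> R[i],
    [/\ holomorphic_near g p,
        holomorphic_near h p,
        ~ (\forall q \near p, h q = 0)
      & \forall q \near p, h q != 0 -> f q = g q / h q].

(* A point at which [f] agrees off a thin set with a holomorphic germ, but with
   the wrong value, also counts as singular: a nonsingular point is one near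
   which the representative [f] itself is holomorphic. *)
Definition singular_point (R : realType) (T : nat)
    (f : 'rV[R[i]]_T -> R[i]) (p : 'rV[R[i]]_T) : Prop :=
  ~ holomorphic_near f p.

(* [x ^ s = exp (s log x)], for [0 < x]. *)
Definition cpow (R : realType) (x : R) (s : R[i]) : R[i] :=
  let rho := expR (complex.Re s * ln x) in
  let theta := complex.Im s * ln x in
  Complex (rho * cos theta) (rho * sin theta).

Definition ge1 (R : realType) (m : nat) (x : 'I_m -> R) : Prop :=
  forall i, 1 <= x i.

Definition HDF (R : realType) (m : nat) (P : mpoly m R) : Prop :=
  (forall x : 'I_m -> R, ge1 x -> 0 < meval x P) /\
  (forall j : 'I_m, exists2 eps0 : R, 0 < eps0 &
     forall beta : multinom m, (1 <= beta j)%N ->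
     exists K : R, forall x : 'I_m -> R, ge1 x ->
       `| meval x (mderivm beta P) / meval x P | <= K * x j `^ (- eps0)).

(* Indices: [T'] stands for T-1 and [n'] for n-1, and vectors are 0-based;
   the variable X_n and the coordinate s_T have index [ord_max]. *)

(* P_T(X_1, ..., X_n) = \sum_j Q_j(X_1, ..., X_(n-1)) X_n^(a_j) *)
Definition polyT (R : realType) (n' d : nat) (Q : 'I_d.+1 -> mpoly n' R)
    (a : 'I_d.+1 -> nat) : mpoly n'.+1 R :=
  \sum_(j < d.+1) mwiden (Q j) * mpolyX R (mnm1 ord_max) ^+ a j.

(* P_1 ... P_(T-1) (Q_0 ... Q_d)^(1/(d+1)) tends to infinity as
   x_1 + ... + x_(n-1) does, on [1, oo)^(n-1). *)
Definition tends_to_infty (R : realType) (T' n' d : nat)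
    (P : 'I_T' -> mpoly n' R) (Q : 'I_d.+1 -> mpoly n' R) : Prop :=
  forall A : R, exists B : R, forall x : 'I_n' -> R,
    ge1 x -> B <= \sum_(i < n') x i ->
    A <= (\prod_(j < T') meval x (P j)) *
         (\prod_(j < d.+1) meval x (Q j)) `^ (d.+1%:R^-1).

(* The general term, at (m_1, ..., m_n) = (k_1 + 1, ..., k_n + 1), of the
   series defining zeta_n(s; P; mu). *)
Definition zeta_term (R : realType) (T' n' d : nat)
    (P : 'I_T' -> mpoly n' R) (Q : 'I_d.+1 -> mpoly n' R) (a : 'I_d.+1 -> nat)
    (mu : 'I_n' -> R[i]) (s : 'rV[R[i]]_T'.+1)
    (k : {ffun 'I_n'.+1 -> nat}) : R[i] :=
  let m (i : 'I_n'.+1) : nat := (k i).+1 in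
  let m' (i : 'I_n') : nat := m (widen_ord (leqnSn n') i) in
  (\prod_(i < n') mu i ^+ m' i) /
  ((\prod_(j < T') cpow (meval (fun i => (m' i)%:R) (P j))
                        (s ord0 (widen_ord (leqnSn T') j))) *
   cpow (meval (fun i => (m i)%:R) (polyT Q a)) (s ord0 ord_max)).

(* [z] is the sum of the multiple series, i.e. the limit of its finite partial
   sums along the filter of finite sets of indices; for complex terms the
   existence of this limit is absolute convergence. *)
Definition zeta_is (R : realType) (T' n' d : nat)
    (P : 'I_T' -> mpoly n' R) (Q : 'I_d.+1 -> mpoly n' R) (a : 'I_d.+1 -> nat)
    (mu : 'I_n' -> R[i]) (s : 'rV[R[i]]_T'.+1) (z : R[i]) : Prop :=
  summability.partial_sum (zeta_term P Q a mu s) @ summability.totally --> z.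

(* The index j in {1, ..., d-1} as an element of {0, ..., d}, from the 0-based
   index i = j - 1. *)
Definition mid (d : nat) (i : 'I_d.-1) : 'I_d.+1 :=
  lift ord0 (widen_ord (leq_pred d) i).

Definition gfun (R : realType) (d : nat) (a : 'I_d.+1 -> nat)
    (sT : R[i]) (z : 'I_d.-1 -> R[i]) : R[i] :=
  (1 - (a ord0)%:R * sT - \sum_(j < d.-1) ((a (mid j))%:R - (a ord0)%:R) * z j)
  / ((a ord_max)%:R - (a ord0)%:R).

Definition gtilde (R : realType) (d : nat) (a : 'I_d.+1 -> nat)
    (sT : R[i]) (z : 'I_d.-1 -> R[i]) : R[i] :=
  ((a ord_max)%:R * sT
     - \sum_(j < d.-1) ((a ord_max)%:R - (a (mid j))%:R) * z j - 1)
  / ((a ord_max)%:R - (a ord0)%:R).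

Definition Znonpos (R : realType) : set R[i] :=
  [set z | exists k : nat, z = - k%:R].

Definition S1 (R : realType) (T' d : nat) (a : 'I_d.+1 -> nat)
    (l : 'I_d.-1 -> nat) : set 'rV[R[i]]_T'.+1 :=
  [set s | Znonpos (gfun a (s ord0 ord_max) (fun j => - (l j)%:R))].

Definition S2 (R : realType) (T' d : nat) (a : 'I_d.+1 -> nat)
    (l : 'I_d.-1 -> nat) : set 'rV[R[i]]_T'.+1 :=
  [set s | Znonpos (gtilde a (s ord0 ord_max) (fun j => - (l j)%:R))].

(* alpha_j = a_j - a_0 for 1 <= j <= d; the subtraction on nat is exact since
   [a] is increasing. *)
Definition alpha (d : nat) (a : 'I_d.+1 -> nat) (j : 'I_d) : nat :=
  (a (lift ord0 j) - a ord0)%N.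

Definition S3 (R : realType) (T' d : nat) (a : 'I_d.+1 -> nat)
    (k : 'I_d -> nat) : set 'rV[R[i]]_T'.+1 :=
  [set s | (a ord0)%:R * s ord0 ord_max
           = 1 + (\sum_(j < d) alpha a j * k j)%N%:R].

(* Main.v *)
Require Import Defs.
From HB Require Import structures.
From mathcomp Require Import all_boot all_order all_algebra.
From mathcomp Require Import finmap complex.
From mathcomp Require mpoly.
Import -(notations) mpoly.
From mathcomp Require Import all_classical all_reals all_analysis.
From mathcomp Require Import ring lra.
From mathcomp Require summability.

(** In the variables [m_1 .. m_(n-1)] the factors [mu_j ^ m_j] oscillate and summation by
    parts gains decay. Nothing oscillates in [m_n]: there the summand is compared with exact
    derivatives, and this is where the poles come from.

    Symbols. The HDF condition makes each polynomial [p] a symbol: compared with [p], each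
    derivative in [x_i] gains a factor [x_i ^ (- eps)] ([HDF_symbol]); it also bounds [p] from
    below by a power of each variable that occurs in [p] ([HDF_lower_var]). The symbol classes
    [Sym] are stable under products, inverses, logarithms and exponentials, so the summand
    [exp (- \sum_t s_t ln p_t)] is a symbol, uniformly for [s] in a bounded set.

    The last variable. Put [u_j = Q_j X_n ^ a_j / P_T] for [j < d] and, for a word [w] in the
    letters [0 .. d-1], let [Phi_w] be the product of the summand with the [u_j], [j] in [w].
    With [t_w] the sum over the letters of [w] of the gaps [a_d - a_j], [dHf_word] states that
      [d/dx_n (x_n Phi_w)
         = (1 - t_w - a_d s_T) Phi_w + (s_T + |w|) \sum_j (a_d - a_j) Phi_(j w)].
    Solving for [Phi_w] and iterating from the empty word writes the summand as a combination
    of derivatives [d/dx_n (x_n Phi_w)] and of the [Phi_w] of long words, which decay fast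
    because [u_j = O(1 / x_n)]. By Gregory's formula ([gregory_remainder]) a derivative is a
    difference in [m_n], whose sum telescopes, up to a remainder that decays as fast as wanted.
    The coefficients are rational in [s_T], with denominators products of the factors
    [1 - t_w - a_d s_T], whose zeros lie on the hyperplanes of the sets S2 ([root_S2]). If such
    a zero is a non-positive integer [- k], the factor is cancelled by the factor [s_T + k] met
    at the suffix of length [k] of the word ([root_del]).

    The other variables. Summing by parts [l] times in each of them ([by_parts]) turns growth
    into decay, and the resulting regularised sum does not depend on [l] ([regsum_step]).

    For [s] in a bounded set some order [l] thus makes everything converge absolutely, together
    with two derivatives in [s], which gives holomorphy in [s] ([differentiable_tsum]), apart
    from the zeros of the denominators. Two orders that both suffice give the same value
    ([zeta_of_order_step]). The continuation uses at each [s] the least order that suffices; in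
    the region where order 0 suffices it is the series itself ([zeta_of_order0]). *)

Set Implicit Arguments.
Unset Strict Implicit.
Unset Printing Implicit Defensive.

Import Order.TTheory GRing.Theory Num.Theory.
Import numFieldNormedType.Exports.

Local Open Scope classical_set_scope.
Local Open Scope ring_scope.

(** * Complex numbers and differentiation along real lines *)

Section Complex.
Variable R : realType.
Notation C := R[i].
Implicit Types (z w : C) (f g : R -> C).

(** The l1 norm of [C = R^2]: unlike the modulus, it takes its values in [R], where
    all the estimates are made. *)
Definition N z : R := `|complex.Re z| + `|complex.Im z|.

Lemma N_ge0 z : 0 <= N z. Proof. by rewrite addr_ge0. Qed.

Lemma ND z w : N (z + w) <= N z + N w.
Proof.
case: z w => [a b] [c d]; rewrite /N /= addrACA.
by apply: lerD; exact: ler_normD.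
Qed.

Lemma NM z w : N (z * w) <= N z * N w.
Proof.
case: z w => [a b] [c d]; rewrite /N /=.
apply: (@le_trans _ _ ((`|a| * `|c| + `|b| * `|d|) + (`|a| * `|d| + `|b| * `|c|))).
  apply: lerD; last by rewrite (le_trans (ler_normD _ _))// !normrM.
  by rewrite (le_trans (ler_normB _ _))// !normrM.
by rewrite le_eqVlt; apply/orP; left; apply/eqP; ring.
Qed.

Lemma NN z : N (- z) = N z.
Proof. by case: z => a b; rewrite /N /= !normrN. Qed.

Lemma NB z w : N (z - w) <= N z + N w.
Proof. by rewrite -(NN w) ND. Qed.

Lemma N0 : N 0 = 0. Proof. by rewrite /N /= !normr0 addr0. Qed.

Lemma Nreal (x : R) : N (x%:C)%C = `|x|.
Proof. by rewrite /N /= normr0 addr0. Qed.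

Lemma N_sum (I : Type) (r : seq I) (P : pred I) (F : I -> C) :
  N (\sum_(i <- r | P i) F i) <= \sum_(i <- r | P i) N (F i).
Proof.
elim/big_rec2: _ => [|i x y _ h]; first by rewrite N0.
by rewrite (le_trans (ND _ _))// lerD2l.
Qed.

Lemma ler_sum_term (I : finType) (F : I -> R) i : (forall j, 0 <= F j) -> F i <= \sum_j F j.
Proof. by move=> h; rewrite (bigD1 i)//= lerDl sumr_ge0. Qed.

Lemma normc_le_N z : (`|z| <= (N z)%:C)%C.
Proof.
case: z => a b; rewrite normc_def lecR /N /=.
rewrite -(ger0_norm (addr_ge0 (normr_ge0 a) (normr_ge0 b))) -sqrtr_sqr.
rewrite ler_sqrt ?sqr_ge0// -(real_normK (num_real a)) -(real_normK (num_real b)).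
by have := normr_ge0 a; have := normr_ge0 b; nra.
Qed.

Lemma ReIm_le_normc z (x : R) : (`|z| <= x%:C)%C ->
  `|complex.Re z| <= x /\ `|complex.Im z| <= x.
Proof.
case: z => a b; rewrite normc_def lecR /= => h.
split; apply: le_trans h; rewrite -sqrtr_sqr ler_sqrt ?addr_ge0 ?sqr_ge0//.
  by rewrite lerDl sqr_ge0.
by rewrite lerDr sqr_ge0.
Qed.

Lemma N_le_normc z (x : R) : (`|z| <= x%:C)%C -> N z <= 2 * x.
Proof. by move=> /ReIm_le_normc[h1 h2]; rewrite /N mulrDl mul1r lerD. Qed.

(** Complex-valued functions of a real variable are differentiated through
    their real and imaginary parts, since [R[i]] is a normed module over itself
    and not over [R]. *)
Definition cder f (t : R) (l : C) : Prop :=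
  is_derive t (1 : R) (fun u => complex.Re (f u)) (complex.Re l) /\
  is_derive t (1 : R) (fun u => complex.Im (f u)) (complex.Im l).

Lemma is_derive_congr (F : R -> R) (t l l' : R) :
  is_derive t (1 : R) F l -> l = l' -> is_derive t (1 : R) F l'.
Proof. by move=> h <-. Qed.

Lemma is_derive_ext (F G : R -> R) (t l : R) :
  is_derive t (1 : R) F l -> F =1 G -> is_derive t (1 : R) G l.
Proof. by move=> h /funext <-. Qed.

Lemma is_derive_mul (F G : R -> R) (t a b : R) :
  is_derive t (1 : R) F a -> is_derive t (1 : R) G b ->
  is_derive t (1 : R) (fun u => F u * G u) (F t * b + G t * a).
Proof. by move=> hF hG; exact: is_deriveM. Qed.

Lemma is_derive_add (F G : R -> R) (t a b : R) :
  is_derive t (1 : R) F a -> is_derive t (1 : R) G b ->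
  is_derive t (1 : R) (fun u => F u + G u) (a + b).
Proof. by move=> hF hG; exact: is_deriveD. Qed.

Lemma is_derive_opp (F : R -> R) (t a : R) :
  is_derive t (1 : R) F a -> is_derive t (1 : R) (fun u => - F u) (- a).
Proof. by move=> hF; exact: is_deriveN. Qed.

Lemma is_derive_comp (F G : R -> R) (t a b : R) :
  is_derive t (1 : R) G b -> is_derive (G t) (1 : R) F a ->
  is_derive t (1 : R) (fun u => F (G u)) (b * a).
Proof. by move=> hG hF; rewrite mulrC; exact: is_derive1_comp. Qed.

Lemma cder_congr f t l l' : cder f t l -> l = l' -> cder f t l'.
Proof. by move=> h <-. Qed.

Lemma cder_ext f g t l : cder f t l -> f =1 g -> cder g t l.
Proof. by move=> h /funext <-. Qed.

Lemma cder_unique f t l l' : cder f t l -> cder f t l' -> l = l'.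
Proof.
case: l l' => [a b] [c d] [h1 h2] [h3 h4].
have e1 := @derive_val _ _ _ _ _ _ _ h1; have e2 := @derive_val _ _ _ _ _ _ _ h2.
have e3 := @derive_val _ _ _ _ _ _ _ h3; have e4 := @derive_val _ _ _ _ _ _ _ h4.
by move: e1 e2; rewrite e3 e4 /= => -> ->.
Qed.

Lemma cder_cst z t : cder (fun=> z) t 0.
Proof. by split; exact: is_derive_cst. Qed.

Lemma cder_add f g t a b :
  cder f t a -> cder g t b -> cder (fun u => f u + g u) t (a + b).
Proof.
case: a b => [a1 a2] [b1 b2] [h1 h2] [h3 h4]; split.
  apply: is_derive_ext (is_derive_add h1 h3) _ => u.
  by case: (f u) (g u) => ? ? [].
apply: is_derive_ext (is_derive_add h2 h4) _ => u.
by case: (f u) (g u) => ? ? [].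
Qed.

Lemma cder_mul f g t a b :
  cder f t a -> cder g t b -> cder (fun u => f u * g u) t (a * g t + f t * b).
Proof.
case: a b => [a1 a2] [b1 b2] [/= h1 h2] [/= h3 h4]; split.
  have h := is_derive_add (is_derive_mul h1 h3) (is_derive_opp (is_derive_mul h2 h4)).
  apply: (is_derive_ext (F := fun u => complex.Re (f u) * complex.Re (g u) -
     complex.Im (f u) * complex.Im (g u))); last first.
    by move=> u; case: (f u) (g u) => ? ? [].
  apply: is_derive_congr h _.
  by case: (f t) (g t) => ? ? [? ?] /=; ring.
have h := is_derive_add (is_derive_mul h1 h4) (is_derive_mul h2 h3).
apply: (is_derive_ext (F := fun u => complex.Re (f u) * complex.Im (g u) +
   complex.Im (f u) * complex.Re (g u))); last first.
  by move=> u; case: (f u) (g u) => ? ? [].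
apply: is_derive_congr h _.
by case: (f t) (g t) => ? ? [? ?] /=; ring.
Qed.

Lemma cder_scale z f t a : cder f t a -> cder (fun u => z * f u) t (z * a).
Proof.
move=> h; apply: cder_congr (cder_mul (cder_cst z t) h) _.
by rewrite mul0r add0r.
Qed.

Lemma cder_opp f t a : cder f t a -> cder (fun u => - f u) t (- a).
Proof.
move=> /(cder_scale (-1)); rewrite mulN1r => h.
by apply: cder_ext h _ => u; rewrite mulN1r.
Qed.

Lemma cder_sub f g t a b :
  cder f t a -> cder g t b -> cder (fun u => f u - g u) t (a - b).
Proof. by move=> hf hg; apply: cder_add => //; exact: cder_opp. Qed.

Lemma cder_sum (I : Type) (r : seq I) (F : I -> R -> C) (l : I -> C) t :
  (forall i, cder (F i) t (l i)) ->
  cder (fun u => \sum_(i <- r) F i u) t (\sum_(i <- r) l i).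
Proof.
move=> h; elim: r => [|i r ih].
  by rewrite big_nil; apply: cder_ext (cder_cst 0 t) _ => u; rewrite big_nil.
rewrite big_cons; apply: cder_ext (cder_add (h i) ih) _ => u.
by rewrite big_cons.
Qed.

Lemma cder_real (F : R -> R) t a :
  is_derive t (1 : R) F a -> cder (fun u => (F u)%:C)%C t (a%:C)%C.
Proof. by move=> h; split => //=; exact: is_derive_cst. Qed.

Lemma cder_id t : cder (fun u : R => (u%:C)%C) t 1.
Proof. by apply: (cder_real (F := id)); exact: is_derive_id. Qed.

Lemma cder_comp (f : R -> C) (G : R -> R) t a b :
  is_derive t (1 : R) G b -> cder f (G t) a ->
  cder (fun u => f (G u)) t ((b%:C)%C * a).
Proof.
move=> hG [h1 h2]; case: a h1 h2 => a1 a2 /= h1 h2; split => /=.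
  rewrite mul0r subr0.
  exact: (is_derive_comp (F := fun u => complex.Re (f u)) hG h1).
rewrite mul0r addr0.
exact: (is_derive_comp (F := fun u => complex.Im (f u)) hG h2).
Qed.

(** The exponential, in the form in which [cpow] is defined. *)
Definition cexp z : C :=
  Complex (expR (complex.Re z) * cos (complex.Im z))
          (expR (complex.Re z) * sin (complex.Im z)).

Lemma cexp0 : cexp 0 = 1.
Proof. by rewrite /cexp /= expR0 cos0 sin0 mulr1 mulr0. Qed.

Lemma cexpD z w : cexp (z + w) = cexp z * cexp w.
Proof.
case: z w => [a b] [c d]; rewrite /cexp /= expRD cosD sinD.
by congr Complex; ring.
Qed.

Lemma cexp_sum (I : Type) (r : seq I) (F : I -> C) :
  cexp (\sum_(i <- r) F i) = \prod_(i <- r) cexp (F i).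
Proof. by elim/big_rec2: _ => [|i x y _ <-]; rewrite ?cexp0 ?cexpD. Qed.

Lemma cexpN z : cexp (- z) = (cexp z)^-1.
Proof.
have h : cexp z * cexp (- z) = 1 by rewrite -cexpD subrr cexp0.
have hz : cexp z != 0 by apply/eqP => e; move: h; rewrite e mul0r => /esym/eqP; rewrite oner_eq0.
by apply: (mulfI hz); rewrite h mulfV.
Qed.

Lemma N_cexp z : N (cexp z) <= 2 * expR (complex.Re z).
Proof.
rewrite /N /cexp /= !normrM !(ger0_norm (expR_ge0 _)) mulrDl !mul1r.
by apply: lerD; rewrite ler_piMr ?expR_ge0// ?ler_norml ?cos_le1 ?cos_geN1 ?sin_le1 ?sin_geN1.
Qed.

Lemma cder_cexp f t a : cder f t a -> cder (fun u => cexp (f u)) t (a * cexp (f t)).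
Proof.
move=> [h1 h2].
have he := is_derive_comp h1 (is_derive_expR _).
have hc := is_derive_comp h2 (is_derive_cos _).
have hs := is_derive_comp h2 (is_derive_sin _).
case: a {h1 h2} he hc hs => a b /= he hc hs; split => /=.
  by apply: is_derive_congr (is_derive_mul he hc) _ => /=; ring.
by apply: is_derive_congr (is_derive_mul he hs) _ => /=; ring.
Qed.

Lemma MVT_real (F : R -> R) (F' : R -> R) (b c : R) : 0 <= b ->
  (forall t, 0 <= t <= b -> is_derive t (1 : R) F (F' t)) ->
  (forall t, 0 <= t <= b -> `|F' t| <= c) ->
  `|F b - F 0| <= b * c.
Proof.
rewrite le_eqVlt => /predU1P[<- _ _|b0 hF hc].
  by rewrite subrr normr0 mul0r.
have hd t : t \in `]0, b[ -> is_derive t (1 : R) F (F' t).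
  by rewrite in_itv /= => /andP[/ltW t0 /ltW tb]; apply: hF; rewrite t0.
have hcont : {within `[0, b], continuous F}.
  apply/derivable_within_continuous => t; rewrite in_itv /= => ht.
  exact: (@ex_derive _ _ _ _ _ _ _ (hF t ht)).
have [t] := MVT b0 hd hcont.
rewrite in_itv /= => /andP[t0 tb] ->.
rewrite subr0 normrM (gtr0_norm b0) mulrC ler_wpM2l ?(ltW b0)//.
by apply: hc; rewrite !ltW.
Qed.

(** The mean value inequality holds for each component, hence the factor 2. *)
Lemma MVT_complex f f' (b c : R) : 0 <= b ->
  (forall t, 0 <= t <= b -> cder f t (f' t)) ->
  (forall t, 0 <= t <= b -> N (f' t) <= c) ->
  N (f b - f 0) <= 2 * b * c.
Proof.
move=> b0 hf hc.
have h1 : `|complex.Re (f b) - complex.Re (f 0)| <= b * c.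
  apply: (@MVT_real (fun t => complex.Re (f t)) (fun t => complex.Re (f' t))) => // t ht.
    by have [] := hf t ht.
  by rewrite (le_trans _ (hc t ht))// /N lerDl.
have h2 : `|complex.Im (f b) - complex.Im (f 0)| <= b * c.
  apply: (@MVT_real (fun t => complex.Im (f t)) (fun t => complex.Im (f' t))) => // t ht.
    by have [] := hf t ht.
  by rewrite (le_trans _ (hc t ht))// /N lerDr.
have -> : N (f b - f 0) = `|complex.Re (f b) - complex.Re (f 0)|
                        + `|complex.Im (f b) - complex.Im (f 0)|.
  by rewrite /N; case: (f b) (f 0) => ? ? [].
by rewrite -mulrA mulrDl mul1r lerD.
Qed.

End Complex.

(** * Symbols *)

Section Symbols.
Variables (R : realType) (n : nat) (eps : R).
Notation C := R[i].
Notation X := ('I_n -> R).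

Definition sh (x : X) (i : 'I_n) (t : R) : X := fun k => x k + (k == i)%:R * t.

Lemma sh0 x i : sh x i 0 = x.
Proof. by apply/funext => k; rewrite /sh mulr0 addr0. Qed.

Lemma shD x i t u : sh (sh x i t) i u = sh x i (t + u).
Proof. by apply/funext => k; rewrite /sh mulrDr addrA. Qed.

Lemma shC x i j t u : sh (sh x i t) j u = sh (sh x j u) i t.
Proof. by apply/funext => k; rewrite /sh addrAC. Qed.

Lemma sh_ge1 x i t : ge1 x -> 0 <= t -> ge1 (sh x i t).
Proof. by move=> hx t0 k; rewrite /sh (le_trans (hx k))// lerDl mulr_ge0. Qed.

Lemma ge1_gt0 (x : X) i : ge1 x -> 0 < x i.
Proof. by move=> /(_ i); exact: lt_le_trans. Qed.

(** Derivatives are a relation, required only at the points of [ge1]: a polynomial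
    may vanish elsewhere, and its inverse and logarithm are then of no use. *)
Definition pd (i : 'I_n) (f g : X -> C) : Prop :=
  forall x, ge1 x -> cder (fun t => f (sh x i t)) 0 (g x).

Lemma is_derive_sh (x : X) i j :
  is_derive (0 : R) (1 : R) (fun t => sh x i t j) (j == i)%:R.
Proof.
have h : is_derive (0 : R) (1 : R) (fun t : R => x j + (j == i)%:R * t)
   (0 + ((j == i)%:R * 1 + 0 * 0)).
  apply: is_derive_add; apply: is_derive_mul.
by apply: is_derive_congr h _; rewrite mul0r addr0 mulr1 add0r.
Qed.

Lemma pd_at i f g x t : pd i f g -> ge1 x -> 0 <= t ->
  cder (fun u => f (sh x i u)) t (g (sh x i t)).
Proof.
move=> hfg hx t0; have h := hfg _ (sh_ge1 i hx t0).
have hs : is_derive t (1 : R) (fun u : R => u - t) (1 - 0).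
  by apply: is_derive_add.
rewrite subr0 in hs.
have h' : cder (fun u => f (sh (sh x i t) i u)) (t - t) (g (sh x i t)) by rewrite subrr.
apply: cder_congr (cder_ext (cder_comp hs h') _) _ => [u|]; last by rewrite mul1r.
by rewrite /= shD addrC subrK.
Qed.

Lemma pd_add i f g f' g' :
  pd i f f' -> pd i g g' -> pd i (fun x => f x + g x) (fun x => f' x + g' x).
Proof. by move=> h1 h2 x hx; apply: cder_add; [exact: h1 | exact: h2]. Qed.

Lemma pd_mul i f g f' g' : pd i f f' -> pd i g g' ->
  pd i (fun x => f x * g x) (fun x => f' x * g x + f x * g' x).
Proof.
move=> h1 h2 x hx.
by apply: cder_congr (cder_mul (h1 _ hx) (h2 _ hx)) _; rewrite sh0.
Qed.

Lemma pd_cst i z : pd i (fun=> z) (fun=> 0).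
Proof. by move=> x _; exact: cder_cst. Qed.

Lemma pd_shift i j f g t : 0 <= t -> pd i f g ->
  pd i (fun x => f (sh x j t)) (fun x => g (sh x j t)).
Proof.
move=> t0 h x hx; apply: cder_ext (h _ (sh_ge1 j hx t0)) _ => u.
by rewrite shC.
Qed.

Lemma pd_sub i f g f' g' :
  pd i f f' -> pd i g g' -> pd i (fun x => f x - g x) (fun x => f' x - g' x).
Proof. by move=> h1 h2 x hx; apply: cder_sub; [exact: h1 | exact: h2]. Qed.

Lemma cder_real_inv (F : R -> R) t (l : C) : cder (fun u => (F u)%:C)%C t l ->
  is_derive t (1 : R) F (complex.Re l) /\ complex.Im l = 0.
Proof.
case: l => a b [/= h1 h2]; split => //.
have e := @derive_val _ _ _ _ _ _ _ h2.
by rewrite -e (@derive_val _ _ _ _ _ _ _ (is_derive_cst (0 : R) t 1)).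
Qed.

Lemma cder_inv_real (F : R -> R) t (l : C) : cder (fun u => (F u)%:C)%C t l ->
  F t != 0 -> cder (fun u => ((F u)^-1)%:C)%C t (- (l * ((F t)^-1)%:C * ((F t)^-1)%:C)%C).
Proof.
case: l => a b /cder_real_inv[/= h1 ->] ht.
have h := @is_deriveV R F t a 1 ht h1.
apply: cder_congr (cder_real h) _.
rewrite /GRing.scale /=.
apply/eqP; rewrite eq_complex /= !(mulr0, mul0r, addr0, subr0, oppr0) eqxx andbT.
by apply/eqP; field.
Qed.

Lemma cder_ln_real (F : R -> R) t (l : C) : cder (fun u => (F u)%:C)%C t l ->
  0 < F t -> cder (fun u => (ln (F u))%:C)%C t ((l * ((F t)^-1)%:C)%C).
Proof.
case: l => a b /cder_real_inv[/= h1 ->] ht.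
have h := is_derive_comp h1 (is_derive1_ln ht).
apply: cder_congr (cder_real h) _.
by apply/eqP; rewrite eq_complex /= !(mulr0, mul0r, addr0, subr0, oppr0) !eqxx.
Qed.

Section Classes.
Variables (S : Type) (B : S -> Prop).
Implicit Types (M : X -> R) (f g : S -> X -> C).

Definition dominated M f := exists2 c : R, 0 <= c &
  forall s x, B s -> ge1 x -> N (f s x) <= c * M x.

(** Symbols of weight [M]: each derivative with respect to [x_i] gains a factor
    [x_i ^ (- eps)], uniformly in the parameter [s] of [B]; [K] is the number
    of derivatives controlled. *)
Fixpoint Sym (K : nat) M f : Prop :=
  dominated M f /\
  if K is K'.+1 then
    forall i, exists2 g, (forall s, B s -> pd i (f s) (g s)) &
                         Sym K' (fun x => M x * x i `^ (- eps)) g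
  else True.

Lemma Sym_dom K M f : Sym K M f -> dominated M f.
Proof. by case: K => [|K] []. Qed.

Lemma SymS K M f i : Sym K.+1 M f ->
  exists2 g, (forall s, B s -> pd i (f s) (g s)) &
             Sym K (fun x => M x * x i `^ (- eps)) g.
Proof. by case. Qed.

Lemma dominated_le M M' f (c : R) : 0 <= c ->
  (forall x, ge1 x -> M x <= c * M' x) -> dominated M f -> dominated M' f.
Proof.
move=> c0 hM [d d0 hd]; exists (d * c); first exact: mulr_ge0.
move=> s x hs hx; rewrite (le_trans (hd _ _ hs hx))// -mulrA.
by rewrite ler_wpM2l// hM.
Qed.

Lemma Sym_le K M M' f (c : R) : 0 <= c ->
  (forall x, ge1 x -> M x <= c * M' x) -> Sym K M f -> Sym K M' f.
Proof.
move=> c0; elim: K M M' f => [|K ih] M M' f hM [hd h]; split => //.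
- exact: (dominated_le c0 hM hd).
- exact: (dominated_le c0 hM hd).
- move=> i; have [g hg hS] := h i; exists g => //.
  apply: ih hS => x hx; rewrite mulrA ler_wpM2r ?powR_ge0//.
  exact: hM.
Qed.

Lemma Sym_eqw K M M' f :
  (forall x, ge1 x -> M x = M' x) -> Sym K M f -> Sym K M' f.
Proof. by move=> h; apply: (@Sym_le _ _ _ _ 1) => // x hx; rewrite mul1r h. Qed.

Lemma Sym_down K M f : Sym K.+1 M f -> Sym K M f.
Proof.
elim: K M f => [|K ih] M f [hd h]; first by split.
by split=> // i; have [g hg hS] := h i; exists g => //; exact: ih.
Qed.

Lemma Sym_add K M f g : Sym K M f -> Sym K M g -> Sym K M (fun s x => f s x + g s x).
Proof.
have hdom M' f' g' : dominated M' f' -> dominated M' g' ->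
    dominated M' (fun s x => f' s x + g' s x).
  move=> [c c0 hc] [d d0 hd]; exists (c + d); first exact: addr_ge0.
  by move=> s x hs hx; rewrite (le_trans (ND _ _))// mulrDl lerD ?hc ?hd.
elim: K M f g => [|K ih] M f g [hf1 hf2] [hg1 hg2]; split => //; try exact: hdom.
move=> i; have [f' hf hSf] := hf2 i; have [g' hg hSg] := hg2 i.
exists (fun s x => f' s x + g' s x); last exact: ih.
by move=> s hs; apply: pd_add; [exact: hf | exact: hg].
Qed.

Lemma Sym_mul K M M' f g : Sym K M f -> Sym K M' g ->
  Sym K (fun x => M x * M' x) (fun s x => f s x * g s x).
Proof.
have hdom M1 M2 f' g' : dominated M1 f' -> dominated M2 g' ->
    dominated (fun x => M1 x * M2 x) (fun s x => f' s x * g' s x).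
  move=> [c c0 hc] [d d0 hd]; exists (c * d); first exact: mulr_ge0.
  move=> s x hs hx; rewrite (le_trans (NM _ _))// mulrACA.
  by apply: ler_pM; rewrite ?N_ge0 ?hc ?hd.
elim: K M M' f g => [|K ih] M M' f g hf hg.
  by split => //; apply: hdom; [case: hf | case: hg].
have hf' := Sym_down hf; have hg' := Sym_down hg.
split; first by apply: hdom; [case: hf | case: hg].
case: hf hg => [_ hf2] [_ hg2] i.
have [f' hf hSf] := hf2 i; have [g' hg hSg] := hg2 i.
exists (fun s x => f' s x * g s x + f s x * g' s x).
  by move=> s hs; apply: pd_mul; [exact: hf | exact: hg].
apply: Sym_add.
  by apply: Sym_eqw (ih _ _ _ _ hSf hg') => x _; rewrite mulrAC.
by apply: Sym_eqw (ih _ _ _ _ hf' hSg) => x _; rewrite mulrA.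
Qed.

Lemma Sym_zero K M : (forall x, ge1 x -> 0 <= M x) -> Sym K M (fun _ _ => 0).
Proof.
elim: K M => [|K ih] M hM; split => //; try by exists 0 => // s x _ _; rewrite N0 mul0r.
move=> i; exists (fun _ _ => 0); first by move=> s _; exact: pd_cst.
by apply: ih => x hx; rewrite mulr_ge0 ?powR_ge0 ?hM.
Qed.

Lemma Sym_cst K M (z : S -> C) (c : R) : 0 <= c ->
  (forall s, B s -> N (z s) <= c) -> (forall x, ge1 x -> 1 <= M x) ->
  Sym K M (fun s _ => z s).
Proof.
move=> c0 hz hM.
have hd : dominated M (fun s _ => z s).
  exists c => // s x hs hx; rewrite (le_trans (hz _ hs))// ler_peMr// hM//.
case: K => [|K]; split => // i.
exists (fun s x => 0); first by move=> s _; exact: pd_cst.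
by apply: Sym_zero => x hx; rewrite mulr_ge0 ?powR_ge0// (le_trans _ (hM _ hx)).
Qed.

Lemma Sym_scale K M (z : S -> C) (c : R) f : 0 <= c ->
  (forall s, B s -> N (z s) <= c) -> Sym K M f ->
  Sym K M (fun s x => z s * f s x).
Proof.
move=> c0 hz hf.
have h1 : Sym K (fun=> 1) (fun s _ => z s) by exact: (@Sym_cst K (fun=> 1) z c).
by apply: Sym_eqw (Sym_mul h1 hf) => x _; rewrite mul1r.
Qed.

Lemma Sym_sum K M (I : Type) (r : seq I) (F : I -> S -> X -> C) :
  (forall x, ge1 x -> 0 <= M x) ->
  (forall i, Sym K M (F i)) -> Sym K M (fun s x => \sum_(i <- r) F i s x).
Proof.
move=> hM hF; elim: r => [|i r ih].
  rewrite (_ : (fun s x => _) = (fun _ _ => 0)); first exact: Sym_zero.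
  by apply/funext => s; apply/funext => x; rewrite big_nil.
rewrite (_ : (fun s x => _) = (fun s x => F i s x + \sum_(i <- r) F i s x)).
  exact: Sym_add.
by apply/funext => s; apply/funext => x; rewrite big_cons.
Qed.

(** The quotient rule writes the derivative of [1 / p] as a product of symbols of
    lower order, of weights [1 / p], [p x_i ^ (- eps)] and [1 / p]. *)
Lemma Sym_inv (p : X -> R) : (forall x, ge1 x -> 0 < p x) ->
  (forall K, Sym K p (fun _ x => (p x)%:C%C)) ->
  forall K, Sym K (fun x => (p x)^-1) (fun _ x => ((p x)^-1)%:C%C).
Proof.
move=> p0 hp K.
have hdom : dominated (fun x => (p x)^-1) (fun _ x => ((p x)^-1)%:C%C).
  exists 1 => // s x _ hx.
  by rewrite Nreal mul1r ger0_norm// invr_ge0 ltW// p0.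
elim: K => [|K ih]; split=> // i.
have [_ /(_ i)[g hg hS]] := hp K.+1.
exists (fun s x => - (g s x * ((p x)^-1)%:C * ((p x)^-1)%:C)%C).
  move=> s hs x hx; have h := hg s hs x hx.
  have := cder_inv_real h; rewrite sh0 => /(_ (lt0r_neq0 (p0 _ hx))).
  by [].
have h := Sym_mul (Sym_mul hS ih) ih.
have := @Sym_scale K _ (fun=> -1) 1 _ ler01 _ h.
rewrite (_ : (fun s x => -1 * _) = (fun s x => - (g s x * ((p x)^-1)%:C * ((p x)^-1)%:C)%C)); last first.
  by apply/funext => s; apply/funext => x; rewrite mulN1r.
move=> {}h; apply: Sym_eqw (h _) => [x hx|s _]; last first.
  by rewrite NN -[1]/(1%:C)%C Nreal normr1.
by have := lt0r_neq0 (p0 _ hx) => px; field.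
Qed.

Lemma pd_ln (p : X -> R) : (forall x, ge1 x -> 0 < p x) ->
  (forall K, Sym K p (fun _ x => (p x)%:C%C)) ->
  forall K i, exists2 g, (forall s, B s -> pd i (fun x => (ln (p x))%:C%C) (g s)) &
                         Sym K (fun x => x i `^ (- eps)) g.
Proof.
move=> p0 hp K i; have [_ /(_ i)[g hg hS]] := hp K.+1.
exists (fun s x => g s x * ((p x)^-1)%:C%C).
  move=> s hs x hx; have h := hg s hs x hx.
  by have := cder_ln_real h; rewrite sh0 => /(_ (p0 _ hx)).
apply: Sym_eqw (Sym_mul hS (Sym_inv p0 hp K)) => x hx.
by have := lt0r_neq0 (p0 _ hx) => px; field.
Qed.

(** Only the logarithm itself may grow: its derivative [p' / p] is bounded by
    [x_i ^ (- eps)], whence a separate weight [M]. *)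
Lemma Sym_ln (p : X -> R) M (c : R) : 0 <= c ->
  (forall x, ge1 x -> 0 < p x) ->
  (forall K, Sym K p (fun _ x => (p x)%:C%C)) ->
  (forall x, ge1 x -> 1 <= M x) ->
  (forall x, ge1 x -> `|ln (p x)| <= c * M x) ->
  forall K, Sym K M (fun _ x => (ln (p x))%:C%C).
Proof.
move=> c0 p0 hp hM hc K.
have hd : dominated M (fun _ x => (ln (p x))%:C%C).
  by exists c => // s x _ hx; rewrite Nreal hc.
case: K => [|K]; split=> // i.
have [g hg hS] := pd_ln p0 hp K i; exists g => //.
apply: (@Sym_le _ _ _ _ 1) hS => // x hx.
by rewrite mul1r ler_peMl ?powR_ge0// hM.
Qed.

(** Differentiating multiplies the exponential by derivatives of the exponent, which
    only gain, so a bound on the exponential alone makes it a symbol. *)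
Lemma Sym_cexp M (G : S -> X -> C) :
  (forall K i, exists2 g, (forall s, B s -> pd i (G s) (g s)) &
                          Sym K (fun x => x i `^ (- eps)) g) ->
  dominated M (fun s x => cexp (G s x)) ->
  forall K, Sym K M (fun s x => cexp (G s x)).
Proof.
move=> hG hd; elim=> [|K ih]; split=> // i.
have [g hg hS] := hG K i.
exists (fun s x => g s x * cexp (G s x)).
  move=> s hs x hx; have := cder_cexp (hg s hs x hx).
  by rewrite sh0.
by apply: Sym_eqw (Sym_mul hS ih) => x _; rewrite mulrC.
Qed.

End Classes.

Lemma Sym_reparam (S S' : Type) (B : S -> Prop) (B' : S' -> Prop) (pi : S' -> S)
    K M f : (forall s, B' s -> B (pi s)) ->
  Sym B K M f -> Sym B' K M (fun s => f (pi s)).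
Proof.
move=> hpi; elim: K M f => [|K ih] M f [[c c0 hc] h]; split => //.
- by exists c => // s x hs; apply: hc; exact: hpi.
- by exists c => // s x hs; apply: hc; exact: hpi.
- move=> i; have [g hg hS] := h i; exists (fun s => g (pi s)); last exact: ih.
  by move=> s hs; apply: hg; exact: hpi.
Qed.

Definition W (al : 'I_n -> R) (x : X) : R := \prod_(i < n) x i `^ al i.

Lemma W_ge0 al x : 0 <= W al x.
Proof. by apply: prodr_ge0 => i _; exact: powR_ge0. Qed.

Lemma WD al be x : ge1 x -> W al x * W be x = W (fun i => al i + be i) x.
Proof.
move=> hx; rewrite /W -big_split /=; apply: eq_bigr => i _.
by rewrite powRD// (lt0r_neq0 (ge1_gt0 i hx)) implybT.
Qed.

Lemma W_le al be x : ge1 x -> (forall i, al i <= be i) -> W al x <= W be x.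
Proof.
move=> hx h; apply: ler_prod => i _.
by rewrite powR_ge0 ler_powR// hx.
Qed.

Lemma W_ge1 al x : ge1 x -> (forall i, 0 <= al i) -> 1 <= W al x.
Proof.
move=> hx h; rewrite (_ : 1 = W (fun=> 0) x); first exact: W_le.
by rewrite /W big1// => i _; rewrite powRr0.
Qed.

Definition unitv (i : 'I_n) (r : R) : 'I_n -> R := fun k => (k == i)%:R * r.

Lemma W_unitv i r x : W (unitv i r) x = x i `^ r.
Proof.
rewrite /W (bigD1 i)//= /unitv eqxx mul1r big1 ?mulr1// => k /negbTE ->.
by rewrite mul0r powRr0.
Qed.

Definition dec (al : 'I_n -> R) (i : 'I_n) (r : R) : 'I_n -> R :=
  fun k => al k - (k == i)%:R * r.

Lemma W_dec al i r x : ge1 x -> W (dec al i r) x = W al x * x i `^ (- r).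
Proof.
move=> hx; rewrite -W_unitv WD//; congr W; apply/funext => k.
by rewrite /dec /unitv mulrN.
Qed.

Lemma W_sh al i (T : R) : 0 <= T -> exists2 c : R, 0 <= c &
  forall x t, ge1 x -> 0 <= t <= T -> W al (sh x i t) <= c * W al x.
Proof.
move=> T0; exists ((1 + T) `^ `|al i|); first exact: powR_ge0.
move=> x t hx /andP[t0 tT].
rewrite /W (bigD1 i)//= [in leRHS](bigD1 i)//= mulrA.
rewrite [in leLHS](eq_bigr (fun k => x k `^ al k)); last first.
  by move=> k /negbTE ki; rewrite /sh ki mul0r addr0.
rewrite ler_wpM2r ?prodr_ge0// => [k _|]; first exact: powR_ge0.
have xi := hx i.
rewrite /sh eqxx mul1r; case: (leP 0 (al i)) => ai.
  rewrite (ger0_norm ai).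
  have x0 : 0 <= x i := le_trans ler01 xi.
  have T1 : 0 <= 1 + T by rewrite addr_ge0.
  rewrite -powRM//; apply: ge0_ler_powR; rewrite ?nnegrE ?mulr_ge0 ?addr_ge0//.
  by rewrite mulrDl mul1r lerD2l (le_trans tT)// ler_peMr.
apply: (@le_trans _ _ (x i `^ al i)).
  have [b b0 ->] : exists2 b, 0 <= b & al i = - b.
    by exists (- al i); rewrite ?opprK// oppr_ge0 ltW.
  have x0 : 0 < x i := lt_le_trans ltr01 xi.
  have xt0 : 0 < x i + t by rewrite ltr_pwDl.
  rewrite !powRN lef_pV2 ?posrE ?powR_gt0//.
  by apply: ge0_ler_powR; rewrite ?nnegrE ?(ltW x0) ?(ltW xt0)// lerDl.
rewrite ler_peMl ?powR_ge0//.
rewrite -[leLHS](powRr0 (1 + T)) ler_powR// lerDl//.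
Qed.

(** By the mean value inequality a difference of step at most 1 gains as much as a
    derivative. The step may depend on the parameter: it becomes a parameter in
    [gregory_remainder]. *)
Lemma Sym_diff (S : Type) (B : S -> Prop) K al (f : S -> X -> C) i (h : S -> R) :
  (forall s, B s -> 0 <= h s <= 1) -> Sym B K.+1 (W al) f ->
  Sym B K (W (dec al i eps)) (fun s x => f s (sh x i (h s)) - f s x).
Proof.
move=> hh.
have hdom (al' : 'I_n -> R) f' : Sym B 1 (W al') f' ->
    dominated B (W (dec al' i eps)) (fun s x => f' s (sh x i (h s)) - f' s x).
  move=> [_ /(_ i)[g hg [[c c0 hc] _]]].
  have [d d0 hd] := W_sh (dec al' i eps) i (@ler01 R).
  exists (2 * (c * d)); first by rewrite !mulr_ge0.
  move=> s x hs hx; have /andP[h0 h1] := hh s hs.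
  have := @MVT_complex R (fun t => f' s (sh x i t)) (fun t => g s (sh x i t))
    (h s) (c * d * W (dec al' i eps) x) h0.
  rewrite sh0 => /(_ _ _)/le_trans; apply.
  - by move=> t /andP[t0 _]; exact: pd_at (hg s hs) hx t0.
  - move=> t /andP[t0 th].
    apply: le_trans (hc _ _ hs (sh_ge1 i hx t0)) _.
    rewrite -W_dec; last exact: sh_ge1.
    by rewrite -mulrA ler_wpM2l// hd// t0 (le_trans th).
  - rewrite -!mulrA ler_wpM2l// ler_piMl//.
    by rewrite !mulr_ge0 ?W_ge0.
have hdown K' (al' : 'I_n -> R) f' : Sym B K'.+1 (W al') f' -> Sym B 1 (W al') f'.
  by elim: K' => // K' ih /Sym_down.
elim: K al f => [|K ih] al f hf; first by split=> //; exact/hdom/hdown/hf.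
split; first exact/hdom/hdown/hf.
move=> j; have [g hg hS] := SymS j hf.
exists (fun s x => g s (sh x i (h s)) - g s x).
  move=> s hs; have /andP[h0 h1] := hh s hs.
  by apply: pd_sub; [apply: pd_shift (hg _ hs) | exact: hg].
have hS' : Sym B K.+1 (W (dec al j eps)) g.
  by apply: Sym_eqw hS => x hx; rewrite W_dec.
apply: Sym_eqw (ih _ _ hS') => x hx.
by rewrite !W_dec// mulrAC.
Qed.

End Symbols.

(** * Gregory's formula *)

Section Gregory.
Variables (R : realType) (n : nat) (eps : R).
Hypothesis eps_gt0 : 0 < eps.
Notation C := R[i].
Notation X := ('I_n -> R).

Fixpoint dif (i : 'I_n) (h : R) (r : nat) (f : X -> C) (x : X) : C :=
  if r is r'.+1 then dif i h r' f (sh x i h) - dif i h r' f x else f x.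

Lemma dec_dec (al : 'I_n -> R) i a b : dec (dec al i a) i b = dec al i (a + b).
Proof. by apply/funext => k; rewrite /dec mulrDr opprD addrA. Qed.

Lemma dec0 (al : 'I_n -> R) i : dec al i 0 = al.
Proof. by apply/funext => k; rewrite /dec mulr0 subr0. Qed.

Lemma Sym_dif (S : Type) (B : S -> Prop) K r al (f : S -> X -> C) i (h : S -> R) :
  (forall s, B s -> 0 <= h s <= 1) -> Sym eps B (r + K)%N (W al) f ->
  Sym eps B K (W (dec al i (r%:R * eps))) (fun s => dif i (h s) r (f s)).
Proof.
move=> hh; elim: r K => [|r ih] K hf; first by rewrite mul0r dec0.
rewrite -natr1 mulrDl mul1r -dec_dec.
by apply: Sym_diff => //; apply: ih; rewrite addnS.
Qed.

Lemma dif_step0 i r f x : dif i 0 r.+1 f x = 0.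
Proof. by rewrite /= sh0 subrr. Qed.

(** Differentiating in the step brings out differences of [H'] of the orders [r] and
    [r - 1]; for [a = 0] only the latter, shifted, remains, whence the telescoping in
    [gregory_remainder]. *)
Lemma dif_cder i (H H' : X -> C) (r a : nat) x u : pd i H H' -> ge1 x -> 0 <= u ->
  cder (fun v => dif i v r H (sh x i (a%:R * v))) u
       (a%:R * dif i u r H' (sh x i (a%:R * u)) +
        r%:R * dif i u r.-1 H' (sh x i (a.+1%:R * u))).
Proof.
move=> hH hx u0; elim: r a => [|r ih] a /=.
  have h0 : 0 <= a%:R * u by rewrite mulr_ge0.
  have h := pd_at hH hx h0.
  have hl : is_derive u (1 : R) (fun v : R => a%:R * v) (a%:R * 1 + u * 0).
    by apply: is_derive_mul.
  rewrite mulr1 mulr0 addr0 in hl.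
  apply: cder_congr (cder_comp hl h) _.
  by rewrite mul0r addr0 rmorph_nat.
have e (w : R) : sh (sh x i (a%:R * w)) i w = sh x i (a.+1%:R * w).
  by rewrite shD -[in RHS]addn1 natrD mulrDl mul1r.
apply: cder_ext (cder_congr (cder_sub (ih a.+1) (ih a)) _) _; last by move=> v; rewrite e.
have key : r%:R * (dif i u r.-1 H' (sh x i (a.+2%:R * u)) -
    dif i u r.-1 H' (sh x i (a.+1%:R * u))) = r%:R * dif i u r H' (sh x i (a.+1%:R * u)).
  case: r {ih} => [|r]; first by rewrite !mul0r.
  congr (_ * _); rewrite [RHS]/= shD (_ : a.+1%:R * u + u = a.+2%:R * u)//.
  by rewrite -(natr1 a.+1) mulrDl mul1r.
rewrite !e -(natr1 a) -(natr1 r).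
move: key; set E2 := dif i u r.-1 H' (sh x i (a.+2%:R * u)).
set E1 := dif i u r.-1 H' _; set D1 := dif i u r H' _; set D0 := dif i u r H' _.
by rewrite mulrBr => /eqP; rewrite subr_eq => /eqP ->; ring.
Qed.

Lemma dif_alternating i u (G : X -> C) (L : nat) x :
  \sum_(r < L) (-1) ^+ r * dif i u r G (sh x i u) = G x - (-1) ^+ L * dif i u L G x.
Proof.
elim: L => [|L ih]; first by rewrite big_ord0 mul1r subrr.
by rewrite big_ord_recr /= ih exprS; ring.
Qed.

(** Gregory's formula: the derivation is [log (1 + Delta)], so the difference of
    [greg i L H] is the start of its expansion and approximates the derivative
    of [H]. *)
Definition greg (i : 'I_n) (L : nat) (H : X -> C) (x : X) : C :=
  \sum_(r < L) ((-1) ^+ r / r.+1%:R) * dif i 1 r H x.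

Lemma greg_step i L H x :
  greg i L H (sh x i 1) - greg i L H x =
  \sum_(r < L) ((-1) ^+ r / r.+1%:R) * dif i 1 r.+1 H x.
Proof. by rewrite /greg -sumrB; apply: eq_bigr => r _; rewrite -mulrBr. Qed.

Lemma greg_next i L H x :
  greg i L.+1 H x - greg i L H x = ((-1) ^+ L / L.+1%:R) * dif i 1 L H x.
Proof. by rewrite /greg big_ord_recr /= addrAC subrr add0r. Qed.

(** The steps of [phi u = u H' - \sum_r (-1)^r / (r + 1) Delta_u^(r+1) H] telescope
    after differentiation in [u], leaving one difference of order [L] of [H']. *)
Lemma gregory_remainder (S : Type) (B : S -> Prop) L al (H h : S -> X -> C) i :
  Sym eps B L.+1 (W al) H -> (forall s, B s -> pd i (H s) (h s)) ->
  dominated B (W (dec al i (L.+1%:R * eps)))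
    (fun s x => h s x - (greg i L (H s) (sh x i 1) - greg i L (H s) x)).
Proof.
move=> hH hd.
have [g hg hS] := SymS i hH.
have {}hS : Sym eps B (L + 0) (W (dec al i eps)) g.
  by rewrite addn0; apply: Sym_eqw hS => x hx; rewrite W_dec.
pose B' (p : S * R) := B p.1 /\ 0 <= p.2 <= 1.
have hB' (p : S * R) : B' p -> B p.1 by case.
have hS' := Sym_reparam hB' hS.
have hu (p : S * R) : B' p -> 0 <= p.2 <= 1 by case.
have [c c0 hc] := Sym_dom (@Sym_dif _ B' 0 L _ _ i (fun p => p.2) hu hS').
exists (2 * c); first by rewrite mulr_ge0.
move=> s x hs hx.
have -> : h s x = g s x by exact: cder_unique (hd s hs x hx) (hg s hs x hx).
pose phi (u : R) := (u%:C%C) * g s x -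
   \sum_(r < L) ((-1) ^+ r / r.+1%:R) * dif i u r.+1 (H s) (sh x i (0%:R * u)).
have -> : g s x - (greg i L (H s) (sh x i 1) - greg i L (H s) x) = phi 1 - phi 0.
  have -> : phi 0 = 0.
    rewrite /phi mul0r big1 ?subr0// => r _.
    by rewrite dif_step0 mulr0.
  by rewrite subr0 greg_step /phi mul1r mul0r sh0.
have := @MVT_complex R phi (fun u => (-1) ^+ L * dif i u L (g s) x) 1
  (c * W (dec al i (L.+1%:R * eps)) x) ler01.
rewrite !mulr1 mulrA; apply.
- move=> u /andP[u0 u1].
  have h1 := cder_scale (g s x) (cder_id u).
  have h2 (r : 'I_L) := cder_scale ((-1) ^+ r / r.+1%:R)
     (dif_cder r.+1 0 (hg s hs) hx u0).
  apply: cder_ext (cder_congr (cder_sub h1 (cder_sum (index_enum _) h2)) _) _ => [|v].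
    rewrite mulr1 -[LHS](addrC (- _)) addrC.
    rewrite (eq_bigr (fun r : 'I_L => (-1) ^+ r * dif i u r (g s) (sh x i u))).
      by rewrite dif_alternating opprB addrC subrK.
    move=> r _; rewrite mul0r add0r /= mul1r mulrA -[_ / _ * _]mulrA mulVf ?mulr1//.
  by rewrite /phi mulrC.
- move=> u hu1.
  have := hc (s, u) x (conj hs hu1) hx.
  rewrite dec_dec (_ : eps + L%:R * eps = L.+1%:R * eps); last first.
    by rewrite -[L.+1]addn1 natrD; ring.
  by rewrite -signr_odd; case: (odd L); rewrite ?expr0 ?expr1 ?mul1r ?mulN1r ?NN.
Qed.

Lemma Sym_greg (S : Type) (B : S -> Prop) K L al (H : S -> X -> C) i :
  (forall K', Sym eps B K' (W al) H) ->
  Sym eps B K (W al) (fun s => greg i L (H s)).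
Proof.
move=> hH; apply: Sym_sum => [x _|r]; first exact: W_ge0.
apply: (@Sym_scale _ _ _ _ _ _ _ (fun=> (-1) ^+ r / r.+1%:R) (N ((-1) ^+ r / r.+1%:R : C))).
- exact: N_ge0.
- by [].
- apply: (@Sym_le _ _ _ _ _ _ (W (dec al i (r%:R * eps))) _ _ 1 ler01).
    move=> x hx; rewrite mul1r W_le// => k; rewrite /dec gerBl.
    by rewrite mulr_ge0 ?mulr_ge0// ltW.
  apply: (@Sym_dif _ _ _ _ _ _ _ (fun=> 1)); last exact: hH.
  by move=> s _; rewrite ler01 lexx.
Qed.

Lemma dif_sub i h r (f g : X -> C) x :
  dif i h r (fun y => f y - g y) x = dif i h r f x - dif i h r g x.
Proof. by elim: r x => [//|r ih] x /=; rewrite !ih; ring. Qed.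

Lemma dif_shift i h r j t (f : X -> C) x :
  dif i h r (fun y => f (sh y j t)) x = dif i h r f (sh x j t).
Proof. by elim: r x => [//|r ih] x /=; rewrite !ih shC. Qed.

Lemma greg_diff i L j t (H : X -> C) x :
  greg i L (fun y => H (sh y j t) - H y) x = greg i L H (sh x j t) - greg i L H x.
Proof.
rewrite /greg -sumrB; apply: eq_bigr => r _.
by rewrite dif_sub dif_shift mulrBr.
Qed.

End Gregory.

(** * Symbols on the lattice and summation by parts *)

Section Lattice.
Variables (R : realType) (n : nat) (eps : R).
Hypothesis eps_gt0 : 0 < eps.
Variable tw : pred 'I_n.
Notation C := R[i].
Notation X := ('I_n -> R).
Notation Lat := {ffun 'I_n -> nat}.

(* The summation index [m_i] of the series is [m i + 1]. *)
Definition pt (m : Lat) : X := fun i => (m i).+1%:R.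

Definition bump (m : Lat) (j : 'I_n) : Lat := [ffun k => (m k + (k == j))%N].

Lemma pt_ge1 m : ge1 (pt m).
Proof. by move=> i; rewrite /pt ler1n. Qed.

Lemma pt_bump m j : pt (bump m j) = sh (pt m) j 1.
Proof.
apply/funext => k; rewrite /pt /sh ffunE mulr1 -addSn natrD.
by [].
Qed.

Lemma bumpC m i j : bump (bump m i) j = bump (bump m j) i.
Proof. by apply/ffunP => k; rewrite !ffunE addnAC. Qed.

Definition dl (j : 'I_n) (F : Lat -> C) (m : Lat) : C := F (bump m j) - F m.

Definition ldom (S : Type) (B : S -> Prop) (al : 'I_n -> R) (F : S -> Lat -> C) :=
  exists2 c : R, 0 <= c & forall s m, B s -> N (F s m) <= c * W al (pt m).

(** The discrete analogue of [Sym], with differences in the twisted directions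
    in place of the derivatives. *)
Fixpoint LatSym (S : Type) (B : S -> Prop) (K : nat) al (F : S -> Lat -> C) : Prop :=
  ldom B al F /\
  if K is K'.+1 then
    forall i, tw i -> LatSym B K' (dec al i eps) (fun s => dl i (F s))
  else True.

Section OneFamily.
Variables (S : Type) (B : S -> Prop).
Implicit Types F G : S -> Lat -> C.

Lemma LatSym_dom K al F : LatSym B K al F -> ldom B al F.
Proof. by case: K => [|K] []. Qed.

Lemma LatSymS K al F i : tw i -> LatSym B K.+1 al F -> LatSym B K (dec al i eps) (fun s => dl i (F s)).
Proof. by move=> ti [_ /(_ i ti)]. Qed.

Lemma ldom_le al be F : (forall i, al i <= be i) -> ldom B al F -> ldom B be F.
Proof.
move=> h [c c0 hc]; exists c => // s m hs.
by rewrite (le_trans (hc _ _ hs))// ler_wpM2l// W_le//; exact: pt_ge1.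
Qed.

Lemma LatSym_le K al be F : (forall i, al i <= be i) -> LatSym B K al F -> LatSym B K be F.
Proof.
elim: K al be F => [|K ih] al be F h [hd hF]; split => //; try exact: ldom_le hd.
move=> i ti; apply: ih (hF i ti) => k.
by rewrite /dec lerD2r.
Qed.

Lemma ldom_add al F G : ldom B al F -> ldom B al G ->
  ldom B al (fun s m => F s m + G s m).
Proof.
move=> [c c0 hc] [d d0 hd]; exists (c + d); first exact: addr_ge0.
by move=> s m hs; rewrite (le_trans (ND _ _))// mulrDl lerD ?hc ?hd.
Qed.

Lemma LatSym_add K al F G : LatSym B K al F -> LatSym B K al G ->
  LatSym B K al (fun s m => F s m + G s m).
Proof.
elim: K al F G => [|K ih] al F G [hF1 hF2] [hG1 hG2]; split=> //; try exact: ldom_add.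
move=> i ti; have := ih _ _ _ (hF2 i ti) (hG2 i ti).
rewrite (_ : (fun s m => dl i (F s) m + dl i (G s) m) =
  (fun s => dl i (fun m => F s m + G s m)))//.
by apply/funext => s; apply/funext => m; rewrite /dl opprD addrACA.
Qed.

Lemma LatSym_scale K al (z : S -> C) (c : R) F : 0 <= c -> (forall s, B s -> N (z s) <= c) ->
  LatSym B K al F -> LatSym B K al (fun s m => z s * F s m).
Proof.
move=> c0 hz.
have hdom al' F' : ldom B al' F' -> ldom B al' (fun s m => z s * F' s m).
  move=> [d d0 hd]; exists (c * d); first exact: mulr_ge0.
  move=> s m hs; rewrite (le_trans (NM _ _))// -mulrA.
  by apply: ler_pM; rewrite ?N_ge0 ?hz ?hd.
elim: K al F => [|K ih] al F [hF1 hF2]; split=> //; try exact: hdom.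
move=> i ti; have := ih _ _ (hF2 i ti).
rewrite (_ : (fun s m => z s * dl i (F s) m) = (fun s => dl i (fun m => z s * F s m)))//.
by apply/funext => s; apply/funext => m; rewrite /dl mulrBr.
Qed.

Lemma LS0 K al : LatSym B K al (fun _ _ => 0).
Proof.
have hd al' : ldom B al' (fun _ _ => 0).
  by exists 0 => // s m _; rewrite N0 mul0r.
elim: K al => [|K ih] al; split=> // i ti.
have := ih (dec al i eps).
rewrite (_ : (fun (s : S) => dl i (fun=> 0)) = (fun _ _ => 0))//.
by apply/funext => s; apply/funext => m; rewrite /dl subr0.
Qed.

Lemma LatSym_sum K al (I : Type) (r : seq I) (F : I -> S -> Lat -> C) :
  (forall i, LatSym B K al (F i)) -> LatSym B K al (fun s m => \sum_(i <- r) F i s m).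
Proof.
move=> h; elim: r => [|i r ih].
  rewrite (_ : (fun s m => _) = (fun _ _ => 0)); first exact: LS0.
  by apply/funext => s; apply/funext => m; rewrite big_nil.
rewrite (_ : (fun s m => _) = (fun s m => F i s m + \sum_(i <- r) F i s m)).
  exact: LatSym_add.
by apply/funext => s; apply/funext => m; rewrite big_cons.
Qed.

Lemma LatSym_iter K al F i r : tw i -> LatSym B (r + K) al F ->
  LatSym B K (dec al i (r%:R * eps)) (fun s => iter r (dl i) (F s)).
Proof.
move=> ti; elim: r K => [|r ih] K hF; first by rewrite mul0r dec0.
rewrite -addn1 natrD mulrDl mul1r -dec_dec addn1.
by apply: (@LatSymS _ _ (fun s => iter r (dl i) (F s))) => //; apply: ih; rewrite addnS.
Qed.

Lemma LatSym_Sym K al (f : S -> X -> C) :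
  Sym eps B K (W al) f -> LatSym B K al (fun s m => f s (pt m)).
Proof.
have hd K' al' f' : Sym eps B K' (W al') f' -> ldom B al' (fun s m => f' s (pt m)).
  move=> /Sym_dom[c c0 hc]; exists c => // s m hs.
  by apply: hc => //; exact: pt_ge1.
elim: K al f => [|K ih] al f hf; split => //; try exact: hd hf.
move=> i ti.
have h1 : forall s, B s -> 0 <= (fun _ : S => 1 : R) s <= 1.
  by move=> s _; rewrite ler01 lexx.
have := ih _ _ (Sym_diff i h1 hf).
rewrite (_ : (fun s m => _) = (fun s => dl i (fun m => f s (pt m))))//.
by apply/funext => s; apply/funext => m; rewrite /dl pt_bump.
Qed.

(** Setting [V] to 0 on the face [m_i = 0] makes the sum over [m_i] of [dl i (cut i V)]
    vanish, instead of being a boundary term. *)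
Definition cut (i : 'I_n) (V : Lat -> C) (m : Lat) : C := if m i == 0%N then 0 else V m.

(** The derivative [h] of [H] minus a difference with vanishing sum. It is small off the
    face [m_i0 = 0] by [gregory_remainder]; on it there is a boundary term besides. *)
Definition greg_rem (i0 : 'I_n) (L : nat) (H h : X -> C) (m : Lat) : C :=
  h (pt m) - dl i0 (cut i0 (fun m' => greg i0 L H (pt m'))) m.

Lemma greg_remE i0 L H h m : greg_rem i0 L H h m =
  (h (pt m) - (greg i0 L H (sh (pt m) i0 1) - greg i0 L H (pt m)))
  - (if m i0 == 0%N then greg i0 L H (pt m) else 0).
Proof.
rewrite /greg_rem /dl /cut ffunE eqxx addn1 /= pt_bump.
by case: eqP => _; rewrite ?subr0//; ring.
Qed.

(** The variable [x_i] is 1 on the face [m_i = 0], so its exponent is irrelevant there: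
    boundary terms need not decay in the direction in which they arise. *)
Lemma W_boundary (al be : 'I_n -> R) (m : Lat) i : m i = 0%N ->
  (forall k, k != i -> al k <= be k) -> W al (pt m) <= W be (pt m).
Proof.
move=> mi h; rewrite /W (bigD1 i)//= [leRHS](bigD1 i)//= /pt mi !powR1 !mul1r.
by apply: ler_prod => k ki; rewrite powR_ge0 ler_powR ?h// ler1n.
Qed.

Lemma LatSym_greg_rem K L al be (H h : S -> X -> C) i0 : ~~ tw i0 ->
  (forall K', Sym eps B K' (W al) H) -> (forall s, B s -> pd i0 (H s) (h s)) ->
  (forall k, k != i0 -> al k <= be k) -> al i0 - L.+1%:R * eps <= be i0 ->
  LatSym B K be (fun s => greg_rem i0 L (H s) (h s)).
Proof.
move=> nt.
have hdom al' be' H' h' : (forall K', Sym eps B K' (W al') H') ->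
    (forall s, B s -> pd i0 (H' s) (h' s)) ->
    (forall k, k != i0 -> al' k <= be' k) -> al' i0 - L.+1%:R * eps <= be' i0 ->
    ldom B be' (fun s => greg_rem i0 L (H' s) (h' s)).
  move=> hS hd h1 h2.
  have [c c0 hc] := gregory_remainder (hS L.+1) hd.
  have [e e0 he] := Sym_dom (Sym_greg eps_gt0 0 L i0 hS).
  exists (c + e); first exact: addr_ge0.
  move=> s m hs; rewrite greg_remE (le_trans (NB _ _))// mulrDl lerD//.
    rewrite (le_trans (hc _ _ hs (pt_ge1 m)))// ler_wpM2l// W_le//; first exact: pt_ge1.
    move=> k; rewrite /dec; have [->|ki] := eqVneq k i0; first by rewrite mul1r.
    by rewrite mul0r subr0 h1.
  case: eqP => [mi|_]; last by rewrite N0 mulr_ge0 ?W_ge0.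
  rewrite (le_trans (he _ _ hs (pt_ge1 m)))// ler_wpM2l//.
  exact: W_boundary mi h1.
elim: K al be H h => [|K ih] al be H h hS hd h1 h2; split => //; try exact: (hdom al).
move=> i ti.
have ii0 : i0 != i by apply: contraNneq nt => ->.
have hh : forall s, B s -> 0 <= (fun _ : S => 1 : R) s <= 1.
  by move=> s _; rewrite ler01 lexx.
have := ih (dec al i eps) (dec be i eps) (fun s x => H s (sh x i 1) - H s x)
  (fun s x => h s (sh x i 1) - h s x).
rewrite (_ : (fun s => greg_rem i0 L _ _) = (fun s => dl i (greg_rem i0 L (H s) (h s)))).
  apply.
  - by move=> K'; apply: (Sym_diff i hh).
  - move=> s hs; apply: pd_sub; last exact: hd.
    by apply: pd_shift => //; exact: hd.
  - by move=> k ki; rewrite /dec lerD2r h1.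
  - by rewrite /dec (negbTE ii0) mul0r !subr0.
apply/funext => s; apply/funext => m.
rewrite [in RHS]/dl !greg_remE !greg_diff !pt_bump ffunE (negbTE ii0) addn0 !(shC _ i i0).
by case: eqP => _; ring.
Qed.

End OneFamily.

Section Twist.
Variables (lam mu : 'I_n -> C).

(** Summation by parts in the variable [j], repeated [K] times: for [mu_j <> 1] and
    [lam j = mu_j / (1 - mu_j)], the sum of [mu_j ^ (m_j + 1) F m] over [m_j] is that of
    [by_part K j F], where [F] is replaced by its [K]-th difference but for terms on the
    face [m_j = 0]. *)
Definition by_part (K : nat) (j : 'I_n) (F : Lat -> C) (m : Lat) : C :=
  (if m j == 0%N then \sum_(r < K) lam j ^+ r.+1 * iter r (dl j) F m else 0) +
  lam j ^+ K * mu j ^+ (m j).+1 * iter K (dl j) F m.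

Fixpoint by_parts (ka : 'I_n -> nat) (l : seq 'I_n) (F : Lat -> C) : Lat -> C :=
  if l is j :: l' then by_parts ka l' (by_part (ka j) j F) else F.

Lemma dlC i j (F : Lat -> C) : dl i (dl j F) = dl j (dl i F).
Proof. by apply/funext => m; rewrite /dl bumpC; ring. Qed.

Lemma iter_dlC i j r (F : Lat -> C) : iter r (dl i) (dl j F) = dl j (iter r (dl i) F).
Proof. by elim: r => [//|r ih] /=; rewrite ih dlC. Qed.

Lemma dl_add j (F G : Lat -> C) :
  dl j (fun m => F m + G m) = (fun m => dl j F m + dl j G m).
Proof. by apply/funext => m; rewrite /dl opprD addrACA. Qed.

Lemma iter_dl_add j r (F G : Lat -> C) :
  iter r (dl j) (fun m => F m + G m) = (fun m => iter r (dl j) F m + iter r (dl j) G m).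
Proof. by elim: r => [//|r ih] /=; rewrite ih dl_add. Qed.

Lemma by_part_add K j (F G : Lat -> C) :
  by_part K j (fun m => F m + G m) = (fun m => by_part K j F m + by_part K j G m).
Proof.
apply/funext => m; rewrite /by_part !iter_dl_add mulrDr [RHS]addrACA; congr (_ + _).
case: eqP => _; rewrite ?addr0// -big_split; apply: eq_bigr => r _ /=.
by rewrite iter_dl_add mulrDr.
Qed.

Lemma by_parts_add ka l (F G : Lat -> C) :
  by_parts ka l (fun m => F m + G m) = (fun m => by_parts ka l F m + by_parts ka l G m).
Proof. by elim: l F G => [//|j l ih] F G /=; rewrite by_part_add ih. Qed.

(* Coefficients depending on [m i] only commute with the operators in the other
   variables; the constants are the case of a constant function [z]. *)
Lemma iter_dl_coef i j r (z : nat -> C) (F : Lat -> C) : i != j ->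
  iter r (dl j) (fun m => z (m i) * F m) = (fun m => z (m i) * iter r (dl j) F m).
Proof.
move=> ij; elim: r => [//|r ih] /=; rewrite ih; apply/funext => m.
by rewrite /dl ffunE (negbTE ij) addn0 mulrBr.
Qed.

Lemma iter_dl_scale j r (z : C) (F : Lat -> C) :
  iter r (dl j) (fun m => z * F m) = (fun m => z * iter r (dl j) F m).
Proof.
elim: r => [//|r ih] /=; rewrite ih; apply/funext => m.
by rewrite /dl mulrBr.
Qed.

Lemma by_part_coef K i j (z : nat -> C) (F : Lat -> C) : i != j ->
  by_part K j (fun m => z (m i) * F m) = (fun m => z (m i) * by_part K j F m).
Proof.
move=> ij; apply/funext => m; rewrite /by_part iter_dl_coef// mulrDr [in RHS]mulrCA.
congr (_ + _); case: eqP => _; rewrite ?mulr0// mulr_sumr; apply: eq_bigr => r _.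
by rewrite iter_dl_coef// mulrCA.
Qed.

Lemma by_part_scale K j (z : C) (F : Lat -> C) :
  by_part K j (fun m => z * F m) = (fun m => z * by_part K j F m).
Proof.
apply/funext => m; rewrite /by_part iter_dl_scale mulrDr [in RHS]mulrCA.
congr (_ + _); case: eqP => _; rewrite ?mulr0// mulr_sumr; apply: eq_bigr => r _.
by rewrite iter_dl_scale mulrCA.
Qed.

Lemma by_parts_scale ka l (z : C) (F : Lat -> C) :
  by_parts ka l (fun m => z * F m) = (fun m => z * by_parts ka l F m).
Proof. by elim: l F => [//|j l ih] F /=; rewrite by_part_scale ih. Qed.

Lemma by_parts_coef ka l i (z : nat -> C) (F : Lat -> C) : i \notin l ->
  by_parts ka l (fun m => z (m i) * F m) = (fun m => z (m i) * by_parts ka l F m).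
Proof.
elim: l F => [//|j l ih] F; rewrite inE negb_or => /andP[ij il] /=.
by rewrite by_part_coef// ih.
Qed.

Lemma by_part_dl K i j (F : Lat -> C) : i != j -> by_part K j (dl i F) = dl i (by_part K j F).
Proof.
move=> ij; apply/funext => m.
have ji : (j == i) = false by rewrite eq_sym (negbTE ij).
rewrite [RHS]/dl /by_part !iter_dlC ffunE ji addn0.
rewrite /dl mulrBr opprD addrACA; congr (_ + _).
case: eqP => _; rewrite ?subr0// -sumrB; apply: eq_bigr => r _.
by rewrite iter_dlC /dl mulrBr.
Qed.

Lemma by_parts_dl ka l i (F : Lat -> C) : i \notin l ->
  by_parts ka l (dl i F) = dl i (by_parts ka l F).
Proof.
elim: l F => [//|j l ih] F; rewrite inE negb_or => /andP[ij il] /=.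
by rewrite by_part_dl// ih.
Qed.

Lemma bops0 ka l : by_parts ka l (fun=> 0) = (fun=> 0).
Proof.
have := by_parts_scale ka l 0 (fun=> 0).
rewrite mul0r => ->; apply/funext => m; by rewrite mul0r.
Qed.

Lemma by_parts_sum ka l (I : Type) (r : seq I) (F : I -> Lat -> C) :
  by_parts ka l (fun m => \sum_(i <- r) F i m) = (fun m => \sum_(i <- r) by_parts ka l (F i) m).
Proof.
elim: r => [|i r ih].
  rewrite (_ : (fun m => _) = (fun=> 0)) ?bops0; last first.
    by apply/funext => m; rewrite big_nil.
  by apply/funext => m; rewrite big_nil.
rewrite (_ : (fun m => _) = (fun m => F i m + \sum_(i <- r) F i m)); last first.
  by apply/funext => m; rewrite big_cons.
by rewrite by_parts_add ih; apply/funext => m; rewrite big_cons.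
Qed.

Lemma by_parts_cat ka l1 l2 (F : Lat -> C) : by_parts ka (l1 ++ l2) F = by_parts ka l2 (by_parts ka l1 F).
Proof. by elim: l1 F => [//|j l ih] F /=; rewrite ih. Qed.

Lemma by_parts_cons ka j l (F : Lat -> C) m : j \notin l ->
  by_parts ka (j :: l) F m =
  (if m j == 0%N then \sum_(r < ka j) lam j ^+ r.+1 * by_parts ka l (iter r (dl j) F) m else 0) +
  lam j ^+ ka j * mu j ^+ (m j).+1 * by_parts ka l (iter (ka j) (dl j) F) m.
Proof.
move=> jl /=.
pose z0 k : C := (k == 0%N)%:R.
pose z1 k : C := lam j ^+ ka j * mu j ^+ k.+1.
rewrite (_ : by_part (ka j) j F = (fun m => z0 (m j) *
    (\sum_(r < ka j) lam j ^+ r.+1 * iter r (dl j) F m) +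
    z1 (m j) * iter (ka j) (dl j) F m)); last first.
  apply/funext => m'; rewrite /by_part /z0; congr (_ + _).
  by case: eqP => _; rewrite ?mul1r ?mul0r.
rewrite by_parts_add !by_parts_coef// by_parts_sum /z0; congr (_ + _).
case: eqP => _; rewrite ?mul0r// mul1r; apply: eq_bigr => r _.
by rewrite (by_parts_scale ka l (lam j ^+ r.+1) (iter r (dl j) F)).
Qed.

Hypothesis mu_bd : forall j k, N (mu j ^+ k) <= 2.

(** Each of the [ka j] differences in a variable [j] of [l] gains [eps] in the exponent;
    the boundary terms, on which only part of them acts, are covered by
    [W_boundary]. *)
Lemma by_parts_bound (S : Type) (B : S -> Prop) ka l (F : S -> Lat -> C) al be :
  uniq l -> (forall j, j \in l -> tw j) ->
  (forall K, LatSym B K al F) ->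
  (forall k, al k - (k \in l)%:R * ((ka k)%:R * eps) <= be k) ->
  ldom B be (fun s => by_parts ka l (F s)).
Proof.
elim: l F al be => [|j l ih] F al be /=.
  move=> _ _ hF h; apply: ldom_le (LatSym_dom (hF 0%N)) => k.
  by have := h k; rewrite mul0r subr0.
move=> /andP[jl ul] hl hF h.
have tj : tw j by apply: hl; rewrite mem_head.
have hl' k : k \in l -> tw k by move=> kl; apply: hl; rewrite inE kl orbT.
have hmain : ldom B be (fun s => by_parts ka l (iter (ka j) (dl j) (F s))).
  apply: (ih _ (dec al j ((ka j)%:R * eps))) => //.
    by move=> K; apply: LatSym_iter.
  move=> k; have := h k; rewrite /dec inE.
  have [->|kj] := eqVneq k j; last by rewrite mul0r subr0.
  by rewrite (negbTE jl) !mul1r mul0r subr0.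
pose be' k := Num.max (be k) (if k == j then al j else be k).
have hb r : ldom B be' (fun s => by_parts ka l (iter r (dl j) (F s))).
  apply: (ih _ (dec al j (r%:R * eps))) => //.
    by move=> K; apply: LatSym_iter.
  move=> k; have := h k; rewrite /dec inE /be'.
  have [->|kj] := eqVneq k j; last by rewrite mul0r subr0 maxxx.
  move=> _; rewrite (negbTE jl) mul1r mul0r subr0 le_max; apply/orP; right.
  by rewrite gerBl mulr_ge0// ltW.
have hb' : ldom B be (fun s m => if m j == 0%N then
    \sum_(r < ka j) lam j ^+ r.+1 * by_parts ka l (iter r (dl j) (F s)) m else 0).
  have /choice[c hc] : forall r : nat, exists c : R, 0 <= c /\ forall s m, B s ->
      N (by_parts ka l (iter r (dl j) (F s)) m) <= c * W be' (pt m).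
    by move=> r; have [c c0 hc] := hb r; exists c.
  exists (\sum_(r < ka j) N (lam j ^+ r.+1) * c r).
    by apply: sumr_ge0 => r _; rewrite mulr_ge0 ?N_ge0//; have [] := hc r.
  move=> s m hs; case: eqP => mj; last first.
    rewrite N0 mulr_ge0 ?W_ge0//.
    by apply: sumr_ge0 => r _; rewrite mulr_ge0 ?N_ge0//; have [] := hc r.
  rewrite (le_trans (N_sum _ _ _))// mulr_suml ler_sum// => r _.
  rewrite (le_trans (NM _ _))// -mulrA ler_wpM2l ?N_ge0//.
  have [c0 {}hc] := hc r; rewrite (le_trans (hc _ _ hs))// ler_wpM2l//.
  apply: W_boundary mj _ => k kj.
  by rewrite /be' (negbTE kj) maxxx.
have hm' : ldom B be (fun s m => lam j ^+ ka j * mu j ^+ (m j).+1 *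
    by_parts ka l (iter (ka j) (dl j) (F s)) m).
  have [c c0 hc] := hmain; exists (N (lam j ^+ ka j) * 2 * c).
    by rewrite !mulr_ge0 ?N_ge0.
  move=> s m hs; rewrite (le_trans (NM _ _))// -mulrA.
  apply: ler_pM; rewrite ?N_ge0 ?hc//.
  by rewrite (le_trans (NM _ _))// ler_wpM2l ?N_ge0.
have [c c0 hc] := ldom_add hb' hm'; exists c => // s m hs.
by have := hc s m hs; rewrite -by_parts_cons.
Qed.

End Twist.

End Lattice.

(** * Absolutely convergent sums *)

Section Sums.
Variables (R : realType) (I : choiceType).
Notation C := R[i].
Implicit Types (G H : I -> C) (A : {fset I}).

(** Absolute convergence makes the net of finite partial sums the natural notion
    of sum; [N] measures the distance to the sum. *)
Definition isum G (z : C) : Prop := forall e : R, 0 < e ->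
  exists A0, forall A, (A0 `<=` A)%fset -> N (\sum_(i <- A) G i - z) <= e.

Definition summable_weight (w : I -> R) : Prop :=
  (forall i, 0 <= w i) /\ exists M, forall A, \sum_(i <- A) w i <= M.

Lemma N_small (z : C) : (forall e : R, 0 < e -> N z <= e) -> z = 0.
Proof.
move=> h; have h0 : N z <= 0.
  by apply/ler_addgt0Pl => e e0; rewrite addr0 h.
case: z h h0 => a b _; rewrite /N /= => h0.
have := normr_ge0 a; have := normr_ge0 b => hb ha.
have ea : `|a| = 0 by lra.
have eb : `|b| = 0 by lra.
by move/eqP: ea; move/eqP: eb; rewrite !normr_eq0 => /eqP -> /eqP ->.
Qed.

Lemma isum_unique G z z' : isum G z -> isum G z' -> z = z'.
Proof.
move=> h h'; apply/eqP; rewrite -subr_eq0; apply/eqP; apply: N_small => e e0.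
have e2 : 0 < e / 2 by rewrite divr_gt0.
have [A1 h1] := h _ e2; have [A2 h2] := h' _ e2.
pose A := (A1 `|` A2)%fset.
have -> : z - z' = (\sum_(i <- A) G i - z') - (\sum_(i <- A) G i - z) by ring.
rewrite (le_trans (NB _ _))// [e]splitr lerD ?h2 ?h1// ?fsubsetUl ?fsubsetUr//.
Qed.

Lemma isum_add G H z w : isum G z -> isum H w -> isum (fun i => G i + H i) (z + w).
Proof.
move=> h h' e e0; have e2 : 0 < e / 2 by rewrite divr_gt0.
have [A1 h1] := h _ e2; have [A2 h2] := h' _ e2.
exists ((A1 `|` A2)%fset) => A; rewrite fsubUset => /andP[A1A A2A].
rewrite big_split /= opprD addrACA (le_trans (ND _ _))// [e]splitr lerD ?h1 ?h2//.
Qed.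

Lemma isum_scale G z (c : C) : isum G z -> isum (fun i => c * G i) (c * z).
Proof.
move=> h e e0; have c1 : 0 < N c + 1 by rewrite ltr_pwDr ?N_ge0.
have [A0 h0] := h (e / (N c + 1)) (divr_gt0 e0 c1).
exists A0 => A /h0 hA; rewrite -mulr_sumr -mulrBr (le_trans (NM _ _))//.
apply: (@le_trans _ _ ((N c + 1) * (e / (N c + 1)))).
  by apply: ler_pM; rewrite ?N_ge0// lerDl.
by rewrite mulrC divfK// lt0r_neq0.
Qed.

Lemma isum_sum (J : Type) (r : seq J) (F : J -> I -> C) (z : J -> C) :
  (forall j, isum (F j) (z j)) ->
  isum (fun i => \sum_(j <- r) F j i) (\sum_(j <- r) z j).
Proof.
move=> h; elim: r => [|j r ih].
  move=> e e0; exists fset0%fset => A _; rewrite big_nil big1 ?subr0 ?N0 ?ltW//.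
  by move=> i _; rewrite big_nil.
rewrite big_cons (_ : (fun i => _) = (fun i => F j i + \sum_(j <- r) F j i)).
  exact: isum_add.
by apply/funext => i; rewrite big_cons.
Qed.

Lemma sum_fsubset (w : I -> R) A B : (forall i, 0 <= w i) -> (A `<=` B)%fset ->
  \sum_(i <- A) w i <= \sum_(i <- B) w i.
Proof.
move=> w0 /fsubsetP AB; rewrite [leRHS](big_fsetID _ (mem A)) /=.
rewrite [X in _ <= X + _](_ : _ = \sum_(i <- A) w i).
  by rewrite lerDl sumr_ge0.
apply: eq_fbigl => i; rewrite !inE /=; apply/idP/idP; last by move=> iA; rewrite iA AB.
by case/andP.
Qed.

Lemma sum_sup (w : I -> R) : summable_weight w -> exists z : R,
  forall e, 0 < e -> exists A0, forall A, (A0 `<=` A)%fset -> `|\sum_(i <- A) w i - z| <= e.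
Proof.
move=> [w0 [M hM]].
pose E : set R := [set x | exists A, x = \sum_(i <- A) w i].
have hE : has_sup E.
  split; first by exists (\sum_(i <- fset0%fset) w i), fset0%fset.
  by exists M => x [A ->].
exists (sup E) => e e0.
have [x [A0 ->] hx] := sup_adherent e0 hE.
exists A0 => A hA.
have h1 : \sum_(i <- A) w i <= sup E by apply: sup_upper_bound => //; exists A.
have h2 := sum_fsubset w0 hA.
rewrite ler0_norm ?subr_le0// opprB lerBlDr -lerBlDl (le_trans (ltW hx))//.
Qed.

Lemma isum_exists (w : I -> R) (c : R) G : summable_weight w -> 0 <= c ->
  (forall i, N (G i) <= c * w i) -> exists z, isum G z.
Proof.
move=> [w0 [M hM]] c0 hG.
have real_case (g : I -> R) : (forall i, `|g i| <= c * w i) -> exists z : R,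
    forall e, 0 < e -> exists A0, forall A, (A0 `<=` A)%fset -> `|\sum_(i <- A) g i - z| <= e.
  move=> hg.
  have M0 : 0 <= M by rewrite (le_trans _ (hM fset0%fset))// big_seq_fset0.
  have hcw : summable_weight (fun i => c * w i).
    split; first by move=> i; rewrite mulr_ge0.
    by exists (c * M) => A; rewrite -mulr_sumr ler_wpM2l.
  have hgw : summable_weight (fun i => g i + c * w i).
    split; first by move=> i; have := hg i; rewrite ler_norml => /andP[h _]; lra.
    exists (c * M + c * M) => A; rewrite big_split /= lerD//; last first.
      by rewrite -mulr_sumr ler_wpM2l.
    apply: (@le_trans _ _ (\sum_(i <- A) c * w i)).
      by apply: ler_sum => i _; rewrite (le_trans (ler_norm _)).
    by rewrite -mulr_sumr ler_wpM2l.
  have [z1 h1] := sum_sup hgw; have [z2 h2] := sum_sup hcw.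
  exists (z1 - z2) => e e0; have e2 : 0 < e / 2 by rewrite divr_gt0.
  have [A1 {}h1] := h1 _ e2; have [A2 {}h2] := h2 _ e2.
  exists ((A1 `|` A2)%fset) => A; rewrite fsubUset => /andP[A1A A2A].
  have -> : \sum_(i <- A) g i - (z1 - z2) =
      (\sum_(i <- A) (g i + c * w i) - z1) - (\sum_(i <- A) c * w i - z2).
    by rewrite big_split /=; ring.
  by rewrite (le_trans (ler_normB _ _))// [e]splitr lerD ?h1 ?h2.
have hr i : `|complex.Re (G i)| <= c * w i by rewrite (le_trans _ (hG i))// lerDl.
have hi i : `|complex.Im (G i)| <= c * w i by rewrite (le_trans _ (hG i))// lerDr.
have [x hx] := real_case _ hr; have [y hy] := real_case _ hi.
exists (Complex x y) => e e0; have e2 : 0 < e / 2 by rewrite divr_gt0.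
have [A1 h1] := hx _ e2; have [A2 h2] := hy _ e2.
exists ((A1 `|` A2)%fset) => A; rewrite fsubUset => /andP[A1A A2A].
have -> : \sum_(i <- A) G i =
    Complex (\sum_(i <- A) complex.Re (G i)) (\sum_(i <- A) complex.Im (G i)).
  by elim/big_rec3: _ => // i x1 x2 x3 _ ->; case: (G i).
by rewrite /N /= [e]splitr lerD ?h1 ?h2.
Qed.

Lemma isum_bound (w : I -> R) (c M : R) G z : (forall A, \sum_(i <- A) w i <= M) ->
  0 <= c -> (forall i, N (G i) <= c * w i) -> isum G z -> N z <= c * M.
Proof.
move=> hM c0 hG h; apply/ler_addgt0Pl => e e0.
have [A0 h0] := h e e0.
have -> : z = - (\sum_(i <- A0) G i - z) + \sum_(i <- A0) G i by ring.
rewrite (le_trans (ND _ _))// lerD ?NN ?h0//.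
rewrite (le_trans (N_sum _ _ _))//.
apply: (@le_trans _ _ (\sum_(i <- A0) c * w i)); first exact: ler_sum.
by rewrite -mulr_sumr ler_wpM2l.
Qed.

Definition tsum G : C := xget 0 [set z | isum G z].

Lemma tsumP (w : I -> R) (c : R) G : summable_weight w -> 0 <= c ->
  (forall i, N (G i) <= c * w i) -> isum G (tsum G).
Proof.
move=> hw c0 hG; have [z hz] := isum_exists hw c0 hG.
exact: (@xgetPex _ 0 [set z | isum G z]) (ex_intro _ z hz).
Qed.

Lemma tsumE G z : isum G z -> tsum G = z.
Proof.
move=> hz; apply: (@isum_unique G) => //.
exact: (@xgetPex _ 0 [set z | isum G z]) (ex_intro _ z hz).
Qed.

Lemma isum_cvg G z : isum G z ->
  summability.partial_sum G @ summability.totally --> z.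
Proof.
have hF := @summability.totally_filter I.
move=> h; apply/cvgrPdist_lt => e e0.
have [r er] : exists r : R, e = (r%:C)%C.
  by exists (complex.Re e); case: e e0 => a b; rewrite ltcE /= => /andP[/eqP ->].
have r0 : 0 < r by move: e0; rewrite er ltcR.
have r2 : 0 < r / 2 by rewrite divr_gt0.
have [A0 h0] := h _ r2.
exists A0 => // A /= hA.
rewrite /summability.partial_sum.
have -> : \sum_(i : A) G (val i) = \sum_(i <- A) G i by rewrite big_seq_fsetE.
rewrite distrC.
apply: (le_lt_trans (normc_le_N _)); rewrite er ltcR.
by rewrite (le_lt_trans (h0 _ hA))// ltr_pdivrMr// mulrDr mulr1 ltrDl.
Qed.

End Sums.

Section LatticeSums.
Variables (R : realType) (n : nat).
Notation C := R[i].
Notation Lat := {ffun 'I_n -> nat}.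

Definition lift_box (K : nat) (f : {ffun 'I_n -> 'I_K}) : Lat :=
  [ffun i => nat_of_ord (f i)].

Definition lbox (K : nat) : {fset Lat} :=
  [fset lift_box f | f : {ffun 'I_n -> 'I_K}]%fset.

Lemma lboxP K (m : Lat) : reflect (forall i, (m i < K)%N) (m \in lbox K).
Proof.
apply: (iffP idP) => [/imfsetP[f _ ->] i|h]; first by rewrite ffunE.
apply/imfsetP; exists [ffun i => Ordinal (h i)] => //.
by apply/ffunP => i; rewrite !ffunE.
Qed.

Lemma lift_box_inj K : injective (@lift_box K).
Proof.
move=> f g /ffunP h; apply/ffunP => i; apply: val_inj.
by have := h i; rewrite !ffunE.
Qed.

Lemma fsub_lbox (A : {fset Lat}) : exists K0, forall K, (K0 <= K)%N -> (A `<=` lbox K)%fset.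
Proof.
exists (\sum_(m <- A) \sum_(i < n) (m i).+1)%N => K hK.
apply/fsubsetP => m mA; apply/lboxP => i; apply: leq_trans hK.
rewrite (big_fsetD1 m)//= (bigD1 i)//=.
by rewrite -addnA ltn_addr.
Qed.

Lemma inv_squares_le2 (K : nat) : \sum_(k < K) (k.+1%:R : R) `^ (- 2) <= 2.
Proof.
have hsq (k : nat) : (k.+1%:R : R) `^ (- 2) = (k.+1%:R ^+ 2)^-1.
  by rewrite powRN powR_mulrn// ler0n.
suff : \sum_(k < K.+1) (k.+1%:R : R) `^ (- 2) <= 2 - K.+1%:R^-1.
  rewrite big_ord_recr /= => h.
  apply: (@le_trans _ _ (2 - K.+1%:R^-1)); last by rewrite gerBl invr_ge0.
  by apply: le_trans h; rewrite lerDl powR_ge0.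
elim: K => [|K ih]; first by rewrite big_ord1 hsq expr1n invr1; lra.
rewrite big_ord_recr /= hsq (le_trans (lerD ih (lexx _)))//.
have k0 : (0 : R) < K.+1%:R by rewrite ltr0n.
rewrite -(natr1 K.+1); move: (K.+1%:R) k0 => x x0.
have x1 : 0 < x + 1 by rewrite addr_gt0.
have -> : 2 - x^-1 + ((x + 1) ^+ 2)^-1 =
    2 - (x + 1)^-1 - (x * (x + 1) ^+ 2)^-1.
  by field; rewrite (lt0r_neq0 x0) (lt0r_neq0 x1).
by rewrite gerBl invr_ge0 mulr_ge0 ?exprn_ge0 ?ltW.
Qed.

Lemma inv_squares_summable :
  summable_weight (fun m : Lat => W (fun=> - 2) (pt R m)).
Proof.
split; first by move=> m; exact: W_ge0.
exists (2 ^+ n) => A; have [K hK] := fsub_lbox A.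
apply: le_trans (sum_fsubset _ (hK K (leqnn K))) _; first by move=> m; exact: W_ge0.
rewrite big_imfset /=; last by move=> f g _ _; exact: lift_box_inj.
rewrite big_enum /=.
rewrite (eq_bigr (fun f : {ffun 'I_n -> 'I_K} =>
    \prod_i ((f i).+1%:R : R) `^ (- 2))); last first.
  by move=> f _; apply: eq_bigr => i _; rewrite /pt ffunE.
rewrite -(bigA_distr_bigA (fun (i : 'I_n) (k : 'I_K) => (k.+1%:R : R) `^ (- 2))).
rewrite prodr_const card_ord lerXn2r ?nnegrE ?sumr_ge0 ?inv_squares_le2//.
Qed.

Lemma bump_inj (j : 'I_n) : injective (fun m : Lat => bump m j).
Proof.
move=> m m' /ffunP h; apply/ffunP => k; have := h k; rewrite !ffunE.
exact: addIn.
Qed.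

(** Over a large box the sum reduces to the values of [V] on the far face, where one
    of the three negative powers gives a factor [1 / K] and the others are
    summable. *)
Lemma isum_telescope (V : Lat -> C) (j : 'I_n) (c : R) z : 0 <= c ->
  (forall m, N (V m) <= c * W (fun=> - 3) (pt R m)) ->
  (forall m : Lat, m j = 0%N -> V m = 0) ->
  isum (dl j V) z -> z = 0.
Proof.
move=> c0 hV hV0 hz; apply: N_small => e e0.
have e2 : 0 < e / 2 by rewrite divr_gt0.
have [A0 h0] := hz _ e2.
have [K0 hK0] := fsub_lbox A0.
have [w0 [M hM]] := inv_squares_summable.
have M0 : 0 <= M by rewrite (le_trans _ (hM fset0%fset))// big_seq_fset0.
pose K := maxn K0 (Num.bound (c * M / (e / 2))).
have hK : c * M / (e / 2) <= K.+1%:R.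
  have hb := archi_boundP (divr_ge0 (mulr_ge0 c0 M0) (ltW e2)).
  by rewrite (le_trans (ltW hb))// ler_nat (leq_trans (leq_maxr K0 _))// leqnSn.
have := h0 _ (hK0 K (leq_maxl _ _)).
set T := \sum_(m <- lbox K) _ => hT.
suff hT2 : N T <= e / 2.
  have -> : z = T - (T - z) by ring.
  by rewrite (le_trans (NB _ _))// [e]splitr lerD.
have -> : T = \sum_(m <- [fset bump m j | m in lbox K]%fset) V m - \sum_(m <- lbox K) V m.
  rewrite /T sumrB [X in _ = X - _]big_imfset//= => m m' _ _; exact: bump_inj.
pose P := [pred m : Lat | (0 < m j < K)%N].
rewrite (big_fsetID _ P [fset bump m j | m in lbox K]%fset) /=.
rewrite [X in _ - X](big_fsetID _ P (lbox K)) /=.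
have -> : \sum_(m <- [fset x in [fset bump m j | m in lbox K] | P x]%fset) V m =
          \sum_(m <- [fset x in lbox K | P x]%fset) V m.
  apply: eq_fbigl => m; rewrite !inE /=; apply/andP/andP => -[].
    move=> /imfsetP[m' /= /lboxP hm' ->] hP; split=> //; apply/lboxP => i.
    move: hP; rewrite /P /= !ffunE; have [->|ij] := eqVneq i j.
      by rewrite eqxx => /andP[].
    by rewrite addn0.
  move=> /lboxP hm hP; split=> //; apply/imfsetP.
  exists [ffun i => (m i - (i == j))%N] => /=.
    by apply/lboxP => i; rewrite ffunE (leq_ltn_trans (leq_subr _ _)).
  apply/ffunP => i; rewrite !ffunE; have [->|ij] := eqVneq i j; last by rewrite subn0 addn0.
  by rewrite subnK//; case/andP: hP.
rewrite [X in _ - (_ + X)]big1_fset; last first.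
  move=> m; rewrite !inE /= => /andP[/lboxP hm]; rewrite hm andbT -eqn0Ngt => /eqP hm0 _.
  exact: hV0.
rewrite addr0 addrAC subrr add0r.
set D := [fset x in _ | ~~ _]%fset.
apply: (@le_trans _ _ (\sum_(m <- D) c * (K.+1%:R^-1 * W (fun=> - 2) (pt R m)))).
  rewrite (le_trans (N_sum _ _ _))// big_seq [leRHS]big_seq; apply: ler_sum => m.
  rewrite !inE /= => /andP[/imfsetP[m' /= /lboxP hm' ->]].
  rewrite ffunE eqxx addn1 /= -leqNgt => hmK.
  have emj : K = (m' j).+1 by apply/eqP; rewrite eqn_leq hmK hm'.
  rewrite (le_trans (hV _))// ler_wpM2l//.
  rewrite (_ : (fun=> - 3) = dec (fun=> - 2) j (0 : R) \+ (fun=> - 1))//; last first.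
    by apply/funext => i /=; rewrite /dec mulr0 subr0; ring.
  rewrite /= -WD; last exact: pt_ge1.
  rewrite dec0 mulrC ler_wpM2r ?W_ge0//.
  apply: (@le_trans _ _ (W (unitv j (- 1)) (pt R (bump m' j)))).
    apply: W_le; first exact: pt_ge1.
    by move=> i; rewrite /unitv; case: eqP => _; rewrite ?mul1r ?mul0r; lra.
  by rewrite W_unitv /pt ffunE eqxx addn1 -emj powR_inv1.
rewrite -mulr_sumr -mulr_sumr.
apply: (@le_trans _ _ (c * (K.+1%:R^-1 * M))).
  by rewrite ler_wpM2l// ler_wpM2l// invr_ge0.
rewrite mulrCA mulrC ler_pdivrMr ?ltr0n//.
by rewrite [leRHS]mulrC -ler_pdivrMr.
Qed.

End LatticeSums.

(** * Holomorphy of sums *)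

Lemma differentiable_zero (K : numFieldType) (V W : normedModType K) (f : V -> W) (p : V) :
  (forall e : K, 0 < e -> \forall v \near (0 : V), `|f (v + p) - f p| <= e * `|v|) ->
  differentiable f p.
Proof.
move=> h.
pose L : {linear V -> W} := \0.
have hL : continuous L by move=> x; exact: cst_continuous.
have e : f \o shift p = cst (f p) + L +o_ 0 id.
  apply/eqaddoP => eps eps0; apply: filterS (h _ eps0) => v.
  rewrite -[(f \o shift p - (cst (f p) + L)) v]/(f (v + p) - (f p + 0)).
  by rewrite addr0.
have dE := diff_unique hL e.
by apply/diff_locallyP; rewrite dE.
Qed.

Lemma differentiable_near (K : numFieldType) (U W0 : normedModType K) (f g : U -> W0) (p : U) :
  (\forall q \near p, f q = g q) -> differentiable g p -> differentiable f p.
Proof.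
move=> h hg.
have hz : differentiable (f \- g) p.
  apply: differentiable_zero => e e0; have hp := nbhs_singleton h.
  have : \forall v \near (0 : U), f (v + p) = g (v + p).
    have hc : (fun v => v + p) @ (0 : U) --> p.
      by rewrite -[X in _ --> X]add0r; apply: cvgD; [exact: cvg_id | exact: cvg_cst].
    exact: (hc _ h).
  apply: filterS => v hv; rewrite /= hv hp !subrr normr0.
  by apply: mulr_ge0; [exact: ltW | exact: normr_ge0].
have := differentiableD hz hg.
by rewrite (_ : (f \- g) + g = f)//; apply/funext => v; rewrite /= -[LHS]/(f v - g v + g v) subrK.
Qed.

Section Holomorphy.
Variables (R : realType) (T : nat).
Notation C := R[i].
Notation V := 'rV[R[i]]_T.

Lemma differentiable_coordC (t : 'I_T) (p : V) :
  differentiable (fun v : V => v ord0 t : C) p.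
Proof. exact: differentiable_coord. Qed.

Lemma diffble_add (f g : V -> C) (p : V) :
  differentiable f p -> differentiable g p -> differentiable (fun v => f v + g v) p.
Proof. by move=> hf hg; exact: differentiableD. Qed.

Lemma diffble_mul (f g : V -> C) (p : V) :
  differentiable f p -> differentiable g p -> differentiable (fun v => f v * g v) p.
Proof. by move=> hf hg; exact: differentiableM. Qed.

Lemma diffble_inv (f : V -> C) (p : V) : differentiable f p -> f p != 0 ->
  differentiable (fun v => (f v)^-1) p.
Proof. by move=> hf hg; exact: differentiableV. Qed.

Lemma diffble_cst (z : C) (p : V) : differentiable (fun _ : V => z) p.
Proof. exact: differentiable_cst. Qed.

Lemma diffble_sum (I : Type) (r : seq I) (F : I -> V -> C) (p : V) :
  (forall i, differentiable (F i) p) -> differentiable (fun v => \sum_(i <- r) F i v) p.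
Proof.
move=> h; elim: r => [|i r ih].
  rewrite (_ : (fun v => _) = (fun=> 0)); first exact: diffble_cst.
  by apply/funext => v; rewrite big_nil.
rewrite (_ : (fun v => _) = (fun v => F i v + \sum_(i <- r) F i v)).
  exact: diffble_add.
by apply/funext => v; rewrite big_cons.
Qed.

Lemma diffble_horner (q : {poly C}) (t : 'I_T) (p : V) :
  differentiable (fun v : V => q.[v ord0 t]) p.
Proof.
elim/poly_ind: q => [|q c ih].
  rewrite (_ : (fun v => _) = (fun=> 0)); first exact: diffble_cst.
  by apply/funext => v; rewrite horner0.
rewrite (_ : (fun v : V => _) = (fun v : V => q.[v ord0 t] * v ord0 t + c)).
  by apply: diffble_add; [apply: diffble_mul => //; exact: differentiable_coordC | exact: diffble_cst].
by apply/funext => v; rewrite !hornerE.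
Qed.

Lemma coord_le_norm (v : V) (t : 'I_T) : `|v ord0 t| <= `|v|.
Proof.
rewrite [leRHS]mx_normE [leLHS](_ : _ = (`|v ord0 t|%:nng)%:num)// num_le.
by apply: (@le_trans _ _ (`|v (ord0, t).1 (ord0, t).2|%:nng)); [| exact: (le_bigmax _ (fun ij => `|v ij.1 ij.2|%:nng) (ord0, t))].
Qed.

Lemma norm_real (v : V) : exists r : R, 0 <= r /\ `|v| = (r%:C)%C.
Proof.
have := normr_ge0 v; case: (`|v|) => a b; rewrite lecE /= => /andP[/eqP -> ha].
by exists a.
Qed.

Definition polydisc (p : V) (r : R) (q : V) : Prop :=
  forall t, N (q ord0 t - p ord0 t) < r.

Lemma near_polydisc (p : V) (r : R) : 0 < r -> \forall q \near p, polydisc p r q.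
Proof.
move=> r0; apply/nbhs_normP; exists ((r / 4)%:C)%C => /=.
  by rewrite ltcR divr_gt0.
move=> q /=; rewrite distrC => hq t.
have h : `|(q - p) ord0 t| <= ((r / 4)%:C)%C.
  by rewrite (le_trans (coord_le_norm _ _))// ltW.
rewrite !mxE in h.
rewrite (le_lt_trans (N_le_normc h))//; lra.
Qed.

Lemma differentiable_flat (f : V -> C) (p : V) (c r : R) : 0 <= c -> 0 < r ->
  (forall q, polydisc p r q -> N (f q - f p) <= c * (\sum_t N (q ord0 t - p ord0 t)) ^+ 2) ->
  differentiable f p.
Proof.
move=> c0 r0 hf.
apply: differentiable_zero => eps eps0.
have [e' [e'0 ee]] : exists e' : R, 0 < e' /\ eps = (e'%:C)%C.
  exists (complex.Re eps); case: eps eps0 => a b; rewrite ltcE /= => /andP[/eqP -> ha].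
  by [].
pose d := Num.min r (e' / (c * (2 * T%:R) ^+ 2 + 1)).
have c1 : 0 < c * (2 * T%:R) ^+ 2 + 1 by rewrite ltr_pwDr// mulr_ge0// exprn_ge0// mulr_ge0.
have d0 : 0 < d by rewrite lt_min r0 divr_gt0.
apply/nbhs_normP; exists ((d / 4)%:C)%C => /=; first by rewrite ltcR divr_gt0.
move=> v /=; rewrite sub0r normrN => hv.
have [s [s0 es]] := norm_real v.
have hN t : N ((v + p) ord0 t - p ord0 t) <= 2 * s.
  rewrite !mxE addrK; apply: N_le_normc.
  by rewrite -es; exact: coord_le_norm.
have sd : s < d / 4 by move: hv; rewrite es ltcR.
have hq : polydisc p r (v + p).
  move=> t; rewrite (le_lt_trans (hN t))//.
  apply: (@lt_le_trans _ _ d); first lra.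
  by rewrite ge_min lexx.
apply: (le_trans (normc_le_N _)); rewrite es ee -rmorphM lecR.
rewrite (le_trans (hf _ hq))//.
have hS : \sum_t N ((v + p) ord0 t - p ord0 t) <= (2 * T%:R) * s.
  apply: (@le_trans _ _ (\sum_(t < T) 2 * s)); first by apply: ler_sum => t _; exact: hN.
  by rewrite sumr_const card_ord -mulr_natr; lra.
apply: (@le_trans _ _ (c * ((2 * T%:R) * s) ^+ 2)).
  rewrite ler_wpM2l// lerXn2r ?nnegrE ?mulr_ge0// sumr_ge0// => t _; exact: N_ge0.
rewrite exprMn mulrA expr2 mulrA ler_wpM2r//.
apply: (@le_trans _ _ ((c * (2 * T%:R) ^+ 2 + 1) * d)).
  by apply: ler_pM; rewrite ?mulr_ge0 ?exprn_ge0 ?mulr_ge0// ?lerDl//; lra.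
by rewrite -ler_pdivlMl// mulrC ge_min lexx orbT.
Qed.

(** A differential needs only be linear here, its continuity following from its
    coordinates: subtracting it leaves a quadratically small increment. *)
Lemma differentiable_taylor (f : V -> C) (p : V) (g : 'I_T -> C) (c r : R) :
  0 <= c -> 0 < r ->
  (forall q, polydisc p r q ->
    N (f q - f p - \sum_t (q ord0 t - p ord0 t) * g t)
      <= c * (\sum_t N (q ord0 t - p ord0 t)) ^+ 2) ->
  differentiable f p.
Proof.
move=> c0 r0 hf.
pose l (v : V) : C := \sum_t v ord0 t * g t.
have dl : differentiable l p.
  apply: diffble_sum => t.
  by apply: diffble_mul; [exact: differentiable_coordC | exact: diffble_cst].
have df : differentiable (fun v => f v - l v) p.
  apply: (differentiable_flat c0 r0) => q hq; apply: le_trans (hf q hq).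
  rewrite le_eqVlt; apply/orP; left; apply/eqP; congr N.
  have -> : \sum_t (q ord0 t - p ord0 t) * g t = l q - l p.
    by rewrite /l -sumrB; apply: eq_bigr => t _; rewrite mulrBl.
  by ring.
rewrite (_ : f = (fun v => (f v - l v) + l v)); first exact: diffble_add.
by apply/funext => v; rewrite subrK.
Qed.

Lemma taylor2 (g g1 g2 : R -> C) (c : R) :
  (forall u, 0 <= u <= 1 -> cder g u (g1 u)) ->
  (forall u, 0 <= u <= 1 -> cder g1 u (g2 u)) ->
  (forall u, 0 <= u <= 1 -> N (g2 u) <= c) -> N (g 1 - g 0 - g1 0) <= 4 * c.
Proof.
move=> h1 h2 hc.
have c0 : 0 <= c by rewrite (le_trans (N_ge0 (g2 0)))// hc// lexx ler01.
have hb u : 0 <= u <= 1 -> N (g1 u - g1 0) <= 2 * c.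
  move=> /andP[u0 u1].
  have := @MVT_complex R g1 g2 u c u0.
  move=> /(_ _ _)/le_trans; apply.
  - by move=> t /andP[t0 tu]; apply: h2; rewrite t0 (le_trans tu).
  - by move=> t /andP[t0 tu]; apply: hc; rewrite t0 (le_trans tu).
  - by rewrite ler_wpM2r//; lra.
have := @MVT_complex R (fun u => g u - g1 0 * (u%:C)%C) (fun u => g1 u - g1 0) 1 (2 * c) ler01.
rewrite mulr1 mulr0 subr0 mulrA -natrM.
have -> : g 1 - g1 0 * 1%:C%C - g 0 = g 1 - g 0 - g1 0.
  by rewrite mulr1; ring.
apply=> [u hu|//].
have := cder_sub (h1 u hu) (cder_scale (g1 0) (cder_id u)).
by rewrite mulr1.
Qed.

(** The second order Taylor remainders of the terms, controlled along real segments, add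
    up to that of the sum; this bypasses Cauchy estimates and uniform limits. *)
Lemma differentiable_tsum (I : choiceType) (w : I -> R) (F : V -> I -> C)
    (F1 : 'I_T -> V -> I -> C) (F2 : 'I_T -> 'I_T -> V -> I -> C) (p : V) (c r : R) :
  summable_weight w -> 0 <= c -> 0 < r ->
  (forall q i, polydisc p r q -> N (F q i) <= c * w i) ->
  (forall t q i, polydisc p r q -> N (F1 t q i) <= c * w i) ->
  (forall t u q i, polydisc p r q -> N (F2 t u q i) <= c * w i) ->
  (forall q v i (x : R), cder (fun y : R => F (q + (y%:C)%C *: v) i) x
     (\sum_t v ord0 t * F1 t (q + (x%:C)%C *: v) i)) ->
  (forall t q v i (x : R), cder (fun y : R => F1 t (q + (y%:C)%C *: v) i) x
     (\sum_u v ord0 u * F2 t u (q + (x%:C)%C *: v) i)) ->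
  differentiable (fun q => tsum (F q)) p.
Proof.
move=> hw c0 r0 hF hF1 hF2 d1 d2.
have [w0 [M hM]] := hw.
have M0 : 0 <= M by rewrite (le_trans _ (hM fset0))// big_seq_fset0.
have hpp : polydisc p r p by move=> t; rewrite subrr N0.
pose g t := tsum (F1 t p).
apply: (@differentiable_taylor _ _ g (4 * c * M) r) => //; first by rewrite !mulr_ge0.
move=> q hq; pose v := q - p.
have hv t : q ord0 t - p ord0 t = v ord0 t by rewrite !mxE.
under eq_bigr do rewrite hv.
under [in leRHS]eq_bigr do rewrite hv.
set s := \sum_t N (v ord0 t).
have s0 : 0 <= s by apply: sumr_ge0 => t _; exact: N_ge0.
have h1 := tsumP hw c0 (fun i => hF q i hq).
have h2 := tsumP hw c0 (fun i => hF p i hpp).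
have h3 t := tsumP hw c0 (fun i => hF1 t p i hpp).
have h4 : isum (fun i => \sum_t v ord0 t * F1 t p i) (\sum_t v ord0 t * g t).
  by apply: isum_sum => t; exact: isum_scale.
have h5 := isum_add (isum_add h1 (isum_scale (-1) h2)) (isum_scale (-1) h4).
rewrite !mulN1r in h5.
rewrite [leRHS](_ : _ = (4 * c * s ^+ 2) * M); last by ring.
apply: (isum_bound hM _ _ h5); first by rewrite !mulr_ge0 ?exprn_ge0.
move=> i; rewrite !mulN1r.
pose gg (y : R) := F (p + (y%:C)%C *: v) i.
pose gg1 (y : R) := \sum_t v ord0 t * F1 t (p + (y%:C)%C *: v) i.
pose gg2 (y : R) := \sum_t v ord0 t * \sum_u v ord0 u * F2 t u (p + (y%:C)%C *: v) i.
have := @taylor2 gg gg1 gg2 (s * (s * (c * w i))).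
have e0 : p + (0%:C)%C *: v = p by rewrite scale0r addr0.
have e1 : p + (1%:C)%C *: v = q by rewrite scale1r addrC subrK.
have -> : F q i = gg 1 by rewrite /gg e1.
have -> : F p i = gg 0 by rewrite /gg e0.
have -> : \sum_t v ord0 t * F1 t p i = gg1 0 by rewrite /gg1 e0.
rewrite (_ : 4 * (s * _) = 4 * c * s ^+ 2 * w i); last by ring.
apply.
- by move=> u _; exact: d1.
- by move=> u _; apply: cder_sum => t; apply: cder_scale; exact: d2.
- move=> u /andP[u0 u1].
  have hu : polydisc p r (p + (u%:C)%C *: v).
    move=> t; have -> : (p + (u%:C)%C *: v) ord0 t - p ord0 t =
        (u%:C)%C * (q ord0 t - p ord0 t) by rewrite !mxE; ring.
    rewrite (le_lt_trans (NM _ _))// Nreal ger0_norm//.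
    rewrite (le_lt_trans _ (hq t))// ler_piMl ?N_ge0//.
  rewrite (le_trans (N_sum _ _ _))// mulr_suml ler_sum// => t _.
  rewrite (le_trans (NM _ _))// ler_wpM2l ?N_ge0//.
  rewrite (le_trans (N_sum _ _ _))// mulr_suml ler_sum// => t' _.
  by rewrite (le_trans (NM _ _))// ler_wpM2l ?N_ge0// hF2.
Qed.

End Holomorphy.

(** * Regularised sums *)

Section Regularised.
Variables (R : realType) (n : nat) (eps : R).
Hypothesis eps_gt0 : 0 < eps.
Notation C := R[i].
Notation Lat := {ffun 'I_n -> nat}.
Variables (tl : seq 'I_n) (mu : 'I_n -> C).
Hypothesis tl_uniq : uniq tl.
Hypothesis mu_neq1 : forall j, j \in tl -> mu j != 1.
Hypothesis mu_neq0 : forall j, j \in tl -> mu j != 0.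
Hypothesis mu_bd : forall j k, N (mu j ^+ k) <= 2.

Definition tw : pred 'I_n := fun j => j \in tl.
Definition lam (j : 'I_n) : C := mu j / (1 - mu j).

Definition LatSymU al (F : Lat -> C) : Prop :=
  forall K, LatSym eps tw (fun _ : unit => True) K al (fun=> F).

(** After [ka k] summations by parts in each twisted variable every exponent is at most
    -3: one more than summability requires, for [isum_telescope]. *)
Definition decays ka (al : 'I_n -> R) : Prop :=
  forall k, al k - (k \in tl)%:R * ((ka k)%:R * eps) <= - 3.

Lemma by_parts_isum (S : Type) (B : S -> Prop) ka al (F : S -> Lat -> C) :
  (forall K, LatSym eps tw B K al F) -> decays ka al ->
  exists2 c : R, 0 <= c & forall s m, B s ->
    N (by_parts lam mu ka tl (F s) m) <= c * W (fun=> - 2) (pt R m).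
Proof.
move=> hF hd.
have hb := by_parts_bound eps_gt0 lam mu_bd tl_uniq (fun j h => h) hF
  (be := fun=> - 3) hd.
by apply: ldom_le hb => _; lra.
Qed.

(** The regularised sum of [F] against the [mu_j ^ (m_j + 1)]. *)
Definition regsum ka (F : Lat -> C) : C := tsum (by_parts lam mu ka tl F).

Lemma regsum_isum ka al F : LatSymU al F -> decays ka al ->
  isum (by_parts lam mu ka tl F) (regsum ka F).
Proof.
move=> hF hd; have [c c0 hc] := by_parts_isum hF hd.
exact: (tsumP (inv_squares_summable R n) c0 (fun m => hc tt m I)).
Qed.

Definition twist_tail K j (F : Lat -> C) (m : Lat) : C :=
  (if m j == 0%N then 0 else - (lam j ^+ K.+1 * mu j ^+ m j)) * iter K (dl j) F m.

Lemma by_part_step K j F : j \in tl ->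
  by_part lam mu K j F = (fun m => by_part lam mu K.+1 j F m + dl j (twist_tail K j F) m).
Proof.
move=> jl; apply/funext => m.
have -> : dl j (twist_tail K j F) m = twist_tail K j F (bump m j) - twist_tail K j F m.
  by [].
rewrite /by_part /twist_tail ffunE eqxx addn1 /=.
have [mu0 mu1] := (mu_neq0 jl, mu_neq1 jl).
have m1 : 1 - mu j != 0 by rewrite subr_eq0 eq_sym.
set G := iter K (dl j) F.
rewrite -[dl j G m]/(G (bump m j) - G m).
have key x y : lam j ^+ K * mu j ^+ (m j).+1 * x =
  lam j ^+ K.+1 * mu j ^+ (m j).+1 * (y - x) +
  (- (lam j ^+ K.+1 * mu j ^+ (m j).+1) * y + lam j ^+ K.+1 * mu j ^+ m j * x).
  rewrite !exprS; set u := mu j ^+ m j; set v := lam j ^+ K.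
  by rewrite /lam; field.
rewrite (key _ (G (bump m j))).
case: eqP => mj; last by ring.
by rewrite big_ord_recr /= -/G mj expr0; ring.
Qed.

Lemma by_parts_eqka ka ka' l F : {in l, ka =1 ka'} ->
  by_parts lam mu ka l F = by_parts lam mu ka' l F.
Proof.
elim: l F => [//|j l ih] F h /=; rewrite h ?mem_head//.
by apply: ih => k kl; rewrite h// inE kl orbT.
Qed.

Lemma by_parts_iter_dl ka l i K (F : Lat -> C) : i \notin l ->
  iter K (dl i) (by_parts lam mu ka l F) = by_parts lam mu ka l (iter K (dl i) F).
Proof. by move=> il; elim: K => [//|K ih] /=; rewrite ih by_parts_dl. Qed.

(** Raising one summation order by one adds a telescoping term, so the
    regularised sum does not change. *)
Lemma regsum_step1 ka ka' al F j : j \in tl -> LatSymU al F -> decays ka al ->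
  ka' j = (ka j).+1 -> (forall k, k != j -> ka' k = ka k) -> regsum ka F = regsum ka' F.
Proof.
move=> jl hF hd hj hk.
have hd' : decays ka' al.
  move=> k; apply: le_trans (hd k); rewrite lerD2l lerN2 ler_wpM2l// ler_wpM2r ?(ltW eps_gt0)//.
  rewrite ler_nat; have [->|kj] := eqVneq k j; first by rewrite hj leqnSn.
  by rewrite hk.
have h1 := regsum_isum hF hd; have h2 := regsum_isum hF hd'.
have h3 := isum_add h1 (isum_scale (-1) h2).
apply/eqP; rewrite -subr_eq0; apply/eqP; rewrite -mulN1r.
have [l1 [l2 etl]] : exists l1 l2, tl = l1 ++ j :: l2.
  by case/splitPr: jl => l1 l2; exists l1, l2.
have : uniq (l1 ++ j :: l2) by rewrite -etl.
rewrite cat_uniq /= negb_or => /and3P[u1 /andP[j1 n12] /andP[j2 u2]].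
have j1' : j \notin l1 by exact: j1.
have e1 : {in l1, ka' =1 ka}.
  by move=> k kl; apply: hk; apply: contraNneq j1' => <-.
have e2 : {in l2, ka' =1 ka}.
  by move=> k kl; apply: hk; apply: contraNneq j2 => <-.
pose G := by_parts lam mu ka l1 F.
pose z k : C := if k == 0%N then 0 else - (lam j ^+ (ka j).+1 * mu j ^+ k).
pose V := by_parts lam mu ka l2 (twist_tail (ka j) j G).
have eV : V = (fun m => z (m j) * by_parts lam mu ka (l1 ++ l2) (iter (ka j) (dl j) F) m).
  by rewrite /V /twist_tail (by_parts_coef lam mu ka z)// by_parts_cat -(by_parts_iter_dl ka (ka j) F j1').
have eS : (fun m => by_parts lam mu ka tl F m + -1 * by_parts lam mu ka' tl F m) = dl j V.
  apply/funext => m; rewrite etl !by_parts_cat /= (by_parts_eqka _ e1) (by_parts_eqka _ e2) hj.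
  rewrite -/G (by_part_step _ _ jl) by_parts_add by_parts_dl// mulN1r.
  by rewrite addrAC subrr add0r.
rewrite eS in h3.
have hF' : LatSymU (dec al j ((ka j)%:R * eps)) (iter (ka j) (dl j) F).
  by move=> K; apply: (@LatSym_iter R n eps tw unit (fun=> True) K al (fun=> F)).
have u12 : uniq (l1 ++ l2).
  by rewrite cat_uniq u1 u2 n12.
have s12 k : k \in l1 ++ l2 -> tw k.
  by rewrite /tw etl !mem_cat inE => /orP[->|->]; rewrite ?orbT.
have hbe k : dec al j ((ka j)%:R * eps) k - (k \in l1 ++ l2)%:R * ((ka k)%:R * eps) <= - 3.
  apply: le_trans (hd k); rewrite /dec etl !mem_cat inE.
  have [->|kj] := eqVneq k j; last by rewrite mul0r subr0.
  by rewrite (negbTE j1') (negbTE j2) /= mul1r mul0r subr0.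
have [c c0 hc] := by_parts_bound eps_gt0 lam mu_bd u12 s12 hF' (be := fun=> - 3) hbe.
apply: (isum_telescope (c := N (lam j ^+ (ka j).+1) * 2 * c)) h3.
- by rewrite !mulr_ge0 ?N_ge0.
- move=> m; rewrite eV (le_trans (NM _ _))// -mulrA; apply: ler_pM; rewrite ?N_ge0//.
    rewrite /z; case: eqP => _; first by rewrite N0 mulr_ge0 ?N_ge0.
    by rewrite NN (le_trans (NM _ _))// ler_wpM2l ?N_ge0.
  exact: (hc tt).
- by move=> m mj; rewrite eV /z mj eqxx mul0r.
Qed.

Lemma regsum_step K al F : LatSymU al F -> decays (fun=> K) al ->
  regsum (fun=> K) F = regsum (fun=> K.+1) F.
Proof.
move=> hF hd.
have h l : uniq l -> {subset l <= tl} ->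
    regsum (fun=> K) F = regsum (fun k => (K + (k \in l))%N) F.
  elim: l => [_ _|j l ih /= /andP[jl ul] sl].
    congr regsum; apply/funext => k; by rewrite addn0.
  rewrite ih//; last by move=> k kl; apply: sl; rewrite inE kl orbT.
  apply: (@regsum_step1 _ _ al _ j) => //.
  - by apply: sl; rewrite mem_head.
  - move=> k; apply: le_trans (hd k).
    rewrite lerD2l lerN2 ler_wpM2l// ler_wpM2r ?(ltW eps_gt0)// ler_nat leq_addr//.
  - by rewrite mem_head (negbTE jl) addn0 addn1.
  - by move=> k kj; rewrite inE (negbTE kj).
rewrite (h tl)//; rewrite /regsum; congr tsum; apply: by_parts_eqka => k kl.
by rewrite kl addn1.
Qed.

(** The difference in an untwisted direction commutes with the summations by parts and
    telescopes. *)
Lemma regsum_telescope ka al F i V : i \notin tl ->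
  LatSymU al V -> decays ka al -> (forall m : Lat, m i = 0%N -> V m = 0) ->
  F = dl i V -> isum (by_parts lam mu ka tl F) 0.
Proof.
move=> il hV hd hV0 ->.
have ti : ~~ tw i by exact: il.
have [c c0 hc] := by_parts_bound eps_gt0 lam mu_bd tl_uniq (fun j h => h) hV (be := fun=> - 3) hd.
have eV : by_parts lam mu ka tl V = (fun m => (m i != 0%N)%:R * by_parts lam mu ka tl V m).
  have e : V = (fun m => (m i != 0%N)%:R * V m).
    apply/funext => m; case: eqP => [mi|_]; last by rewrite mul1r.
    by rewrite mul0r hV0.
  by rewrite {1}e (by_parts_coef lam mu ka (fun k => (k != 0%N)%:R))//.
rewrite by_parts_dl//.
have hdl m : N (dl i (by_parts lam mu ka tl V) m) <= (2 * c) * W (fun=> - 2) (pt R m).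
  rewrite /dl (le_trans (NB _ _))// -mulrA mulrDl mul1r; apply: lerD.
    rewrite (le_trans (hc tt _ I))// ler_wpM2l//.
    rewrite (le_trans (W_le (be := fun=> - 2) (pt_ge1 _ _) _))//; first by move=> _; lra.
    apply: ler_prod => k _; rewrite powR_ge0 /=.
    rewrite !powRN lef_pV2 ?posrE ?powR_gt0 ?(lt_le_trans ltr01 (pt_ge1 _ _ _))//.
    apply: ge0_ler_powR; rewrite ?nnegrE ?(le_trans ler01 (pt_ge1 _ _ _))//.
    by rewrite /pt ffunE ler_nat ltnS leq_addr.
  rewrite (le_trans (hc tt _ I))// ler_wpM2l// W_le//; first exact: pt_ge1.
  by move=> _; lra.
have [w0 [M hM]] := inv_squares_summable R n.
have hs := tsumP (inv_squares_summable R n) (mulr_ge0 (ler0n _ 2) c0) hdl.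
have hV0' (m : Lat) : m i = 0%N -> by_parts lam mu ka tl V m = 0.
  by move=> mi; rewrite eV mi eqxx mul0r.
by have := isum_telescope c0 (fun m => hc tt m I) hV0' hs => z0; rewrite z0 in hs.
Qed.

Lemma by_parts_order0 l F m : uniq l ->
  by_parts lam mu (fun=> 0%N) l F m = (\prod_(j <- l) mu j ^+ (m j).+1) * F m.
Proof.
elim: l F => [|j l ih] F; first by rewrite big_nil mul1r.
rewrite [uniq _]/= => /andP[jl ul].
rewrite by_parts_cons// big_ord0 if_same add0r expr0 mul1r ih// big_cons mulrA.
by [].
Qed.

End Regularised.

(** * Polynomials with the HDF condition *)

Section Polynomials.
Variables (R : realType).

Lemma mpoly_ring_ind (k : nat) (P : mpoly k R -> Prop) :
  (forall c, P (mpolyC k c)) -> (forall i, P (mpolyX R (mnm1 i))) ->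
  (forall p q, P p -> P q -> P (p + q)) -> (forall p q, P p -> P q -> P (p * q)) ->
  forall p, P p.
Proof.
move=> hC hX hD hM; elim/mpolyind => [|c m p _ _ hp].
  by have := hC 0; rewrite mpolyC0.
apply: hD => //; rewrite -mul_mpolyC; apply: (hM) => //.
rewrite mpolyXE_id; elim/big_ind: _ => [||i _]; [by have := hC 1; rewrite mpolyC1 | exact: hM |].
elim: (m i) => [|e ih]; first by have := hC 1; rewrite mpolyC1.
by rewrite exprS; apply: hM.
Qed.

Lemma is_derive_meval (k : nat) (p : mpoly k R) (x : 'I_k -> R) i :
  is_derive (0 : R) (1 : R) (fun t => meval (sh x i t) p) (meval x (mderiv i p)).
Proof.
elim/mpoly_ring_ind: p => [c|j|p q hp hq|p q hp hq].
- rewrite mderivC meval0; apply: (@is_derive_ext R (fun=> c)) => t; by rewrite mevalC.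
- rewrite mderivX mnm1E.
  apply: is_derive_ext (is_derive_congr (is_derive_sh x i j) _) _ => [|t]; last by rewrite mevalXU.
  rewrite mevalZ mevalX; have [->|ji] := eqVneq j i; last by rewrite mul0r.
  by rewrite big1 ?mulr1// => l _; rewrite mnmBE subnn expr0.
- rewrite mderivD mevalD; apply: is_derive_ext (is_derive_add hp hq) _ => t.
  by rewrite mevalD.
- rewrite mderivM mevalD !mevalM; apply: is_derive_ext (is_derive_congr (is_derive_mul hp hq) _) _ => [|t].
    by rewrite sh0; ring.
  by rewrite mevalM.
Qed.

Definition wd (k : nat) (i : 'I_k) : 'I_k.+1 := widen_ord (leqnSn k) i.

Definition prj (k : nat) (x : 'I_k.+1 -> R) : 'I_k -> R := fun i => x (wd i).

Lemma meval_mwiden (k : nat) (p : mpoly k R) (x : 'I_k.+1 -> R) :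
  meval x (mwiden p) = meval (prj x) p.
Proof.
elim/mpoly_ring_ind: p => [c|j|p q hp hq|p q hp hq].
- by rewrite mwidenC !mevalC.
- by rewrite mwidenX mnmwiden1 !mevalXU.
- by rewrite mwidenD !mevalD hp hq.
- by rewrite mwidenM !mevalM hp hq.
Qed.

Lemma meval_bound (k : nat) (p : mpoly k R) : exists c D : R, [/\ 0 <= c, 0 <= D &
  forall x : 'I_k -> R, ge1 x -> `|meval x p| <= c * W (fun=> D) x].
Proof.
elim/mpoly_ring_ind: p => [c|j|p q|p q].
- exists `|c|, 0; split=> // x hx; rewrite mevalC ler_peMr// W_ge1//.
- exists 1, 1; split=> // x hx; rewrite mevalXU mul1r ger0_norm ?(le_trans ler01 (hx j))//.
  apply: (@le_trans _ _ (W (unitv j 1) x)).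
    by rewrite W_unitv powRr1// (le_trans ler01 (hx j)).
  by apply: W_le => // i; rewrite /unitv mulr1; case: (_ == _).
- move=> [c1 [D1 [c10 D10 h1]]] [c2 [D2 [c20 D20 h2]]].
  exists (c1 + c2), (D1 + D2); split; rewrite ?addr_ge0// => x hx.
  rewrite mevalD (le_trans (ler_normD _ _))// mulrDl lerD//.
    rewrite (le_trans (h1 _ hx))// ler_wpM2l// W_le// => i; by rewrite lerDl.
  rewrite (le_trans (h2 _ hx))// ler_wpM2l// W_le// => i; by rewrite lerDr.
- move=> [c1 [D1 [c10 D10 h1]]] [c2 [D2 [c20 D20 h2]]].
  exists (c1 * c2), (D1 + D2); split; rewrite ?mulr_ge0 ?addr_ge0// => x hx.
  rewrite mevalM normrM -(WD (fun=> D1) (fun=> D2) hx) mulrACA.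
  by apply: ler_pM; rewrite ?h1 ?h2.
Qed.

(** The decay of the HDF condition with one exponent for all the variables, each
    differentiation gaining in its own variable. *)
Definition symbolic (k : nat) (eps : R) (p : mpoly k R) : Prop :=
  forall b : multinom k, exists2 c : R, 0 <= c & forall x, ge1 x ->
    `|meval x (mderivm b p)| <= c * (W (fun i => - ((b i)%:R * eps)) x * meval x p).

Definition bounded_below (k : nat) (p : mpoly k R) : Prop :=
  exists2 c : R, 0 < c & forall x, ge1 x -> c <= meval x p.

Definition occurs (k : nat) (j : 'I_k) (p : mpoly k R) : bool :=
  has (fun m : multinom k => 0 < m j)%N (msupp p).

Lemma seq_max (T : eqType) (f : T -> nat) (s : seq T) : s != [::] ->
  exists2 x, x \in s & forall y, y \in s -> (f y <= f x)%N.
Proof.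
elim: s => [//|x s ih] _; have [->|/ih[z zs hz]] := eqVneq s [::].
  by exists x; rewrite ?mem_seq1// => y; rewrite mem_seq1 => /eqP ->.
have [xz|zx] := leqP (f x) (f z).
  exists z; first by rewrite inE zs orbT.
  by move=> y; rewrite inE => /predU1P[->//|/hz].
exists x; first exact: mem_head.
by move=> y; rewrite inE => /predU1P[->//|/hz h]; rewrite (leq_trans h)// ltnW.
Qed.

(** The derivative of [p] along a monomial of maximal degree among those that
    contain [X_j] is a nonzero constant; the bound of the HDF condition for it
    bounds [p] itself from below. *)
Lemma HDF_lower_var (k : nat) (p : mpoly k R) (j : 'I_k) : HDF p -> occurs j p ->
  exists c e : R, [/\ 0 < c, 0 < e &
    forall x, ge1 x -> c * x j `^ e <= meval x p].
Proof.
move=> [p0 /(_ j)[e e0 he]] hj.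
have [|b] := @seq_max _ (@mdeg k) [seq m : multinom k <- msupp p | 0 < m j]%N.
  by rewrite -size_eq0 size_filter -lt0n -has_count.
rewrite mem_filter => /andP[bj bp] hb.
pose v : R := mcoeff b p *+ \prod_(i < k) (b i) ^_ (b i).
have v0 : v != 0.
  rewrite /v mulrn_eq0 negb_or mcoeff_eq0 bp andbT -lt0n.
  by apply/prodn_gt0 => i; rewrite ffactnn fact_gt0.
have hv : mderivm b p = mpolyC k v.
  apply/mpolyP => m; rewrite mcoeff_mderivm mcoeffC.
  have [->|m0] := eqVneq m (@mnm0 k); first by rewrite mulr1 addm0.
  rewrite mulr0; suff /memN_msupp_eq0 -> : (mnm_add b m) \notin msupp p by rewrite mul0rn.
  apply/negP => hbm.
  have : (mnm_add b m) \in [seq m : multinom k <- msupp p | 0 < m j]%N.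
    by rewrite mem_filter hbm andbT mnmDE ltn_addr.
  move=> /hb; rewrite mdegD -[leqRHS]addn0 leq_add2l leqn0 mdeg_eq0.
  by rewrite (negbTE m0).
have [K hK] := he b bj.
have xj0 (x : 'I_k -> R) : ge1 x -> 0 < x j by exact: ge1_gt0.
have hK' x : ge1 x -> `|v| * x j `^ e <= K * meval x p.
  move=> hx; have := hK x hx; rewrite hv mevalC normrM normfV (gtr0_norm (p0 _ hx)).
  rewrite ler_pdivrMr ?p0// powRN mulrAC ler_pdivlMr//.
  by rewrite powR_gt0// xj0.
have K0 : 0 < K.
  have h1 : ge1 (fun _ : 'I_k => 1 : R) by move=> ?.
  have := hK' _ h1; rewrite powR1 mulr1 => h.
  have : 0 < K * meval (fun _ : 'I_k => 1) p by rewrite (lt_le_trans _ h)// normr_gt0.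
  by rewrite pmulr_lgt0// p0.
exists (`|v| / K), e; split => //; first by rewrite divr_gt0// normr_gt0.
by move=> x hx; rewrite mulrAC ler_pdivrMr// [leRHS]mulrC hK'.
Qed.

Lemma meval_not_occurs (k : nat) (p : mpoly k R) (j : 'I_k) (x y : 'I_k -> R) :
  ~~ occurs j p -> (forall i, i != j -> x i = y i) -> meval x p = meval y p.
Proof.
move=> /hasPn hj h; rewrite !mevalE [LHS]big_seq [RHS]big_seq.
apply: eq_bigr => m hm; congr (_ * _); apply: eq_bigr => i _.
have [->|ij] := eqVneq i j; last by rewrite h.
by have := hj m hm; rewrite lt0n negbK => /eqP ->.
Qed.

Lemma HDF_lower (k : nat) (p : mpoly k R) : HDF p -> bounded_below p.
Proof.
move=> hp; have [/existsP[j hj]|h] := boolP [exists j, occurs j p].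
  have [c [e [c0 e0 hc]]] := HDF_lower_var hp hj; exists c => // x hx.
  rewrite (le_trans _ (hc x hx))// ler_peMr ?(ltW c0)//.
  by rewrite -[leLHS](powRr0 (x j)) ler_powR ?(ltW e0)// hx.
have h1 : ge1 (fun _ : 'I_k => 1 : R) by move=> ?.
exists (meval (fun=> 1) p); first by case: hp => p0 _; exact: p0.
move=> x hx; rewrite le_eqVlt; apply/orP; left; apply/eqP.
rewrite !mevalE [LHS]big_seq [RHS]big_seq; apply: eq_bigr => m hm; congr (_ * _).
apply: eq_bigr => i _; have : ~~ occurs i p by apply: contraNN h => hi; apply/existsP; exists i.
by move=> /hasPn/(_ m hm); rewrite lt0n negbK => /eqP ->.
Qed.

Lemma min_pos (k : nat) (f : 'I_k -> R) : (forall i, 0 < f i) ->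
  exists2 e : R, 0 < e & forall i, e <= f i.
Proof.
elim: k f => [|k ih] f h; first by exists 1 => // -[].
have [e e0 he] := ih (fun i => f (lift ord0 i)) (fun i => h _).
exists (Num.min e (f ord0)); first by rewrite lt_min e0 h.
by move=> i; have [j ->|->] := unliftP ord0 i; rewrite ge_min ?he ?lexx ?orbT.
Qed.

(** Since [p] has bounded degree, the gain in the largest of the variables that are
    differentiated can be spread over all of them, at the cost of a factor in
    the exponent. *)
Lemma HDF_symbol (k : nat) (p : mpoly k R) : HDF p ->
  exists2 e : R, 0 < e & forall eps, 0 < eps <= e -> symbolic eps p.
Proof.
move=> [p0 hp].
have /choice[f hf] : forall j : 'I_k, exists e : R, 0 < e /\
    forall b : multinom k, (1 <= b j)%N -> exists K : R, forall x : 'I_k -> R, ge1 x ->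
       `| meval x (mderivm b p) / meval x p | <= K * x j `^ (- e).
  by move=> j; have [e e0 he] := hp j; exists e.
have [e1 e10 he1] := min_pos (fun j => (hf j).1).
pose D : R := (msize p).+1%:R.
have D0 : 0 < D by rewrite ltr0n.
exists (e1 / D); first by rewrite divr_gt0.
move=> eps /andP[eps0 epse] b.
have [hb|hb] := leqP (msize p) (mdeg b).
  exists 0 => // x hx; rewrite mul0r (_ : mderivm b p = 0) ?meval0 ?normr0//.
  apply/mpolyP => m; rewrite mcoeff_mderivm mcoeff0 memN_msupp_eq0 ?mul0rn//.
  by apply/negP => /msize_mdeg_lt; rewrite mdegD ltnNge (leq_trans hb)// leq_addr.
have [->|b0] := eqVneq b (@mnm0 k).
  exists 1 => // x hx; rewrite mderivm0m ger0_norm ?(ltW (p0 _ hx))// mul1r.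
  rewrite ler_peMl ?(ltW (p0 _ hx))// W_ge1// => i.
  by rewrite mnm0E mul0r oppr0.
have /choice[K hK] : forall j : 'I_k, exists K : R, 0 <= K /\ ((1 <= b j)%N ->
    forall x : 'I_k -> R, ge1 x ->
       `| meval x (mderivm b p) / meval x p | <= K * x j `^ (- f j)).
  move=> j; have [hj|hj] := leqP 1 (b j); last by exists 0.
  have [K hK] := (hf j).2 b hj; exists `|K|; split=> // _ x hx.
  by rewrite (le_trans (hK x hx))// ler_wpM2r ?powR_ge0// ler_norm.
exists (\sum_j K j); first by apply: sumr_ge0 => j _; have [] := hK j.
move=> x hx.
have [j0 hj0] : exists j0, (0 < b j0)%N.
  apply/existsP; apply: contraNT b0; rewrite negb_exists => /forallP h.
  by apply/eqP/mnmP => i; rewrite mnm0E; have := h i; rewrite lt0n negbK => /eqP.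
(* The largest of the variables that occur in [b] carries the gain of all of them. *)
have [j hj hmax] := @arg_maxP _ _ 'I_k j0 (fun j => 0 < b j)%N x hj0.
have xj0 : 0 < x j by exact: ge1_gt0.
have := (hK j).2 hj x hx; rewrite normrM normfV (gtr0_norm (p0 _ hx)) ler_pdivrMr ?p0//.
move=> /le_trans; apply; rewrite mulrA ler_wpM2r ?(ltW (p0 _ hx))//.
apply: ler_pM; rewrite ?powR_ge0//; first by have [] := hK j.
  by apply: ler_sum_term => i; have [] := hK i.
apply: (@le_trans _ _ (x j `^ (- ((mdeg b)%:R * eps)))).
  rewrite ler_powR// lerN2 (le_trans _ (he1 j))//.
  apply: (@le_trans _ _ (D * (e1 / D))); last by rewrite mulrC divfK ?lt0r_neq0.
  apply: ler_pM => //; first exact: ltW.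
  by rewrite ler_nat ltnW// ltnW.
rewrite mdegE natr_sum mulr_suml -sumrN.
rewrite (_ : x j `^ _ = \prod_(i < k) x j `^ (- ((b i)%:R * eps))); last first.
  elim/big_rec2: _ => [|i y1 y2 _ <-]; first by rewrite powRr0.
  by rewrite powRD// (lt0r_neq0 xj0) implybT.
apply: ler_prod => i _; rewrite powR_ge0 /=.
have [->|bi] := posnP (b i); first by rewrite mul0r oppr0 !powRr0.
have xi0 : 0 < x i by exact: ge1_gt0.
rewrite !powRN lef_pV2 ?posrE ?powR_gt0//.
apply: ge0_ler_powR; rewrite ?nnegrE ?mulr_ge0 ?(ltW eps0) ?(ltW xi0) ?(ltW xj0)//.
exact: hmax.
Qed.

Lemma ord_max_or_wd (k : nat) (i : 'I_k.+1) : i = ord_max \/ exists j, i = wd j.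
Proof.
have [->|im] := eqVneq i ord_max; first by left.
right; have ik : (i < k)%N by rewrite ltn_neqAle -ltnS ltn_ord andbT.
by exists (Ordinal ik); apply: val_inj.
Qed.

Lemma prj_sh_wd (k : nat) (x : 'I_k.+1 -> R) (j : 'I_k) t :
  prj (sh x (wd j) t) = sh (prj x) j t.
Proof. by apply/funext => i; rewrite /prj /sh. Qed.

Lemma prj_sh_max (k : nat) (x : 'I_k.+1 -> R) t : prj (sh x ord_max t) = prj x.
Proof.
apply/funext => i; rewrite /prj /sh (_ : (wd i == ord_max) = false) ?mul0r ?addr0//.
by apply/eqP => /(congr1 val) /= h; have := ltn_ord i; rewrite h ltnn.
Qed.

Lemma prj_ge1 (k : nat) (x : 'I_k.+1 -> R) : ge1 x -> ge1 (prj x).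
Proof. by move=> h i; exact: h. Qed.

Section PolySymbols.
Variables (k : nat) (eps : R).
Hypothesis eps01 : 0 < eps <= 1.
Variables (S : Type) (B : S -> Prop).

Lemma Sym_poly_deriv (p : mpoly k R) : (forall x, ge1 x -> 0 < meval x p) ->
  symbolic eps p ->
  forall K (b : multinom k), Sym eps B K
    (fun x => W (fun i => - ((b i)%:R * eps)) (prj x) * meval (prj x) p)
    (fun _ x => (meval (prj x) (mderivm b p))%:C%C).
Proof.
move=> p0 hp; elim=> [|K ih] b; split=> //.
- have [c c0 hc] := hp b; exists c => // s x _ hx.
  by rewrite Nreal hc//; exact: prj_ge1.
- have [c c0 hc] := hp b; exists c => // s x _ hx.
  by rewrite Nreal hc//; exact: prj_ge1.
move=> i; have [->|[j ->]] := ord_max_or_wd i.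
  exists (fun _ _ => 0).
    move=> s _ x hx; apply: cder_ext (cder_cst _ _) _ => t.
    by rewrite prj_sh_max.
  apply: Sym_zero => x hx; have hx' := prj_ge1 hx.
  by rewrite !mulr_ge0 ?powR_ge0 ?W_ge0// ltW// p0.
exists (fun _ x => (meval (prj x) (mderivm (mnm_add b (mnm1 j)) p))%:C%C).
  move=> s _ x hx; apply: cder_congr (cder_ext (cder_real (is_derive_meval _ (prj x) j)) _) _.
    by move=> t; rewrite prj_sh_wd.
  by rewrite mderivmDm mderivmU1m.
apply: Sym_eqw (ih _) => x hx; have hx' := prj_ge1 hx.
rewrite mulrAC; congr (_ * _).
rewrite -[x (wd j)]/(prj x j) -(W_dec _ j eps hx'); congr W; apply/funext => i'.
by rewrite /dec mnmDE mnm1E natrD eq_sym; ring.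
Qed.

Lemma Sym_last K (i0 : 'I_k.+1) : Sym eps B K (fun x => x i0) (fun _ x => (x i0)%:C%C).
Proof.
have hd : dominated B (fun x : 'I_k.+1 -> R => x i0) (fun _ x => (x i0)%:C%C).
  by exists 1 => // s x _ hx; rewrite Nreal mul1r ger0_norm// (le_trans ler01 (hx i0)).
case: K => [|K]; split=> // i.
have hder (x : 'I_k.+1 -> R) : cder (fun t => (sh x i t i0)%:C%C) 0 ((i0 == i)%:R%:C%C).
  by apply: cder_real; exact: is_derive_sh.
exists (fun _ _ => (i0 == i)%:R%:C%C); first by move=> s _ x _; exact: hder.
have [<-|_] := eqVneq i0 i; last first.
  by apply: Sym_zero => x hx; rewrite mulr_ge0 ?powR_ge0// (le_trans ler01 (hx i0)).
have /andP[e0 e1] := eps01.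
apply: (@Sym_cst _ _ _ _ _ _ _ (fun=> 1%:C%C) 1) => //.
  by move=> s _; rewrite Nreal normr1.
move=> x hx; have x0 := ge1_gt0 i0 hx.
rewrite -[X in X * _](powRr1 (ltW x0)) -powRD ?(lt0r_neq0 x0) ?implybT//.
by rewrite -[leLHS](powRr0 (x i0)) ler_powR// subr_ge0.
Qed.

End PolySymbols.

(** Otherwise the product would not depend on [x_j] and could not tend to infinity along
    that axis. *)
Lemma tends_to_infty_occurs (T' k d : nat) (P : 'I_T' -> mpoly k R)
    (Q : 'I_d.+1 -> mpoly k R) (j : 'I_k) : tends_to_infty P Q ->
  (exists i, occurs j (P i)) \/ (exists i, occurs j (Q i)).
Proof.
move=> h; apply: contrapT => /not_orP[hP hQ].
pose one : 'I_k -> R := fun=> 1.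
pose A0 := (\prod_(i < T') meval one (P i)) * (\prod_(i < d.+1) meval one (Q i)) `^ (d.+1%:R^-1).
have [B hB] := h (A0 + 1).
pose x (i : 'I_k) : R := if i == j then Num.max 1 B else 1.
have hx : ge1 x by move=> i; rewrite /x; case: eqP => _ //; rewrite le_max lexx.
have : B <= \sum_(i < k) x i.
  rewrite (bigD1 j)//= {1}/x eqxx (le_trans (_ : B <= Num.max 1 B))//.
    by rewrite le_max lexx orbT.
  by rewrite lerDl sumr_ge0// => i _; rewrite (le_trans ler01 (hx i)).
move=> /(hB x hx).
have ex i : i != j -> x i = one i by rewrite /x => /negbTE ->.
have -> : \prod_(i < T') meval x (P i) = \prod_(i < T') meval one (P i).
  apply: eq_bigr => i _; apply: (@meval_not_occurs _ _ j) => //.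
  by apply/negP => hi; apply: hP; exists i.
have -> : \prod_(i < d.+1) meval x (Q i) = \prod_(i < d.+1) meval one (Q i).
  apply: eq_bigr => i _; apply: (@meval_not_occurs _ _ j) => //.
  by apply/negP => hi; apply: hQ; exists i.
by rewrite -/A0 gerDl ler10.
Qed.

End Polynomials.

(** * The coefficients of the expansion *)

Section Coefficients.
Variables (R : realType) (d : nat) (a : 'I_d.+1 -> nat).
Notation C := R[i].
Hypothesis d_ge1 : (1 <= d)%N.
Hypothesis a_incr : forall i j : 'I_d.+1, (i < j)%N -> (a i < a j)%N.

Lemma a_lt_max (j : 'I_d) : (a (wd j) < a ord_max)%N.
Proof. exact: (a_incr (i := wd j) (j := ord_max) (ltn_ord j)). Qed.

Definition gap (j : 'I_d) : nat := (a ord_max - a (wd j))%N.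

Lemma gap_gt0 j : (0 < gap j)%N.
Proof. by rewrite subn_gt0; exact: a_lt_max. Qed.

Lemma gapE j : (gap j)%:R = (a ord_max)%:R - (a (wd j))%:R :> R.
Proof. by rewrite natrB//; exact/ltnW/a_lt_max. Qed.

Lemma amax_gt0 : (0 < a ord_max)%N.
Proof. exact: leq_ltn_trans (leq0n _) (a_lt_max (Ordinal d_ge1)). Qed.

(** The words in the letters [0 .. d-1] record which terms of [P_T] have been divided by
    [P_T]; each letter lowers the degree in the last variable by its gap. *)
Definition word_gap (w : seq 'I_d) : nat := (\sum_(j <- w) gap j)%N.

Lemma word_gap_cons j w : word_gap (j :: w) = (gap j + word_gap w)%N.
Proof. by rewrite /word_gap big_cons. Qed.

Lemma word_gap_le w : (word_gap w <= size w * a ord_max)%N.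
Proof.
elim: w => [|j w ih]; first by rewrite /word_gap big_nil.
by rewrite word_gap_cons /= mulSn leq_add// leq_subr.
Qed.

(* Whether [1 - word_gap w - a_d s] vanishes at a non-positive integer, which is
   then [- pole_index w]. *)
Definition npole (w : seq 'I_d) : bool :=
  (0 < word_gap w)%N && (a ord_max %| (word_gap w).-1)%N.

Definition pole_index (w : seq 'I_d) : nat := ((word_gap w).-1 %/ a ord_max)%N.

Lemma npoleP w : npole w -> word_gap w = (1 + pole_index w * a ord_max)%N.
Proof. by case/andP => t0 hd; rewrite divnK// add1n prednK. Qed.

Definition bpoly (w : seq 'I_d) : {poly C} :=
  (1 - (word_gap w)%:R)%:P - (a ord_max)%:R *: 'X.

(** The coefficients of the expansion along words, as fractions (numerator,
    denominator). The recursion divides by [bpoly w]. When [npole w] this would create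
    a pole at the non-positive integer [- pole_index w]; but there the numerator, which
    contains the factors ['X + size w'] of the suffixes [w'] of [w], vanishes, and the
    factor is cancelled instead. *)
Fixpoint gam (w : seq 'I_d) : {poly C} * {poly C} :=
  let q := if w is j :: w' then
             (- ((gap j)%:R *: (('X + (size w')%:R%:P) * (gam w').1)), (gam w').2)
           else (1, 1) in
  if npole w then
    (- (a ord_max)%:R^-1 *: (q.1 %/ ('X - (- (pole_index w)%:R)%:P)), q.2)
  else (q.1, q.2 * bpoly w).

Definition del (w : seq 'I_d) : {poly C} * {poly C} :=
  if w is j :: w' then
    (- ((gap j)%:R *: (('X + (size w')%:R%:P) * (gam w').1)), (gam w').2)
  else (1, 1).

Lemma gamE w : gam w = if npole w then
    (- (a ord_max)%:R^-1 *: ((del w).1 %/ ('X - (- (pole_index w)%:R)%:P)), (del w).2)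
  else ((del w).1, (del w).2 * bpoly w).
Proof. by case: w. Qed.

Definition gamv w (s : C) : C := (gam w).1.[s] / (gam w).2.[s].
Definition delv w (s : C) : C := (del w).1.[s] / (del w).2.[s].

Lemma delv_nil s : delv [::] s = 1.
Proof. by rewrite /delv /= hornerC divr1. Qed.

Lemma delv_cons j w s : delv (j :: w) s = - ((s + (size w)%:R) * (gap j)%:R * gamv w s).
Proof.
rewrite /delv /gamv /= hornerN hornerZ hornerM hornerD hornerX hornerC.
by rewrite mulNr; congr (- _); ring.
Qed.

Lemma amaxC_neq0 : (a ord_max)%:R != 0 :> C.
Proof. by rewrite pnatr_eq0 -lt0n amax_gt0. Qed.

Lemma bpoly_neq0 w : bpoly w != 0.
Proof.
apply/eqP => /(congr1 (fun p : {poly C} => p`_1)).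
rewrite coef0 coefB coefC coefZ coefX /= mulr1 sub0r => /eqP.
by rewrite oppr_eq0 (negbTE amaxC_neq0).
Qed.

Lemma bpolyE w s : (bpoly w).[s] = 1 - (word_gap w)%:R - (a ord_max)%:R * s.
Proof. by rewrite /bpoly hornerD hornerN hornerZ hornerX hornerC. Qed.

Lemma del_den_neq0 w : (gam w).2 != 0 /\ (del w).2 != 0.
Proof.
elim: w => [|j w [ih _]]; rewrite gamE; case: ifP => _ /=; split;
  rewrite ?mulf_neq0 ?oner_neq0 ?bpoly_neq0//.
Qed.

Lemma gam_den_neq0 w : (gam w).2 != 0. Proof. exact: (del_den_neq0 w).1. Qed.

Lemma gam_den_del w s : (gam w).2.[s] != 0 -> (del w).2.[s] != 0.
Proof.
by rewrite gamE; case: ifP => _ //=; rewrite hornerM mulf_eq0 negb_or => /andP[].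
Qed.

Lemma gam_den_root w s : (gam w).2.[s] = 0 ->
  exists2 w', ~~ npole w' & (a ord_max)%:R * s = 1 - (word_gap w')%:R.
Proof.
have hb w0 : ~~ npole w0 -> (bpoly w0).[s] = 0 ->
    exists2 w', ~~ npole w' & (a ord_max)%:R * s = 1 - (word_gap w')%:R.
  move=> h; rewrite bpolyE => e; exists w0 => //; apply/esym/eqP.
  by rewrite -subr_eq0 e.
elim: w => [|j w ih]; rewrite gamE; case: ifPn => hn /=.
- by rewrite hornerC => /eqP; rewrite oner_eq0.
- by rewrite mul1r; exact: hb.
- exact: ih.
- by rewrite hornerM => /eqP; rewrite mulf_eq0 => /orP[/eqP/ih|/eqP/(hb _ hn)].
Qed.

Lemma root_npole w (k : nat) : (a ord_max)%:R * (- k%:R) = 1 - (word_gap w)%:R :> C -> npole w.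
Proof.
move=> /eqP; rewrite mulrN eqr_oppLR opprB eq_sym subr_eq -natrM natr1 eqr_nat => /eqP e.
by rewrite /npole e /= dvdn_mulr.
Qed.

Lemma pole_index_lt w : npole w -> (pole_index w < size w)%N.
Proof.
move=> /npoleP h; rewrite -(ltn_pmul2r amax_gt0).
by apply: leq_trans (word_gap_le w); rewrite h add1n.
Qed.

(** Words grow at their head and the gaps are positive, so the value [1 + k a_d], at which
    the root [- k] is cancelled, is not reached by a proper suffix of [w]. *)
Lemma root_del w (k : nat) : (k < size w)%N -> (word_gap w <= 1 + k * a ord_max)%N ->
  root (del w).1 (- k%:R).
Proof.
elim: w k => [//|j w ih] k /=; rewrite ltnS leq_eqVlt => hk.
rewrite word_gap_cons => ht.
rewrite rootE hornerN hornerZ hornerM hornerD hornerX hornerC.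
have [e|kw] := eqVneq k (size w); first by rewrite e addNr mul0r mulr0 oppr0.
have {}hk : (k < size w)%N by case/predU1P: hk => // e; rewrite e eqxx in kw.
have tw : (word_gap w < 1 + k * a ord_max)%N.
  by apply: leq_trans ht; rewrite -[X in (X <= _)%N]add1n leq_add2r gap_gt0.
have := ih k hk (ltnW tw); rewrite rootE => /eqP hr.
suff -> : (gam w).1.[- k%:R] = 0 by rewrite mulr0 mulr0 oppr0.
rewrite gamE; case: ifP => hn //=; rewrite hornerZ.
have hN := npoleP hn.
have hNk : pole_index w != k.
  by apply/eqP => e; move: tw; rewrite hN e ltnn.
have hd : 'X - (- (pole_index w)%:R)%:P %| (del w).1.
  by rewrite dvdp_XsubCl; apply: ih; rewrite ?pole_index_lt ?hN.
move: hr; rewrite -{1}(divpK hd) hornerM hornerXsubC opprK => /eqP.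
rewrite mulf_eq0 => /orP[/eqP -> |]; first by rewrite mulr0.
by rewrite addrC subr_eq0 eqr_nat (negbTE hNk).
Qed.

Lemma gamv_bpoly w s : (gam w).2.[s] != 0 ->
  (1 - (word_gap w)%:R - (a ord_max)%:R * s) * gamv w s = delv w s.
Proof.
move=> h; have hd := gam_den_del h; move: h.
rewrite /gamv /delv gamE; case: ifP => hn /= h.
  have hN := npoleP hn.
  have hdv : 'X - (- (pole_index w)%:R)%:P %| (del w).1.
    by rewrite dvdp_XsubCl; apply: root_del; rewrite ?pole_index_lt ?hN.
  rewrite -[in RHS](divpK hdv) hornerM hornerXsubC hornerZ opprK hN natrD natrM.
  have := amaxC_neq0; set q := (_ %/ _).[s]; set A := (a ord_max)%:R => A0.
  by field; rewrite hd A0.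
move: h; rewrite !hornerM bpolyE mulf_eq0 negb_or => /andP[h1 h2].
by field; rewrite h1 h2.
Qed.

(** At a non-positive integer [bpoly w] vanishes only when [npole w], and then it has been
    cancelled. *)
Lemma gam_den_nonpos w (k : nat) : (gam w).2.[- k%:R] != 0.
Proof.
apply/eqP => /gam_den_root[w' hw' /root_npole h].
by rewrite h in hw'.
Qed.

End Coefficients.

(** * The summand and its multiples by ratios *)

Section Zeta.
Variables (R : realType) (T' n' d : nat) (a : 'I_d.+1 -> nat).
Variables (P : 'I_T' -> mpoly n' R) (Q : 'I_d.+1 -> mpoly n' R) (eps : R).
Notation C := R[i].
Notation X := ('I_n'.+1 -> R).
Notation V := 'rV[R[i]]_T'.+1.
Notation last := (@ord_max n').
Hypothesis eps01 : 0 < eps <= 1.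
Hypothesis a_incr : forall i j : 'I_d.+1, (i < j)%N -> (a i < a j)%N.

Hypothesis P_symb : forall j, symbolic eps (P j).
Hypothesis Q_symb : forall j, symbolic eps (Q j).
Hypothesis P_low : forall j, bounded_below (P j).
Hypothesis Q_low : forall j, bounded_below (Q j).

Let eps_gt0 : 0 < eps. Proof. by case/andP: eps01. Qed.

Lemma P_gt0 j x : ge1 x -> 0 < meval x (P j).
Proof. by move=> hx; have [c c0 hc] := P_low j; exact: lt_le_trans (hc _ hx). Qed.

Lemma Q_gt0 j x : ge1 x -> 0 < meval x (Q j).
Proof. by move=> hx; have [c c0 hc] := Q_low j; exact: lt_le_trans (hc _ hx). Qed.

Lemma xl_gt0 (x : X) : ge1 x -> 0 < x last. Proof. exact: ge1_gt0. Qed.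

Definition PTterm (j : 'I_d.+1) (x : X) : R := meval (prj x) (Q j) * x last ^+ a j.

Definition pT (x : X) : R := \sum_j PTterm j x.

(** The [T] polynomials on the same footing, as functions of all the [n] variables. *)
Definition pf (t : 'I_T'.+1) (x : X) : R :=
  if unlift ord_max t is Some j then meval (prj x) (P j) else pT x.

Lemma meval_polyT x : meval x (polyT Q a) = pT x.
Proof.
rewrite /polyT /pT (big_morph (meval x) (mevalD x) (meval0 x)); apply: eq_bigr => j _.
by rewrite mevalM meval_mwiden rmorphXn /= mevalXU.
Qed.

Lemma pf_max x : pf ord_max x = pT x.
Proof. by rewrite /pf unlift_none. Qed.

Lemma pf_wd j x : pf (wd j) x = meval (prj x) (P j).
Proof.
rewrite /pf (_ : wd j = lift ord_max j) ?liftK//.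
by apply: val_inj; exact/esym/lift_max.
Qed.

Lemma PTterm_gt0 j x : ge1 x -> 0 < PTterm j x.
Proof. by move=> hx; rewrite mulr_gt0 ?exprn_gt0 ?xl_gt0 ?Q_gt0//; exact: prj_ge1. Qed.

Lemma PTterm_le_pT j x : ge1 x -> PTterm j x <= pT x.
Proof.
move=> hx; rewrite /pT (bigD1 j)//= lerDl sumr_ge0// => i _.
exact/ltW/PTterm_gt0.
Qed.

Lemma pT_gt0 x : ge1 x -> 0 < pT x.
Proof. by move=> hx; exact: lt_le_trans (PTterm_gt0 ord0 hx) (PTterm_le_pT _ hx). Qed.

Lemma pf_gt0 t x : ge1 x -> 0 < pf t x.
Proof.
move=> hx; have [->|[j ->]] := ord_max_or_wd t; first by rewrite pf_max pT_gt0.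
by rewrite pf_wd P_gt0//; exact: prj_ge1.
Qed.

Lemma pf_low : exists2 c : R, 0 < c & forall t x, ge1 x -> c <= pf t x.
Proof.
have /choice[f hf] : forall t : 'I_T'.+1, exists c : R, 0 < c /\ forall x, ge1 x -> c <= pf t x.
  move=> t; have [->|[j ->]] := ord_max_or_wd t.
    have [c c0 hc] := Q_low ord0; exists c; split=> // x hx.
    rewrite pf_max (le_trans _ (PTterm_le_pT ord0 hx))// (le_trans (hc _ (prj_ge1 hx)))//.
    by rewrite ler_peMr ?exprn_ege1 ?hx// ltW// Q_gt0//; exact: prj_ge1.
  have [c c0 hc] := P_low j; exists c; split=> // x hx.
  by rewrite pf_wd hc//; exact: prj_ge1.
have [e e0 he] := min_pos (fun t => (hf t).1).
by exists e => // t x hx; rewrite (le_trans (he t))//; exact: (hf t).2.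
Qed.

Lemma W_prj (D : R) (x : X) : 0 <= D -> ge1 x -> W (fun=> D) (prj x) <= W (fun=> D) x.
Proof.
move=> D0 hx; rewrite /W [leRHS]big_ord_recr /=.
rewrite ler_peMr ?prodr_ge0//; last by rewrite -[leLHS](powRr0 (x last)) ler_powR ?hx.
by move=> i _; exact: powR_ge0.
Qed.

Lemma pf_growth : exists c D : R, [/\ 1 <= c, 0 <= D & forall t x, ge1 x ->
  pf t x <= c * W (fun=> D) x /\ (pf t x)^-1 <= c * W (fun=> D) x].
Proof.
have /choice[f hf] : forall t : 'I_T'.+1, exists cD : R * R, [/\ 0 <= cD.1, 0 <= cD.2 &
    forall x, ge1 x -> pf t x <= cD.1 * W (fun=> cD.2) x].
  move=> t; have [->|[j ->]] := ord_max_or_wd t.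
    have [c [D [c0 D0 h]]] := meval_bound (polyT Q a); exists (c, D); split=> // x hx.
    by rewrite pf_max -meval_polyT (le_trans (ler_norm _))//= h.
  have [c [D [c0 D0 h]]] := meval_bound (P j); exists (c, D); split=> // x hx.
  rewrite pf_wd (le_trans (ler_norm _))//= (le_trans (h _ (prj_ge1 hx)))//.
  by rewrite ler_wpM2l// W_prj.
have [c c0 hc] := pf_low.
exists (1 + c^-1 + \sum_t (f t).1), (\sum_t (f t).2).
have s1 : 0 <= \sum_t (f t).1 by apply: sumr_ge0 => t _; have [] := hf t.
have s2 : 0 <= \sum_t (f t).2 by apply: sumr_ge0 => t _; have [] := hf t.
have c1 : 0 <= c^-1 by rewrite invr_ge0 ltW.
split=> //; first by rewrite -addrA lerDl addr_ge0.
move=> t x hx; split.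
  have [f1 f2 h] := hf t; rewrite (le_trans (h _ hx))//.
  apply: ler_pM; rewrite ?W_ge0//.
    rewrite (bigD1 t)//= addrCA lerDl addr_ge0// ?addr_ge0//.
    by apply: sumr_ge0 => u _; have [] := hf u.
  by apply: W_le => // _; apply: (ler_sum_term t) => u; have [] := hf u.
apply: (@le_trans _ _ (c^-1)).
  by rewrite lef_pV2 ?posrE ?pf_gt0// hc.
rewrite -[leLHS]mulr1; apply: ler_pM => //; last exact: W_ge1.
by rewrite addrAC lerDr addr_ge0.
Qed.

Definition Lg (t : 'I_T'.+1) (x : X) : R := ln (pf t x).

Lemma Lg_bound (c D : R) t x : 1 <= c -> 0 <= D -> ge1 x ->
  pf t x <= c * W (fun=> D) x -> (pf t x)^-1 <= c * W (fun=> D) x ->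
  `|Lg t x| <= ln (c * W (fun=> D) x).
Proof.
move=> c1 D0 hx h1 h2; have p0 := pf_gt0 t hx.
have Y0 : 0 < c * W (fun=> D) x by exact: lt_le_trans h1.
rewrite ler_norml; apply/andP; split; last by rewrite ler_ln ?posrE.
by rewrite lerNl -lnV ?posrE// ler_ln ?posrE ?invr_gt0.
Qed.

(** The product of the [pf t ^ (- s_t)], which carries the dependence on [s]. *)
Definition pows (s : V) (x : X) : C := cexp (- \sum_t s ord0 t * (Lg t x)%:C%C).

Definition ratio (j : 'I_d) (x : X) : R := PTterm (wd j) x / pT x.

Section Symbols.
Variables (S : Type) (B : S -> Prop).

Lemma Sym_extf K (M : X -> R) (f g : S -> X -> C) : (forall s x, f s x = g s x) ->
  Sym eps B K M f -> Sym eps B K M g.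
Proof.
by move=> h; rewrite (_ : f = g)//; apply/funext => s; apply/funext => x.
Qed.

Lemma Sym_poly K (p : mpoly n' R) : symbolic eps p -> (forall x, ge1 x -> 0 < meval x p) ->
  Sym eps B K (fun x => meval (prj x) p) (fun _ x => (meval (prj x) p)%:C%C).
Proof.
move=> hp p0; have := @Sym_poly_deriv R n' eps S B p p0 hp K (@mnm0 n').
rewrite mderivm0m; apply: Sym_eqw => x hx.
rewrite /W big1 ?mul1r// => i _.
by rewrite mnm0E mul0r oppr0 powRr0.
Qed.

Lemma Sym_PTterm K j : Sym eps B K (PTterm j) (fun _ x => (PTterm j x)%:C%C).
Proof.
have hX : Sym eps B K (fun x => x last ^+ a j) (fun _ x => (x last ^+ a j)%:C%C).
  elim: (a j) => [|k ih].
    apply: (@Sym_cst _ _ _ _ _ _ _ (fun=> 1%:C%C) 1) => //.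
    by move=> s _; rewrite Nreal normr1.
  apply: Sym_extf (Sym_eqw _ (Sym_mul (Sym_last eps01 B K last) ih)) => [s x|x _].
    by rewrite exprS rmorphM.
  by rewrite exprS.
apply: Sym_extf (Sym_mul (Sym_poly K (Q_symb j) _) hX) => [s x|x hx].
  by rewrite -rmorphM.
exact: Q_gt0.
Qed.

Lemma Sym_pT K : Sym eps B K pT (fun _ x => (pT x)%:C%C).
Proof.
apply: Sym_extf (@Sym_sum _ _ _ _ _ _ _ _ (index_enum _)
    (fun j _ x => (PTterm j x)%:C%C) _ _) => [s x|x hx|j].
- by rewrite rmorph_sum.
- exact/ltW/pT_gt0.
- apply: (@Sym_le _ _ _ _ _ _ (PTterm j) _ _ 1) (Sym_PTterm K j) => // x hx.
  by rewrite mul1r PTterm_le_pT.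
Qed.

Lemma Sym_pf K t : Sym eps B K (pf t) (fun _ x => (pf t x)%:C%C).
Proof.
have [->|[j ->]] := ord_max_or_wd t.
  apply: Sym_extf (Sym_eqw _ (Sym_pT K)) => [s x|x _]; by rewrite pf_max.
apply: Sym_extf (Sym_eqw _ (Sym_poly K (P_symb j) _)) => [s x|x _|x hx].
- by rewrite pf_wd.
- by rewrite pf_wd.
- exact: P_gt0.
Qed.

Lemma Sym_ratio K j : Sym eps B K (ratio j) (fun _ x => (ratio j x)%:C%C).
Proof.
apply: Sym_extf (Sym_mul (Sym_PTterm K (wd j)) (Sym_inv pT_gt0 Sym_pT K)) => s x.
by rewrite -rmorphM.
Qed.

Lemma Sym_Lg : exists2 D1 : R, 0 <= D1 &
  forall t K, Sym eps B K (W (fun=> D1)) (fun _ x => (Lg t x)%:C%C).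
Proof.
have [c [D [c1 D0 h]]] := pf_growth; exists D => // t.
apply: (@Sym_ln _ _ _ _ _ (pf t) _ c).
- by rewrite (le_trans ler01).
- exact: pf_gt0.
- by move=> K; exact: Sym_pf.
- by move=> x hx; exact: W_ge1.
move=> x hx; have [h1 h2] := h t x hx.
rewrite (le_trans (Lg_bound c1 D0 hx h1 h2))//.
exact/ltW/ln_sublinear/(lt_le_trans (pf_gt0 t hx) h1).
Qed.

(** The logarithm of [pows] is a combination of the [Lg t] with bounded coefficients, so a
    bound on [pows] makes it a symbol, uniformly in the exponents. *)
Lemma Sym_pows (D0 : R) (g : S -> V) (r : R) : 0 <= r ->
  (forall s, B s -> forall t, N (g s ord0 t) <= r) ->
  dominated B (W (fun=> D0)) (fun s => pows (g s)) ->
  forall K, Sym eps B K (W (fun=> D0)) (fun s => pows (g s)).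
Proof.
move=> r0 hr hd; apply: Sym_cexp => // K i.
have /choice[f hf] : forall t : 'I_T'.+1, exists f : S -> X -> C,
   (forall s, B s -> pd i (fun x => (ln (pf t x))%:C%C) (f s)) /\
   Sym eps B K (fun x => x i `^ (- eps)) f.
  move=> t; have [f h1 h2] := pd_ln (pf_gt0 t) (fun K => Sym_pf K t) K i.
  by exists f.
exists (fun s x => - \sum_t g s ord0 t * f t s x).
  move=> s hs x hx; apply: cder_opp; apply: cder_sum => t; apply: cder_scale.
  exact: (hf t).1.
apply: Sym_extf (Sym_scale (z := fun=> -1) (c := 1) _ _ (Sym_sum (index_enum _) _
  (F := fun t s x => g s ord0 t * f t s x) _)) => [s x|//|s _|x hx|t].
- by rewrite mulN1r.
- by rewrite NN -[1]/(1%:C%C) Nreal normr1.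
- exact: powR_ge0.
- exact: (Sym_scale (z := fun s => g s ord0 t) r0 (fun s hs => hr s hs t) (hf t).2).
Qed.

End Symbols.

Lemma W_pow (D r : R) (x : X) : W (fun=> D) x `^ r = W (fun=> D * r) x.
Proof.
rewrite /W; elim: (index_enum _) => [|i l ih]; first by rewrite !big_nil powR1.
rewrite !big_cons powRM ?powR_ge0 ?powRrM ?ih//.
by apply: prodr_ge0 => k _; exact: powR_ge0.
Qed.

Lemma Re_sum (I : Type) (r : seq I) (F : I -> C) :
  complex.Re (\sum_(i <- r) F i) = \sum_(i <- r) complex.Re (F i).
Proof. by elim/big_rec2: _ => // i y1 y2 _ <-; case: (F i) y2 => ? ? []. Qed.

Lemma N_pows (s : V) x : N (pows s x) <= 2 * expR (- \sum_t complex.Re (s ord0 t) * Lg t x).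
Proof.
rewrite /pows (le_trans (N_cexp _))// ler_wpM2l// ler_expR.
rewrite (_ : complex.Re (- _) = - complex.Re (\sum_t s ord0 t * (Lg t x)%:C%C)); last first.
  by case: (\sum_t _).
rewrite Re_sum lerN2; apply: ler_sum => t _.
by case: (s ord0 t) => u v /=; rewrite mulr0 subr0.
Qed.

Lemma pows_ball (r : R) : 0 <= r -> exists2 D0 : R, 0 <= D0 &
  dominated (fun s : V => forall t, N (s ord0 t) <= r) (W (fun=> D0)) pows.
Proof.
move=> r0; have [c [D [c1 D0 h]]] := pf_growth.
have c0 : 0 < c by exact: lt_le_trans ltr01 c1.
pose k := r * T'.+1%:R.
have k0 : 0 <= k by rewrite mulr_ge0.
exists (D * k); first exact: mulr_ge0.
exists (2 * c `^ k); first by rewrite mulr_ge0 ?powR_ge0.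
move=> s x hs hx; rewrite (le_trans (N_pows _ _))// -mulrA ler_wpM2l//.
have W0 : 0 < W (fun=> D) x by apply: lt_le_trans (W_ge1 hx _).
have Y0 : 0 < c * W (fun=> D) x by rewrite mulr_gt0.
rewrite -W_pow -powRM ?(ltW c0) ?(ltW W0)// /powR (gt_eqF Y0) ler_expR.
rewrite -sumrN.
apply: (@le_trans _ _ (\sum_(t < T'.+1) r * ln (c * W (fun=> D) x))).
  apply: ler_sum => t _; have [h1 h2] := h t x hx.
  rewrite (le_trans (ler_norm _))// normrN normrM; apply: ler_pM => //.
    by rewrite (le_trans _ (hs t))// /N lerDl.
  exact: Lg_bound.
by rewrite sumr_const card_ord -mulr_natr /k mulrAC.
Qed.

Lemma ratio_le1 j x : ge1 x -> ratio j x <= 1.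
Proof. by move=> hx; rewrite ler_pdivrMr ?pT_gt0// mul1r PTterm_le_pT. Qed.

Definition gain (D' : R) (k : 'I_n'.+1) : R := if k == last then - 1 else D'.

(** [Q_j / Q_d] grows at most polynomially and [a_j < a_d]: a ratio decays in the last
    variable at the cost of a polynomial growth in the others, which summation
    by parts can absorb. *)
Lemma ratio_gain : exists2 D' : R, 0 <= D' & exists2 c : R, 0 <= c &
  forall j x, ge1 x -> ratio j x <= c * W (gain D') x.
Proof.
have /choice[f hf] : forall j : 'I_d, exists cD : R * R, [/\ 0 <= cD.1, 0 <= cD.2 &
    forall x : 'I_n' -> R, ge1 x -> meval x (Q (wd j)) <= cD.1 * W (fun=> cD.2) x].
  move=> j; have [c [D [c0 D0 h]]] := meval_bound (Q (wd j)); exists (c, D); split=> // x hx.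
  by rewrite (le_trans (ler_norm _))// h.
have [q q0 hq] := Q_low ord_max.
have s1 : 0 <= \sum_j (f j).1 by apply: sumr_ge0 => t _; have [] := hf t.
have s2 : 0 <= \sum_j (f j).2 by apply: sumr_ge0 => t _; have [] := hf t.
exists (\sum_j (f j).2) => //; exists ((\sum_j (f j).1) / q); first by rewrite divr_ge0 ?(ltW q0).
move=> j x hx; have hx' := prj_ge1 hx; have [f1 f2 h] := hf j.
rewrite /ratio ler_pdivrMr ?pT_gt0//.
apply: (@le_trans _ _ ((\sum_j (f j).1) / q * W (gain (\sum_j (f j).2)) x * PTterm ord_max x)); last first.
  by rewrite ler_wpM2l ?PTterm_le_pT// mulr_ge0 ?W_ge0// divr_ge0 ?(ltW q0).
have Wg : W (gain (\sum_j (f j).2)) x = W (fun=> \sum_j (f j).2) (prj x) * (x last)^-1.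
  rewrite /W big_ord_recr /= /gain eqxx powR_inv1 ?(ltW (xl_gt0 hx))//; congr (_ * _).
  apply: eq_bigr => i _; case: eqP => // /(congr1 val) /= e.
  by have := ltn_ord i; rewrite e ltnn.
rewrite Wg /PTterm.
have hm : meval (prj x) (Q (wd j)) <= (\sum_j (f j).1) * W (fun=> \sum_j (f j).2) (prj x).
  rewrite (le_trans (h _ hx'))//; apply: ler_pM; rewrite ?W_ge0//.
    by apply: ler_sum_term => t; have [] := hf t.
  by apply: W_le => // _; apply: (ler_sum_term j) => t; have [] := hf t.
have hpow : x last ^+ a (wd j) <= (x last)^-1 * x last ^+ a ord_max.
  have xl := xl_gt0 hx.
  rewrite mulrC ler_pdivlMr// -exprSr ler_weXn2l ?hx//; exact: (a_lt_max a_incr).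
apply: le_trans (_ : (\sum_j (f j).1) * W (fun=> \sum_j (f j).2) (prj x) *
    ((x last)^-1 * x last ^+ a ord_max) <= _).
  apply: ler_pM => //; first exact/ltW/Q_gt0.
  by rewrite exprn_ge0// (ltW (xl_gt0 hx)).
set A := \sum_j (f j).1; set w := W _ (prj x); set y := x last ^- 1.
rewrite (_ : A / q * (w * (x last)^-1) * (meval (prj x) (Q ord_max) * x last ^+ a ord_max) =
  (A * w * ((x last)^-1 * x last ^+ a ord_max)) * (meval (prj x) (Q ord_max) / q)); last first.
  by rewrite -!mulrA; congr (_ * _); rewrite mulrCA; congr (_ * _); ring.
rewrite ler_peMr//; last by rewrite ler_pdivlMr// mul1r hq.
by rewrite !mulr_ge0 ?W_ge0// ?invr_ge0 ?exprn_ge0 ?(ltW (xl_gt0 hx)).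
Qed.

Definition ratios (w : seq 'I_d) (x : X) : R := \prod_(j <- w) ratio j x.

Lemma Sym_ratios_one (S : Type) (B : S -> Prop) K w :
  Sym eps B K (W (fun=> 0)) (fun _ x => (ratios w x)%:C%C).
Proof.
elim: w => [|j w ih].
  apply: Sym_extf (@Sym_cst _ _ _ _ _ _ _ (fun=> 1%:C%C) 1 _ _ _) => [s x|//|s _|x hx].
  - by rewrite /ratios big_nil.
  - by rewrite Nreal normr1.
  - exact: W_ge1.
apply: Sym_extf (Sym_le ler01 _ (Sym_mul (Sym_ratio B K j) ih)) => [s x|x hx].
  by rewrite -rmorphM /ratios big_cons.
by rewrite mul1r ler_piMl ?W_ge0 ?ratio_le1.
Qed.

Lemma Sym_ratios_gain (S : Type) (B : S -> Prop) K (D' c : R) N1 w : 0 <= D' -> 0 <= c ->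
  (forall j x, ge1 x -> ratio j x <= c * W (gain D') x) -> (N1 <= size w)%N ->
  Sym eps B K (W (fun k => N1%:R * gain D' k)) (fun _ x => (ratios w x)%:C%C).
Proof.
move=> D0 c0 h; elim: N1 w => [|N1 ih] w.
  move=> _; apply: Sym_eqw (Sym_ratios_one B K w) => x _; congr W.
  by apply/funext => k; rewrite mul0r.
case: w => [//|j w]; rewrite [(_ <= _)%N]/= ltnS => hw.
apply: Sym_extf (Sym_le c0 _ (Sym_mul (Sym_ratio B K j) (ih w hw))) => [s x|x hx].
  by rewrite -rmorphM /ratios big_cons.
rewrite (_ : (fun k => N1.+1%:R * gain D' k) = (fun k => gain D' k + N1%:R * gain D' k)).
  by rewrite -WD// mulrA ler_wpM2r ?W_ge0 ?h.
by apply/funext => k; rewrite -natr1 mulrDl mul1r addrC.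
Qed.

(** The Euler operator [x_n d/dx_n]: the ratios and the logarithms [Lg t] generate
    an algebra that it preserves. *)
Definition eul (f th : X -> R) : Prop := forall x, ge1 x ->
  is_derive (0 : R) (1 : R) (fun t => f (sh x last t)) (th x / x last).

Lemma eul_ext f th th' : eul f th -> (forall x, ge1 x -> th x = th' x) -> eul f th'.
Proof. by move=> h e x hx; rewrite -e//; exact: h. Qed.

Lemma eul_extf f g th : eul f th -> f =1 g -> eul g th.
Proof. by move=> h /funext <-. Qed.

Lemma eul_cst z : eul (fun=> z) (fun=> 0).
Proof. by move=> x _; rewrite mul0r; exact: is_derive_cst. Qed.

Lemma eul_add f g th th' : eul f th -> eul g th' ->
  eul (fun x => f x + g x) (fun x => th x + th' x).
Proof.
move=> h1 h2 x hx.
by apply: is_derive_congr (is_derive_add (h1 x hx) (h2 x hx)) _; rewrite mulrDl.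
Qed.

Lemma eul_mul f g th th' : eul f th -> eul g th' ->
  eul (fun x => f x * g x) (fun x => th x * g x + f x * th' x).
Proof.
move=> h1 h2 x hx; apply: is_derive_congr (is_derive_mul (h1 x hx) (h2 x hx)) _.
by rewrite sh0; ring.
Qed.

Lemma eul_opp f th : eul f th -> eul (fun x => - f x) (fun x => - th x).
Proof.
move=> h x hx; apply: is_derive_congr (is_derive_opp (h x hx)) _.
by rewrite mulNr.
Qed.

Lemma eul_sum (I : Type) (r : seq I) (F th : I -> X -> R) : (forall i, eul (F i) (th i)) ->
  eul (fun x => \sum_(i <- r) F i x) (fun x => \sum_(i <- r) th i x).
Proof.
move=> h; elim: r => [|i r ih].
  apply: eul_extf (eul_ext (eul_cst 0) _) _ => [x _|x]; by rewrite big_nil.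
apply: eul_extf (eul_ext (eul_add (h i) ih) _) _ => [x _|x]; by rewrite big_cons.
Qed.

Lemma eul_inv f th : (forall x, ge1 x -> 0 < f x) -> eul f th ->
  eul (fun x => (f x)^-1) (fun x => - th x / f x / f x).
Proof.
move=> f0 h x hx; have := f0 x hx; rewrite -{1}(sh0 x last) => fx.
have := @is_deriveV R (fun t => f (sh x last t)) 0 _ 1 (lt0r_neq0 fx) (h x hx).
move/is_derive_congr; apply; rewrite sh0 /GRing.scale /=.
have := lt0r_neq0 (f0 x hx); have := lt0r_neq0 (xl_gt0 hx) => x0 fx0.
by field; rewrite fx0 x0.
Qed.

Lemma eul_ln f th : (forall x, ge1 x -> 0 < f x) -> eul f th ->
  eul (fun x => ln (f x)) (fun x => th x / f x).
Proof.
move=> f0 h x hx; have := f0 x hx; rewrite -{1}(sh0 x last) => fx.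
apply: is_derive_congr (is_derive_comp (h x hx) (is_derive1_ln fx)) _.
by rewrite sh0 mulrAC.
Qed.

Lemma eul_prj (p : mpoly n' R) : eul (fun x => meval (prj x) p) (fun=> 0).
Proof.
move=> x hx; rewrite mul0r.
apply: (@is_derive_ext R (fun=> meval (prj x) p)) => t.
by rewrite prj_sh_max.
Qed.

Lemma is_derive_last (x : X) : is_derive (0 : R) (1 : R) (fun t => sh x last t last) 1.
Proof. by apply: is_derive_congr (is_derive_sh x last last) _; rewrite eqxx. Qed.

Lemma eul_last : eul (fun x => x last) (fun x => x last).
Proof.
move=> x hx; rewrite divff ?lt0r_neq0 ?xl_gt0//; exact: is_derive_last.
Qed.

Lemma eul_PTterm j : eul (PTterm j) (fun x => (a j)%:R * PTterm j x).
Proof.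
have hX k : eul (fun x => x last ^+ k) (fun x => k%:R * x last ^+ k).
  elim: k => [|k ih].
    by apply: eul_ext (eul_cst 1) _ => x _; rewrite mul0r.
  apply: eul_extf (eul_ext (eul_mul eul_last ih) _) _ => [x hx|x]; last by rewrite exprS.
  by rewrite exprS -natr1; ring.
apply: eul_ext (eul_mul (eul_prj (Q j)) (hX (a j))) _ => x hx.
by rewrite mul0r add0r /PTterm mulrCA.
Qed.

Definition mean_gap (x : X) : R := \sum_j (gap a j)%:R * ratio j x.

Lemma eul_pT : eul pT (fun x => pT x * ((a ord_max)%:R - mean_gap x)).
Proof.
apply: eul_ext (eul_sum (index_enum _) eul_PTterm) _ => x hx.
have p0 := lt0r_neq0 (pT_gt0 hx).
rewrite /mean_gap mulrBr mulr_sumr {1}/pT mulr_suml.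
rewrite [in X in _ = X - _]big_ord_recr [LHS]big_ord_recr /=.
have -> : \sum_(j < d) pT x * ((gap a j)%:R * ratio j x) =
    \sum_(j < d) (PTterm (wd j) x * (a ord_max)%:R - (a (wd j))%:R * PTterm (wd j) x).
  apply: eq_bigr => j _; rewrite (gapE R a_incr) /ratio.
  by field.
rewrite sumrB [PTterm ord_max x * _]mulrC.
by ring.
Qed.

Definition tau (t : 'I_T'.+1) (x : X) : R := if t == ord_max then (a ord_max)%:R - mean_gap x else 0.

Lemma eul_Lg t : eul (Lg t) (tau t).
Proof.
have [->|[j ->]] := ord_max_or_wd t.
  apply: eul_extf (eul_ext (eul_ln pT_gt0 eul_pT) _) _ => [x hx|x].
    by rewrite /tau eqxx mulrAC divff ?mul1r// lt0r_neq0// pT_gt0.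
  by rewrite /Lg pf_max.
have P0 x : ge1 x -> 0 < meval (prj x) (P j) by move=> hx; exact/P_gt0/prj_ge1.
apply: eul_extf (eul_ext (eul_ln P0 (eul_prj (P j))) _) _ => [x hx|x].
  rewrite /tau mul0r; case: eqP => // /(congr1 val) /= e.
  by have := ltn_ord j; rewrite e ltnn.
by rewrite /Lg pf_wd.
Qed.

Lemma eul_ratio j : eul (ratio j) (fun x => ratio j x * (mean_gap x - (gap a j)%:R)).
Proof.
apply: eul_ext (eul_mul (eul_PTterm (wd j)) (eul_inv pT_gt0 eul_pT)) _ => x hx.
have p0 := lt0r_neq0 (pT_gt0 hx).
by rewrite (gapE R a_incr) /ratio; field.
Qed.

Definition eul_of_ratios (w : seq 'I_d) (x : X) : R := ratios w x * ((size w)%:R * mean_gap x - (word_gap a w)%:R).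

Lemma eul_ratios w : eul (ratios w) (eul_of_ratios w).
Proof.
elim: w => [|j w ih].
  apply: eul_extf (eul_ext (eul_cst 1) _) _ => [x _|x]; last by rewrite /ratios big_nil.
  by rewrite /eul_of_ratios /word_gap big_nil mul0r subrr mulr0.
apply: eul_extf (eul_ext (eul_mul (eul_ratio j) ih) _) _ => [x _|x]; last by rewrite /ratios big_cons.
rewrite /eul_of_ratios word_gap_cons natrD /= -natr1 {3}/ratios big_cons -/(ratios w x).
by ring.
Qed.

(** The factor [x_n] of [Hf] turns its derivative in [x_n], which is [dHf], into an Euler
    derivative: a function of the same kind as [Phi]. *)
Definition Phi (f : X -> R) (s : V) (x : X) : C := (f x)%:C%C * pows s x.

Definition Hf (f : X -> R) (s : V) (x : X) : C := (x last)%:C%C * Phi f s x.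

Definition dHf (f th : X -> R) (s : V) (x : X) : C :=
  ((f x + th x)%:C%C - (f x)%:C%C * \sum_t s ord0 t * (tau t x)%:C%C) * pows s x.

Lemma pd_Hf f th s : eul f th -> pd last (Hf f s) (dHf f th s).
Proof.
move=> he x hx; have x0 := lt0r_neq0 (xl_gt0 hx).
have hG : cder (fun t => - \sum_t0 s ord0 t0 * (Lg t0 (sh x last t))%:C%C) 0
    (- \sum_t0 s ord0 t0 * (tau t0 x / x last)%:C%C).
  apply: cder_opp; apply: cder_sum => t; apply: cder_scale; apply: cder_real.
  exact: eul_Lg.
have h1 := cder_mul (cder_real (is_derive_last x)) (cder_mul (cder_real (he x hx)) (cder_cexp hG)).
apply: cder_congr h1 _.
rewrite !sh0 -/(pows s x) /dHf.
have -> : \sum_t0 s ord0 t0 * (tau t0 x / x last)%:C%C =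
    (\sum_t0 s ord0 t0 * (tau t0 x)%:C%C) * ((x last)^-1)%:C%C.
  by rewrite mulr_suml; apply: eq_bigr => t _; rewrite rmorphM mulrA.
set Z := \sum_t0 _; set e := pows s x.
have xC : (x last)%:C%C * ((x last)^-1)%:C%C = 1 :> C by rewrite -rmorphM divff.
rewrite rmorph1 mul1r rmorphM rmorphD.
rewrite (_ : (x last)%:C%C * _ = (x last)%:C%C * ((x last)^-1)%:C%C *
  ((th x)%:C%C - (f x)%:C%C * Z) * e); last by ring.
by rewrite xC; ring.
Qed.

(** The relation that carries the continuation. Up to a derivative in [x_n], whose sum
    almost telescopes, the term of the word [w] reduces to those of the longer words
    [j :: w], which decay faster in [x_n]; the factor to be divided by vanishes on
    a hyperplane. *)
Lemma dHf_word w s x : dHf (ratios w) (eul_of_ratios w) s x =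
  (1 - (word_gap a w)%:R - (a ord_max)%:R * s ord0 ord_max) * Phi (ratios w) s x +
  (s ord0 ord_max + (size w)%:R) * \sum_j (gap a j)%:R * Phi (ratios (j :: w)) s x.
Proof.
have -> : \sum_j (gap a j)%:R * Phi (ratios (j :: w)) s x = (mean_gap x)%:C%C * Phi (ratios w) s x.
  rewrite /mean_gap rmorph_sum /= mulr_suml; apply: eq_bigr => j _.
  by rewrite /Phi /ratios big_cons !rmorphM rmorph_nat; ring.
rewrite /dHf.
have -> : \sum_t s ord0 t * (tau t x)%:C%C =
    s ord0 ord_max * ((a ord_max)%:R - (mean_gap x)%:C%C).
  rewrite (bigD1 ord_max)//= big1 ?addr0 => [|t /negbTE ht].
    by rewrite /tau eqxx rmorphB rmorph_nat.
  by rewrite /tau ht mulr0.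
rewrite /eul_of_ratios /Phi !(rmorphD, rmorphM, rmorphB, rmorph_nat) /=.
by ring.
Qed.

(** * The twisted sums *)

Variable mu0 : 'I_n' -> C.
Hypothesis mu0_norm : forall j, `|mu0 j| = 1.
Hypothesis mu0_neq1 : forall j, mu0 j <> 1.

Notation Lat := {ffun 'I_n'.+1 -> nat}.

Definition mu (k : 'I_n'.+1) : C := if unlift last k is Some j then mu0 j else 0.

Definition tl : seq 'I_n'.+1 := [seq wd j | j <- enum 'I_n'].

Lemma mu_wd j : mu (wd j) = mu0 j.
Proof.
rewrite /mu (_ : wd j = lift last j) ?liftK//.
by apply: val_inj; exact/esym/lift_max.
Qed.

Lemma wd_inj k : injective (@wd k).
Proof. by move=> i j /(congr1 val) /= h; exact: val_inj. Qed.

Lemma tl_uniq : uniq tl.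
Proof. by rewrite map_inj_uniq ?enum_uniq//; exact: wd_inj. Qed.

Lemma last_notin_tl : last \notin tl.
Proof.
apply/mapP => -[j _ /(congr1 val) /= e].
by have := ltn_ord j; rewrite -e ltnn.
Qed.

Lemma mu_neq0 j : j \in tl -> mu j != 0.
Proof.
by case/mapP => i _ ->; rewrite mu_wd -normr_gt0 mu0_norm ltr01.
Qed.

Lemma mu_neq1 j : j \in tl -> mu j != 1.
Proof. by case/mapP => i _ ->; rewrite mu_wd; apply/eqP. Qed.

Lemma mu_bd j k : N (mu j ^+ k) <= 2.
Proof.
suff : `|mu j ^+ k| <= (1%:C)%C by move/N_le_normc; rewrite mulr1.
rewrite normrX /mu; case: unliftP => [i _|_]; first by rewrite mu0_norm expr1n.
by rewrite normr0 expr0n; case: (k == _); rewrite ?lexx ?ler01.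
Qed.

(** Target exponents: in the last variable, -3; in the twisted ones, any growth [A], to be
    removed by summation by parts. *)
Definition summable_exp (A : R) (k : 'I_n'.+1) : R := if k == last then - 3 else A.

Notation LatSymT B K al F := (LatSym eps (tw tl) B K al F).

Section Families.
Variables (S : Type) (B : S -> Prop) (g : S -> V) (D0 A : R).
Hypothesis pows_Sym : forall K, Sym eps B K (W (fun=> D0)) (fun s => pows (g s)).
Variables (f th : X -> R) (al : 'I_n'.+1 -> R).
Hypothesis f_Sym : forall K, Sym eps B K (W al) (fun _ x => (f x)%:C%C).

Lemma Sym_Phi K : Sym eps B K (W (fun k => al k + D0)) (fun s => Phi f (g s)).
Proof. by apply: Sym_eqw (Sym_mul (f_Sym K) (pows_Sym K)) => x hx; rewrite WD. Qed.

Lemma Sym_Hf K :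
  Sym eps B K (W (fun k => (k == last)%:R * 1 + (al k + D0))) (fun s => Hf f (g s)).
Proof.
apply: Sym_eqw (Sym_mul (Sym_last eps01 B K last) (Sym_Phi K)) => x hx.
by rewrite -(WD (unitv last 1) _ hx) W_unitv powRr1// (ltW (xl_gt0 hx)).
Qed.

Lemma LatSym_Phi K : (forall k, k != last -> al k + D0 <= A) -> al last + D0 <= - 3 ->
  LatSymT B K (summable_exp A) (fun s m => Phi f (g s) (pt R m)).
Proof.
move=> h1 h2; have := LatSym_Sym (tw tl) (Sym_Phi K); apply: LatSym_le => k.
by rewrite /summable_exp; case: eqP => [->//|/eqP /h1].
Qed.

Lemma LatSym_rem K L : eul f th -> (forall k, k != last -> al k + D0 <= A) ->
  al last + D0 + 1 - L.+1%:R * eps <= - 3 ->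
  LatSymT B K (summable_exp A) (fun s => greg_rem last L (Hf f (g s)) (dHf f th (g s))).
Proof.
move=> he h1 h2.
apply: (LatSym_greg_rem eps_gt0 K (al := fun k => (k == last)%:R * 1 + (al k + D0))).
- exact: last_notin_tl.
- exact: Sym_Hf.
- by move=> s _; exact: pd_Hf.
- by move=> k kl; rewrite /summable_exp (negbTE kl) mul0r add0r h1.
- by rewrite /summable_exp !eqxx mul1r; lra.
Qed.

Lemma LatSym_dif_Hf K L : (forall k, k != last -> al k + D0 <= A) ->
  al last + D0 + 1 - L%:R * eps <= - 3 ->
  LatSymT B K (summable_exp A) (fun s m => dif last 1 L (Hf f (g s)) (pt R m)).
Proof.
move=> h1 h2.
have hh : forall s, B s -> 0 <= (fun _ : S => 1 : R) s <= 1.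
  by move=> s _; rewrite ler01 lexx.
have := LatSym_Sym (tw tl) (Sym_dif last hh (Sym_Hf (L + K))); apply: LatSym_le => k.
rewrite /summable_exp /dec; have [->|kl] := eqVneq k last; first by rewrite ?eqxx ?mul1r; lra.
by rewrite ?(negbTE kl) !mul0r add0r subr0 h1.
Qed.

Lemma LatSym_greg_Hf K L : (forall k, k != last -> al k + D0 <= A) ->
  al last + D0 + 1 <= - 3 ->
  LatSymT B K (summable_exp A) (fun s m => greg last L (Hf f (g s)) (pt R m)).
Proof.
move=> h1 h2.
have := LatSym_Sym (tw tl) (Sym_greg eps_gt0 K L last Sym_Hf); apply: LatSym_le => k.
rewrite /summable_exp; have [->|kl] := eqVneq k last; first by rewrite mul1r; lra.
by rewrite !mul0r add0r h1.
Qed.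

End Families.

Lemma LatSym_cut (S : Type) (B : S -> Prop) K al (F : S -> Lat -> C) :
  LatSymT B K al F -> LatSymT B K al (fun s => cut last (F s)).
Proof.
have hd al' F' : ldom B al' F' -> ldom B al' (fun s => cut last (F' s)).
  move=> [c c0 hc]; exists c => // s m hs; rewrite /cut.
  by case: eqP => _; rewrite ?N0 ?mulr_ge0 ?W_ge0 ?hc.
elim: K al F => [|K ih] al F [h1 h2]; split=> //; try exact: hd.
move=> i ti; have := ih _ _ (h2 i ti).
rewrite (_ : (fun s => cut last (dl i (F s))) = (fun s => dl i (cut last (F s))))//.
apply/funext => s; apply/funext => m; rewrite /cut /dl ffunE.
have -> : (last == i) = false.
  by apply: contraNF last_notin_tl => /eqP ->.
by rewrite addn0; case: eqP => _; rewrite ?subr0.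
Qed.

(** Differentiating [pows] in [s_t] multiplies it by [- Lg t], so derivatives in [s] are
    of the same kind as the functions themselves. *)
Definition mulL t (f : X -> R) (x : X) : R := - Lg t x * f x.
Definition mulLth t (f th : X -> R) (x : X) : R := - tau t x * f x + - Lg t x * th x.

Lemma eul_mulL t f th : eul f th -> eul (mulL t f) (mulLth t f th).
Proof. by move=> h; apply: eul_mul => //; apply: eul_opp; exact: eul_Lg. Qed.

Lemma Sym_mulL (S : Type) (B : S -> Prop) (D1 : R) t (f : X -> R) al :
  (forall K, Sym eps B K (W (fun=> D1)) (fun _ x => (Lg t x)%:C%C)) ->
  (forall K, Sym eps B K (W al) (fun _ x => (f x)%:C%C)) ->
  forall K, Sym eps B K (W (fun k => al k + D1)) (fun _ x => (mulL t f x)%:C%C).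
Proof.
move=> hL hf K.
apply: Sym_extf (Sym_scale (z := fun=> -1) (c := 1) _ _
  (Sym_eqw _ (Sym_mul (hf K) (hL K)))) => [s x|//|s _|x hx].
- by rewrite /mulL rmorphM rmorphN; ring.
- by rewrite NN -[1]/(1%:C%C) Nreal normr1.
- by rewrite WD.
Qed.

Lemma cder_linear (c : 'I_T'.+1 -> C) (q v : V) y :
  cder (fun z : R => \sum_t (q + (z%:C)%C *: v) ord0 t * c t) y (\sum_t v ord0 t * c t).
Proof.
apply: cder_sum => t.
have h := cder_add (cder_cst (q ord0 t * c t) y) (cder_scale (v ord0 t * c t) (cder_id y)).
apply: cder_ext (cder_congr h _) _ => [|z]; first by rewrite add0r mulr1.
by rewrite !mxE; ring.
Qed.

Lemma cder_pows (q v : V) x y :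
  cder (fun z : R => pows (q + (z%:C)%C *: v) x) y
    (- (\sum_t v ord0 t * (Lg t x)%:C%C) * pows (q + (y%:C)%C *: v) x).
Proof.
by apply: cder_cexp; apply: cder_opp; exact: cder_linear.
Qed.

Lemma cder_Phi f (q v : V) x y :
  cder (fun z : R => Phi f (q + (z%:C)%C *: v) x) y
    (\sum_t v ord0 t * Phi (mulL t f) (q + (y%:C)%C *: v) x).
Proof.
apply: cder_congr (cder_scale _ (cder_pows q v x y)) _.
set e := pows _ x; rewrite mulrA mulrN mulr_sumr -sumrN mulr_suml; apply: eq_bigr => t _.
by rewrite /Phi /mulL rmorphM rmorphN -/e; ring.
Qed.

Lemma cder_Hf f (q v : V) x y :
  cder (fun z : R => Hf f (q + (z%:C)%C *: v) x) y
    (\sum_t v ord0 t * Hf (mulL t f) (q + (y%:C)%C *: v) x).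
Proof.
apply: cder_congr (cder_scale _ (cder_Phi f q v x y)) _.
by rewrite mulr_sumr; apply: eq_bigr => t _; rewrite mulrCA.
Qed.

Lemma cder_dHf f th (q v : V) x y :
  cder (fun z : R => dHf f th (q + (z%:C)%C *: v) x) y
    (\sum_t v ord0 t * dHf (mulL t f) (mulLth t f th) (q + (y%:C)%C *: v) x).
Proof.
pose lin (z : V) := \sum_t z ord0 t * (tau t x)%:C%C.
have hl : cder (fun z : R => lin (q + (z%:C)%C *: v)) y (lin v) by exact: cder_linear.
have h := cder_mul (cder_sub (cder_cst ((f x + th x)%:C%C) y)
  (cder_scale (f x)%:C%C hl)) (cder_pows q v x y).
apply: cder_congr h _.
set e := pows _ x; set Lv := \sum_t v ord0 t * _.
set Z := lin (q + _).
have -> : \sum_t v ord0 t * dHf (mulL t f) (mulLth t f th) (q + (y%:C)%C *: v) x =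
    \sum_t (- (v ord0 t * (Lg t x)%:C%C) * (((f x + th x)%:C%C - (f x)%:C%C * Z) * e) -
            v ord0 t * (tau t x)%:C%C * ((f x)%:C%C * e)).
  apply: eq_bigr => t _; rewrite /dHf -/e -[\sum_t0 (q + _) ord0 t0 * _]/Z /mulL /mulLth.
  by rewrite !(rmorphD, rmorphM, rmorphN); ring.
rewrite sumrB -!mulr_suml sumrN -/Lv -/(lin v).
by ring.
Qed.

Lemma cder_dif (G : R -> X -> C) (G' : X -> C) y i h r x :
  (forall x, cder (fun z => G z x) y (G' x)) ->
  cder (fun z => dif i h r (G z) x) y (dif i h r G' x).
Proof.
by move=> hG; elim: r x => [//|r ih] x /=; apply: cder_sub.
Qed.

Lemma cder_greg_rem (G H : R -> X -> C) (G' H' : X -> C) y L m :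
  (forall x, cder (fun z => G z x) y (G' x)) ->
  (forall x, cder (fun z => H z x) y (H' x)) ->
  cder (fun z => greg_rem last L (G z) (H z) m) y (greg_rem last L G' H' m).
Proof.
move=> hG hH; apply: cder_sub => //.
have hc m' : cder (fun z => cut last (fun m => greg last L (G z) (pt R m)) m') y
    (cut last (fun m => greg last L G' (pt R m)) m').
  rewrite /cut; case: eqP => _; first exact: cder_cst.
  by apply: cder_sum => r; apply: cder_scale; exact: cder_dif.
by apply: cder_sub.
Qed.

Lemma cder_by_parts (G : R -> Lat -> C) (G' : Lat -> C) y ka l m :
  (forall m, cder (fun z => G z m) y (G' m)) ->
  cder (fun z => by_parts (lam mu) mu ka l (G z) m) y (by_parts (lam mu) mu ka l G' m).
Proof.
elim: l G G' m => [|j l ih] G G' m hG /=; first exact: hG.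
apply: (ih (fun z => by_part (lam mu) mu (ka j) j (G z))) => {}m.
have hi r m' : cder (fun z => iter r (dl j) (G z) m') y (iter r (dl j) G' m').
  by elim: r m' => [|r ihr] m' //=; apply: cder_sub.
rewrite /by_part; apply: cder_add; last exact: cder_scale.
case: eqP => _; last exact: cder_cst.
by apply: cder_sum => r; apply: cder_scale.
Qed.

Lemma greg_rem_sum (I : Type) (r : seq I) (z : I -> C) (G H : I -> X -> C) L m :
  greg_rem last L (fun x => \sum_(i <- r) z i * G i x) (fun x => \sum_(i <- r) z i * H i x) m =
  \sum_(i <- r) z i * greg_rem last L (G i) (H i) m.
Proof.
have hd k x : dif last 1 k (fun x => \sum_(i <- r) z i * G i x) x =
    \sum_(i <- r) z i * dif last 1 k (G i) x.
  elim: k x => [//|k ih] x /=; rewrite !ih -sumrB; apply: eq_bigr => i _.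
  by rewrite mulrBr.
have hg x : greg last L (fun x => \sum_(i <- r) z i * G i x) x =
    \sum_(i <- r) z i * greg last L (G i) x.
  rewrite /greg; under eq_bigr do rewrite hd mulr_sumr.
  rewrite exchange_big; apply: eq_bigr => i _; rewrite mulr_sumr.
  by apply: eq_bigr => k _; rewrite mulrCA.
have -> : \sum_(i <- r) z i * greg_rem last L (G i) (H i) m =
    \sum_(i <- r) z i * (H i (pt R m) - (greg last L (G i) (pt R (bump m last)) -
      (if m last == 0%N then 0 else greg last L (G i) (pt R m)))).
  by apply: eq_bigr => i _; rewrite /greg_rem /dl /cut !ffunE eqxx addn1.
rewrite /greg_rem /dl /cut !ffunE eqxx addn1 /= !hg.
case: eqP => _; rewrite ?subr0 -!sumrB; apply: eq_bigr => i _; first by rewrite subr0 mulrBr.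
by rewrite !mulrBr.
Qed.

(** * Independence of the order *)

Lemma sum_tuple_cons (l : nat) (F : seq 'I_d -> C) :
  \sum_(w : l.+1.-tuple 'I_d) F w = \sum_(w : l.-tuple 'I_d) \sum_j F (j :: w).
Proof.
rewrite pair_big /= (reindex (fun p : l.-tuple 'I_d * 'I_d => [tuple of p.2 :: p.1])) //=.
exists (fun w : l.+1.-tuple 'I_d => (behead_tuple w : l.-tuple 'I_d, thead w)) => [[w j] _|w _] /=.
  by congr (_, _); apply: val_inj.
by rewrite [RHS]tuple_eta; apply: val_inj.
Qed.

Lemma regsum_scale (z : C) (F : Lat -> C) ka al : LatSymU eps tl al F -> decays eps tl ka al ->
  regsum tl mu ka (fun m => z * F m) = z * regsum tl mu ka F.
Proof.
move=> hF hd; apply: tsumE; rewrite by_parts_scale; apply: isum_scale.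
exact: (regsum_isum eps_gt0 tl_uniq mu_bd hF hd).
Qed.

Lemma regsum_sum (I : Type) (r : seq I) (F : I -> Lat -> C) ka al :
  (forall i, LatSymU eps tl al (F i)) -> decays eps tl ka al ->
  regsum tl mu ka (fun m => \sum_(i <- r) F i m) = \sum_(i <- r) regsum tl mu ka (F i).
Proof.
move=> hF hd; apply: tsumE; rewrite by_parts_sum; apply: isum_sum => i.
exact: (regsum_isum eps_gt0 tl_uniq mu_bd (hF i) hd).
Qed.

Lemma regsum_add (F G : Lat -> C) ka al : LatSymU eps tl al F -> LatSymU eps tl al G ->
  decays eps tl ka al ->
  regsum tl mu ka (fun m => F m + G m) = regsum tl mu ka F + regsum tl mu ka G.
Proof.
move=> hF hG hd; apply: tsumE; rewrite by_parts_add.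
apply: isum_add.
  exact: (regsum_isum eps_gt0 tl_uniq mu_bd hF hd).
exact: (regsum_isum eps_gt0 tl_uniq mu_bd hG hd).
Qed.

(** The derivatives of the terms in [s] being symbols too, [by_parts_isum] gives the uniform
    bounds that [differentiable_tsum] requires. *)
Lemma differentiable_regsum (p : V) (r : R) ka al (F : V -> Lat -> C)
    (F1 : 'I_T'.+1 -> V -> Lat -> C) (F2 : 'I_T'.+1 -> 'I_T'.+1 -> V -> Lat -> C) :
  0 < r -> decays eps tl ka al ->
  (forall K, LatSymT (polydisc p r) K al F) ->
  (forall t K, LatSymT (polydisc p r) K al (F1 t)) ->
  (forall t u K, LatSymT (polydisc p r) K al (F2 t u)) ->
  (forall q v m x, cder (fun y : R => F (q + (y%:C)%C *: v) m) x
     (\sum_t v ord0 t * F1 t (q + (x%:C)%C *: v) m)) ->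
  (forall t q v m x, cder (fun y : R => F1 t (q + (y%:C)%C *: v) m) x
     (\sum_u v ord0 u * F2 t u (q + (x%:C)%C *: v) m)) ->
  differentiable (fun q => regsum tl mu ka (F q)) p.
Proof.
move=> r0 hd hF hF1 hF2 d1 d2.
have hb G : (forall K, LatSymT (polydisc p r) K al G) -> exists c : R, 0 <= c /\
    forall s m, polydisc p r s -> N (by_parts (lam mu) mu ka tl (G s) m) <= c * W (fun=> - 2) (pt R m).
  by move=> hG; have [c c0 hc] := by_parts_isum eps_gt0 tl_uniq mu_bd hG hd; exists c.
have [c [c0 hc]] := hb _ hF.
have /choice[c1 hc1] t := hb _ (hF1 t).
have /choice[c2 hc2] (tu : 'I_T'.+1 * 'I_T'.+1) := hb _ (hF2 tu.1 tu.2).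
have s1 : 0 <= \sum_t c1 t by apply: sumr_ge0 => t _; have [] := hc1 t.
have s2 : 0 <= \sum_tu c2 tu by apply: sumr_ge0 => t _; have [] := hc2 t.
have lin (G : 'I_T'.+1 -> Lat -> C) (z : 'I_T'.+1 -> C) m :
    by_parts (lam mu) mu ka tl (fun m => \sum_t z t * G t m) m =
    \sum_t z t * by_parts (lam mu) mu ka tl (G t) m.
  by rewrite by_parts_sum; apply: eq_bigr => t _; rewrite by_parts_scale.
apply: (@differentiable_tsum _ _ _ _ _
  (fun t q => by_parts (lam mu) mu ka tl (F1 t q))
  (fun t u q => by_parts (lam mu) mu ka tl (F2 t u q)) p (c + \sum_t c1 t + \sum_tu c2 tu) r
  (inv_squares_summable R n'.+1)) => //.
- by rewrite !addr_ge0.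
- move=> q m hq; rewrite (le_trans (hc _ _ hq))// ler_wpM2r ?W_ge0//.
  by rewrite -addrA lerDl addr_ge0.
- move=> t q m hq; have [t0 ht] := hc1 t.
  rewrite (le_trans (ht _ _ hq))// ler_wpM2r ?W_ge0//.
  have : c1 t <= \sum_t c1 t.
    by apply: ler_sum_term => u; have [] := hc1 u.
  by lra.
- move=> t u q m hq; have [t0 ht] := hc2 (t, u).
  rewrite (le_trans (ht _ _ hq))// ler_wpM2r ?W_ge0//.
  have : c2 (t, u) <= \sum_tu c2 tu.
    by apply: ler_sum_term => v; have [] := hc2 v.
  by lra.
- by move=> q v m x; rewrite -lin; apply: cder_by_parts => {}m; exact: d1.
- by move=> t q v m x; rewrite -lin; apply: cder_by_parts => {}m; exact: d2.
Qed.

Hypothesis d_ge1 : (1 <= d)%N.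

Definition Eterm (l : nat) (f th : X -> R) (s : V) : Lat -> C :=
  greg_rem last l (Hf f s) (dHf f th s).
Definition Pterm (f : X -> R) (s : V) (m : Lat) : C := Phi f s (pt R m).

Lemma cder_Eterm l f th (q v : V) m x :
  cder (fun y : R => Eterm l f th (q + (y%:C)%C *: v) m) x
    (\sum_t v ord0 t * Eterm l (mulL t f) (mulLth t f th) (q + (x%:C)%C *: v) m).
Proof.
rewrite /Eterm -greg_rem_sum; apply: cder_greg_rem => y; first exact: cder_Hf.
exact: cder_dHf.
Qed.

Lemma cder_Pterm f (q v : V) m x :
  cder (fun y : R => Pterm f (q + (y%:C)%C *: v) m) x
    (\sum_t v ord0 t * Pterm (mulL t f) (q + (x%:C)%C *: v) m).
Proof. exact: cder_Phi. Qed.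

(** The family whose regularised sum is the continuation: the words shorter than
    [l] contribute remainders of Gregory's formula of order [l], and those of
    length [l] their own terms. All of it is summable once [l] is large, at the
    cost of the denominators of the coefficients. *)
Definition expansion (l : nat) (s : V) (m : Lat) : C :=
  \sum_(r < l) \sum_(w : r.-tuple 'I_d)
    gamv a w (s ord0 ord_max) * Eterm l (ratios w) (eul_of_ratios w) s m +
  \sum_(w : l.-tuple 'I_d) delv a w (s ord0 ord_max) * Pterm (ratios w) s m.

Definition zeta_of_order (l : nat) (s : V) : C := regsum tl mu (fun=> l) (expansion l s).

(** The loss in the other variables for a gain of one in the last one, as in
    [ratio_gain]. *)
Variable D' : R.
Hypothesis D'_ge0 : 0 <= D'.
Hypothesis ratio_le_gain : exists2 c : R, 0 <= c & forall j x, ge1 x -> ratio j x <= c * W (gain D') x.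

(** Sufficient conditions for all the sums in [expansion] to converge when [pows s] is a
    symbol of exponent [D]: the words of length at least [N1] absorb the growth in the
    last variable, the order [l] of Gregory's formula that of its remainders, and
    [l] summations by parts that in the twisted variables. *)
Definition order_ok (D : R) (l N1 : nat) : Prop :=
  [/\ (N1 <= l)%N, D + 1 - N1%:R <= - 3, D + 1 - l%:R * eps <= - 3 &
      D + N1%:R * D' - l%:R * eps <= - 3].

Lemma order_ok_leq D l l' N1 : (l <= l')%N -> order_ok D l N1 -> order_ok D l' N1.
Proof.
move=> ll [h1 h2 h3 h4].
have h : l%:R * eps <= l'%:R * eps by rewrite ler_wpM2r ?(ltW eps_gt0)// ler_nat.
by split=> //; [exact: leq_trans ll | lra | lra].
Qed.

Lemma order_ok0 : order_ok (- 4) 0 0.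
Proof. by split=> //; lra. Qed.

Lemma order_ok_ex D : exists l N1, order_ok D l N1.
Proof.
have [N1 hN] : exists N1 : nat, D + 4 <= N1%:R.
  exists (Num.bound `|D + 4|).
  by rewrite (le_trans (ler_norm _))// ltW// archi_boundP.
have [l hl] : exists l : nat, (`|D| + 4 + N1%:R * D' + N1%:R * eps) / eps <= l%:R.
  exists (Num.bound ((`|D| + 4 + N1%:R * D' + N1%:R * eps) / eps)).
  by rewrite ltW// archi_boundP// divr_ge0 ?addr_ge0 ?mulr_ge0 ?(ltW eps_gt0).
exists l, N1; move: hl; rewrite ler_pdivrMr// => hl.
have hD := ler_norm D.
have h1 : 0 <= N1%:R * D' by rewrite mulr_ge0.
have h2 : 0 <= N1%:R * eps by rewrite mulr_ge0// ltW.
split; [|lra|lra|lra].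
rewrite -(@ler_nat R) -(ler_pM2r eps_gt0).
by have := normr_ge0 D; lra.
Qed.

Section Bounds.
Variables (S : Type) (B : S -> Prop) (g : S -> V) (D D1 : R) (l N1 : nat).
Hypothesis pows_Sym : forall K, Sym eps B K (W (fun=> D)) (fun s => pows (g s)).
Hypothesis l_ok : order_ok (D + D1) l N1.

Let A := D + D1 + N1%:R * D'.

Lemma decays_summable_exp : decays eps tl (fun=> l) (summable_exp A).
Proof.
move=> k; have [_ _ _ h] := l_ok; rewrite /summable_exp; case: eqP => [->|/eqP kl].
  by rewrite (negbTE last_notin_tl) mul0r subr0.
suff -> : k \in tl by rewrite mul1r.
have [e|[j ->]] := ord_max_or_wd k; first by rewrite e eqxx in kl.
by apply/mapP; exists j => //; rewrite mem_enum.
Qed.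

Lemma LatSym_E f th K l' : (l <= l')%N ->
  (forall K, Sym eps B K (W (fun=> D1)) (fun _ x => (f x)%:C%C)) -> eul f th ->
  LatSymT B K (summable_exp A) (fun s => Eterm l' f th (g s)).
Proof.
move=> ll hf he; have [h1 h2 h3 h4] := l_ok.
have hl : l%:R * eps <= l'.+1%:R * eps.
  by rewrite ler_wpM2r ?(ltW eps_gt0)// ler_nat (leq_trans ll).
have h5 : 0 <= N1%:R * D' by rewrite mulr_ge0.
by apply: (LatSym_rem pows_Sym hf K he) => [k _|]; rewrite /A; lra.
Qed.

Lemma LatSym_P f K :
  (forall K, Sym eps B K (W (fun k => N1%:R * gain D' k + D1)) (fun _ x => (f x)%:C%C)) ->
  LatSymT B K (summable_exp A) (fun s => Pterm f (g s)).
Proof.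
move=> hf; have [h1 h2 h3 h4] := l_ok.
apply: (LatSym_Phi (f := f) (A := A) pows_Sym hf K) => [k /negbTE kl|].
  by rewrite /gain kl /A; lra.
by rewrite /gain eqxx; lra.
Qed.

End Bounds.

Section Step.
Variables (s : V) (D : R) (l N1 : nat).
Hypothesis pows_Sym : forall K, Sym eps (fun _ : unit => True) K (W (fun=> D)) (fun _ => pows s).
Hypothesis l_ok : order_ok D l N1.

Let U := fun _ : unit => True.
Let al := summable_exp (D + 0 + N1%:R * D').
Let sT := s ord0 ord_max.

Let l_ok0 : order_ok (D + 0) l N1. Proof. by rewrite addr0. Qed.

Let Sym_R0 w K : Sym eps U K (W (fun=> 0)) (fun _ x => (ratios w x)%:C%C).
Proof. exact: Sym_ratios_one. Qed.

Let Sym_R1 w K : (N1 <= size w)%N ->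
  Sym eps U K (W (fun k => N1%:R * gain D' k + 0)) (fun _ x => (ratios w x)%:C%C).
Proof.
move=> hw; have [c c0 hc] := ratio_le_gain.
apply: Sym_eqw (Sym_ratios_gain U K D'_ge0 c0 hc hw) => x _; congr W.
by apply/funext => k; rewrite addr0.
Qed.

Let hd : decays eps tl (fun=> l) al.
Proof. exact: (decays_summable_exp l_ok0). Qed.

Lemma LatSymU_E w l' : (l <= l')%N -> LatSymU eps tl al (Eterm l' (ratios w) (eul_of_ratios w) s).
Proof.
move=> ll K; apply: (LatSym_E (g := fun=> s) pows_Sym l_ok0 K ll (Sym_R0 w)).
exact: eul_ratios.
Qed.

Lemma LatSymU_P w : (N1 <= size w)%N -> LatSymU eps tl al (Pterm (ratios w) s).
Proof.
move=> hw K; apply: (LatSym_P (g := fun=> s) pows_Sym l_ok0) => K'.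
exact: Sym_R1.
Qed.

Lemma LatSymU_scale (z : C) F : LatSymU eps tl al F -> LatSymU eps tl al (fun m => z * F m).
Proof. by move=> hF K; exact: (LatSym_scale (z := fun=> z) (N_ge0 z) (fun _ _ => lexx _) (hF K)). Qed.

Lemma LatSymU_sum (I : Type) (r : seq I) (F : I -> Lat -> C) :
  (forall i, LatSymU eps tl al (F i)) -> LatSymU eps tl al (fun m => \sum_(i <- r) F i m).
Proof. by move=> h K; exact: (LatSym_sum r (fun i => h i K)). Qed.

Lemma LatSymU_add F G : LatSymU eps tl al F -> LatSymU eps tl al G ->
  LatSymU eps tl al (fun m => F m + G m).
Proof. by move=> hF hG K; exact: (LatSym_add (hF K) (hG K)). Qed.

Lemma LatSymU_expansion : LatSymU eps tl al (expansion l s).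
Proof.
have [h _ _ _] := l_ok.
apply: LatSymU_add; apply: LatSymU_sum => i.
  by apply: LatSymU_sum => w; apply: LatSymU_scale; exact: LatSymU_E.
by apply: LatSymU_scale; apply: LatSymU_P; rewrite size_tuple.
Qed.

Lemma zeta_of_orderE : zeta_of_order l s =
  \sum_(r < l) \sum_(w : r.-tuple 'I_d)
    gamv a w sT * regsum tl mu (fun=> l) (Eterm l (ratios w) (eul_of_ratios w) s) +
  \sum_(w : l.-tuple 'I_d) delv a w sT * regsum tl mu (fun=> l) (Pterm (ratios w) s).
Proof.
have [h _ _ _] := l_ok.
have hP (w : l.-tuple 'I_d) : LatSymU eps tl al (Pterm (ratios w) s).
  by apply: LatSymU_P; rewrite size_tuple.
have hE w : LatSymU eps tl al (Eterm l (ratios w) (eul_of_ratios w) s) by exact: LatSymU_E.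
rewrite /zeta_of_order /expansion (@regsum_add _ _ _ al) //; last 2 first.
- by apply: LatSymU_sum => r; apply: LatSymU_sum => w; apply: LatSymU_scale.
- by apply: LatSymU_sum => w; apply: LatSymU_scale.
congr (_ + _); last first.
  rewrite (@regsum_sum _ _ _ _ al)//; last by move=> w; exact: LatSymU_scale.
  by apply: eq_bigr => w _; rewrite (@regsum_scale _ _ _ al).
rewrite (@regsum_sum _ _ _ _ al)//; last by move=> r; apply: LatSymU_sum => w; apply: LatSymU_scale.
apply: eq_bigr => r _; rewrite (@regsum_sum _ _ _ _ al)//; last by move=> w; exact: LatSymU_scale.
by apply: eq_bigr => w _; rewrite (@regsum_scale _ _ _ al).
Qed.

(** The difference that increasing [l] adds to [expansion]. *)
Definition expansion_diff (m : Lat) : C :=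
  \sum_(r < l) \sum_(w : r.-tuple 'I_d)
    gamv a w sT * ((-1) ^+ l / l.+1%:R * dif last 1 l (Hf (ratios w) s) (pt R m)) +
  \sum_(w : l.-tuple 'I_d) gamv a w sT * greg last l.+1 (Hf (ratios w) s) (pt R m).

Lemma LatSymU_expansion_diff : LatSymU eps tl al (cut last expansion_diff).
Proof.
have [h1 h2 h3 h4] := l_ok.
have h5 : 0 <= N1%:R * D' by rewrite mulr_ge0.
move=> K; apply: (@LatSym_cut _ U K al (fun=> expansion_diff)); move: K; apply: LatSymU_add; apply: LatSymU_sum => i.
  apply: LatSymU_sum => w; apply: LatSymU_scale; apply: LatSymU_scale => K.
  apply: (LatSym_dif_Hf (g := fun=> s) pows_Sym (Sym_R0 w)) => [k _|]; lra.
apply: LatSymU_scale => K.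
have hw : (N1 <= size i)%N by rewrite size_tuple.
apply: (LatSym_greg_Hf (g := fun=> s) pows_Sym (fun K => Sym_R1 K hw)) => [k /negbTE kl|].
  by rewrite /gain kl; lra.
by rewrite /gain eqxx; lra.
Qed.

(** For the words shorter than [l], Gregory's formula takes one more term. For those of
    length [l], [delv w = bpoly w * gamv w] allows to solve [dHf_word] for the term of
    [w], the coefficients [delv (j :: w)] being defined so as to match. *)
Lemma expansion_step : (forall w : l.-tuple 'I_d, (gam R a w).2.[sT] != 0) ->
  expansion l s = (fun m => expansion l.+1 s m + dl last (cut last expansion_diff) m).
Proof.
move=> hg; apply/funext => m.
pose T (F : Lat -> C) := dl last (cut last F) m.
have T_add F G : T (fun m => F m + G m) = T F + T G.
  rewrite /T /dl /cut; by case: eqP => _; case: eqP => _; ring.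
have T_scale z F : T (fun m => z * F m) = z * T F.
  by rewrite /T /dl /cut mulrBr; do 2 case: eqP => _; rewrite ?mulr0.
have T_sum (I : finType) (F : I -> Lat -> C) : T (fun m => \sum_i F i m) = \sum_i T (F i).
  by rewrite /T /dl /cut sumrB; case: eqP => _; case: eqP => _; rewrite ?big1_eq.
have EE L w : Eterm L (ratios w) (eul_of_ratios w) s m =
  dHf (ratios w) (eul_of_ratios w) s (pt R m) - T (fun m => greg last L (Hf (ratios w) s) (pt R m)) by [].
have E_next w : Eterm l (ratios w) (eul_of_ratios w) s m = Eterm l.+1 (ratios w) (eul_of_ratios w) s m +
    T (fun m => (-1) ^+ l / l.+1%:R * dif last 1 l (Hf (ratios w) s) (pt R m)).
  rewrite !EE.
  have -> : T (fun m => greg last l.+1 (Hf (ratios w) s) (pt R m)) =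
      T (fun m => greg last l (Hf (ratios w) s) (pt R m)) +
      T (fun m => (-1) ^+ l / l.+1%:R * dif last 1 l (Hf (ratios w) s) (pt R m)).
    rewrite -T_add; congr T; apply/funext => m'.
    by rewrite -greg_next addrC subrK.
  by ring.
have P_next (w : l.-tuple 'I_d) : delv a w sT * Pterm (ratios w) s m =
    gamv a w sT * Eterm l.+1 (ratios w) (eul_of_ratios w) s m +
    gamv a w sT * T (fun m => greg last l.+1 (Hf (ratios w) s) (pt R m)) +
    \sum_j delv a (j :: w) sT * Pterm (ratios (j :: w)) s m.
  rewrite -(gamv_bpoly d_ge1 a_incr (hg w)).
  have -> : \sum_j delv a (j :: w) sT * Pterm (ratios (j :: w)) s m =
      - gamv a w sT * ((sT + (size w)%:R) * \sum_j (gap a j)%:R * Phi (ratios (j :: w)) s (pt R m)).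
    rewrite !mulr_sumr; apply: eq_bigr => j _; rewrite delv_cons /Pterm; ring.
  rewrite EE dHf_word -/sT /Pterm.
  by ring.
pose Dl' (w : seq 'I_d) := T (fun m => (-1) ^+ l / l.+1%:R * dif last 1 l (Hf (ratios w) s) (pt R m)).
pose Gl' (w : seq 'I_d) := T (fun m => greg last l.+1 (Hf (ratios w) s) (pt R m)).
pose E' (w : seq 'I_d) := Eterm l.+1 (ratios w) (eul_of_ratios w) s m.
have eT : T expansion_diff = \sum_(r < l) \sum_(w : r.-tuple 'I_d) gamv a w sT * Dl' w +
    \sum_(w : l.-tuple 'I_d) gamv a w sT * Gl' w.
  rewrite /expansion_diff T_add !T_sum; congr (_ + _); apply: eq_bigr => r _; rewrite ?T_scale//.
  by rewrite T_sum; apply: eq_bigr => w _; rewrite T_scale.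
have eE : \sum_(r < l) \sum_(w : r.-tuple 'I_d) gamv a w sT * Eterm l (ratios w) (eul_of_ratios w) s m =
    \sum_(r < l) \sum_(w : r.-tuple 'I_d) gamv a w sT * E' w +
    \sum_(r < l) \sum_(w : r.-tuple 'I_d) gamv a w sT * Dl' w.
  rewrite -big_split; apply: eq_bigr => r _; rewrite -big_split; apply: eq_bigr => w _.
  by rewrite E_next mulrDr.
have eP : \sum_(w : l.-tuple 'I_d) delv a w sT * Pterm (ratios w) s m =
    \sum_(w : l.-tuple 'I_d) gamv a w sT * E' w +
    \sum_(w : l.-tuple 'I_d) gamv a w sT * Gl' w +
    \sum_(w : l.+1.-tuple 'I_d) delv a w sT * Pterm (ratios w) s m.
  rewrite (sum_tuple_cons l (fun w => delv a w sT * Pterm (ratios w) s m)) -!big_split.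
  by apply: eq_bigr => w _; rewrite P_next.
transitivity (\sum_(r < l.+1) \sum_(w : r.-tuple 'I_d) gamv a w sT * E' w +
  \sum_(w : l.+1.-tuple 'I_d) delv a w sT * Pterm (ratios w) s m + T expansion_diff); last by [].
rewrite /expansion -/sT eE eP eT big_ord_recr /=.
move: (\sum_(r < l) \sum_w _) => x1.
move: (\sum_(r < l) \sum_w _) => x2.
move: (\sum_w _) (\sum_w _) (\sum_w _) => x3 x4 x5.
by ring.
Qed.

(** Neither the difference added to the expansion nor the additional summations by parts
    change the regularised sum. *)
Lemma zeta_of_order_step : (forall w : l.-tuple 'I_d, (gam R a w).2.[sT] != 0) ->
  zeta_of_order l s = zeta_of_order l.+1 s.
Proof.
move=> hg; rewrite /zeta_of_order (@regsum_step _ _ _ eps_gt0 _ _ tl_uniq mu_neq1 mu_neq0 mu_bd _ al)//; last exact: LatSymU_expansion.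
have hd' : decays eps tl (fun=> l.+1) al.
  move=> k; apply: le_trans (hd k); rewrite lerD2l lerN2 ler_wpM2l// ler_wpM2r ?(ltW eps_gt0)//.
  by rewrite ler_nat.
have hF := LatSymU_expansion.
have hU0 (m : Lat) : m last = 0%N -> cut last expansion_diff m = 0 by move=> e; rewrite /cut e eqxx.
have h0 := regsum_telescope eps_gt0 tl_uniq mu_bd last_notin_tl LatSymU_expansion_diff hd' hU0 erefl.
have h1 := regsum_isum eps_gt0 tl_uniq mu_bd hF hd'.
have := isum_add h1 (isum_scale (-1) h0); rewrite mulr0 addr0 => h2.
have e : by_parts (lam mu) mu (fun=> l.+1) tl (expansion l s) = (fun m =>
    by_parts (lam mu) mu (fun=> l.+1) tl (expansion l.+1 s) m +
    by_parts (lam mu) mu (fun=> l.+1) tl (dl last (cut last expansion_diff)) m).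
  by rewrite -by_parts_add -expansion_step.
apply/esym/tsumE; move: h2; rewrite {1}e.
rewrite (_ : (fun i : Lat => _) = by_parts (lam mu) mu (fun=> l.+1) tl (expansion l.+1 s))//.
by apply/funext => m; ring.
Qed.

End Step.

(** * The continuation *)

Definition order_suffices (s : V) (l : nat) : Prop := exists D N1,
  (forall K, Sym eps (fun _ : unit => True) K (W (fun=> D)) (fun _ => pows s)) /\ order_ok D l N1.

Lemma order_suffices_leq s l l' : (l <= l')%N -> order_suffices s l -> order_suffices s l'.
Proof. by move=> ll [D [N1 [h1 h2]]]; exists D, N1; split=> //; exact: order_ok_leq h2. Qed.

Lemma zeta_of_order_leq s l l' : (l <= l')%N -> order_suffices s l ->
  (forall w, (size w < l')%N -> (gam R a w).2.[s ord0 ord_max] != 0) ->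
  zeta_of_order l s = zeta_of_order l' s.
Proof.
move=> ll hl hg; rewrite -(subnKC ll); move: (l' - l)%N (subnKC ll) => k.
elim: k l' {ll} hg => [|k ih] l' hg e; first by rewrite addn0.
rewrite (ih (l + k)%N)//; last by move=> w hw; apply: hg; rewrite -e addnS ltnS ltnW.
have [D [N1 [h1 h2]]] := order_suffices_leq (leq_addr k l) hl.
by rewrite addnS (zeta_of_order_step h1 h2)// => w; apply: hg; rewrite size_tuple -e addnS.
Qed.

Definition cpolydisc (M : R) (s : V) : Prop := forall t, N (s ord0 t) <= M.

Variable D1 : R.
Hypothesis D1_ge0 : 0 <= D1.
Hypothesis Lg_Sym : forall t K, Sym eps (fun _ : unit => True) K (W (fun=> D1)) (fun _ x => (Lg t x)%:C%C).

(** The margin [D1 + D1] in the exponent leaves room for two derivatives in [s]. *)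
Definition uniform_order (M : R) (l : nat) : Prop := exists D N1,
  (forall K, Sym eps (cpolydisc M) K (W (fun=> D)) pows) /\ order_ok (D + (D1 + D1)) l N1.

Lemma uniform_order_ex M : 0 <= M -> exists l, uniform_order M l.
Proof.
move=> M0; have [D D0 hD] := pows_ball M0.
have [l [N1 h]] := order_ok_ex (D + (D1 + D1)).
exists l, D, N1; split=> // K.
exact: (@Sym_pows V (cpolydisc M) D (fun s => s) M M0 (fun s hs => hs) hD).
Qed.

Lemma uniform_order_suffices M l s : uniform_order M l -> cpolydisc M s -> order_suffices s l.
Proof.
move=> [D [N1 [h [h1 h2 h3 h4]]]] hs; exists D, N1; split.
  by move=> K; apply: (Sym_reparam (pi := fun=> s) _ (h K)).
have h0 := D1_ge0; split; [by [] | lra | lra | lra].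
Qed.

Section Differentiability.
Variables (q : V) (M : R) (l : nat).
Hypothesis q_ball : cpolydisc M q.
Hypothesis l_ok : uniform_order (M + 1) l.

Let B := polydisc q 1.

Let B_ball s : B s -> cpolydisc (M + 1) s.
Proof.
move=> hs t; have -> : s ord0 t = q ord0 t + (s ord0 t - q ord0 t) by rewrite addrC subrK.
by rewrite (le_trans (ND _ _))// lerD// ltW.
Qed.

Let Lg_Sym' t K : Sym eps B K (W (fun=> D1)) (fun _ x => (Lg t x)%:C%C).
Proof. by apply: (Sym_reparam (pi := fun=> tt) _ (Lg_Sym t K)). Qed.

Let Sym_low (f : X -> R) al al' : (forall k, al k <= al' k) ->
  (forall K, Sym eps B K (W al) (fun _ x => (f x)%:C%C)) ->
  (forall K, Sym eps B K (W al') (fun _ x => (f x)%:C%C)).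
Proof. by move=> h hf K; apply: Sym_le ler01 _ (hf K) => x hx; rewrite mul1r W_le. Qed.

Let derivs_Sym (f : X -> R) al : (forall K, Sym eps B K (W al) (fun _ x => (f x)%:C%C)) ->
  let al' k := al k + (D1 + D1) in
  [/\ forall K, Sym eps B K (W al') (fun _ x => (f x)%:C%C),
      forall t K, Sym eps B K (W al') (fun _ x => (mulL t f x)%:C%C) &
      forall t u K, Sym eps B K (W al') (fun _ x => (mulL u (mulL t f) x)%:C%C)].
Proof.
move=> hf; split=> [|t|t u].
- by apply: Sym_low hf => k; rewrite lerDl addr_ge0.
- apply: Sym_low (Sym_mulL (Lg_Sym' t) hf) => k; by rewrite lerD2l lerDl.
- apply: Sym_low (Sym_mulL (Lg_Sym' u) (Sym_mulL (Lg_Sym' t) hf)) => k.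
  by rewrite addrA.
Qed.

Let differentiable_deriv (F : (X -> R) -> (X -> R) -> V -> Lat -> C) f th al be :
  decays eps tl (fun=> l) be ->
  (forall K, Sym eps B K (W al) (fun _ x => (f x)%:C%C)) -> eul f th ->
  (forall f th, (forall K, Sym eps B K (W (fun k => al k + (D1 + D1))) (fun _ x => (f x)%:C%C)) ->
    eul f th -> forall K, LatSymT B K be (F f th)) ->
  (forall f th q v m x, cder (fun y : R => F f th (q + (y%:C)%C *: v) m) x
    (\sum_t v ord0 t * F (mulL t f) (mulLth t f th) (q + (x%:C)%C *: v) m)) ->
  differentiable (fun s => regsum tl mu (fun=> l) (F f th s)) q.
Proof.
move=> hd hf he hF dF; have [s0 s1 s2] := derivs_Sym hf.
apply: (@differentiable_regsum q 1 _ be _ (fun t => F (mulL t f) (mulLth t f th))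
  (fun t u => F (mulL u (mulL t f)) (mulLth u (mulL t f) (mulLth t f th)))) => //.
- exact: hF.
- by move=> t; apply: hF => //; exact: eul_mulL.
- by move=> t u; apply: hF => //; do 2 apply: eul_mulL.
Qed.

Lemma differentiable_E w :
  differentiable (fun s => regsum tl mu (fun=> l) (Eterm l (ratios w) (eul_of_ratios w) s)) q.
Proof.
have [D [N1 [hex hok]]] := l_ok.
have hex' K : Sym eps B K (W (fun=> D)) (fun s => pows s) by apply: Sym_reparam (hex K).
apply: (differentiable_deriv (decays_summable_exp hok) (fun K => Sym_ratios_one B K w)
  (@eul_ratios w)) => [f th hf he K|]; last exact: cder_Eterm.
apply: (LatSym_E (g := id) hex' hok K (leqnn l) _ he).
by apply: Sym_low hf => k; rewrite add0r.
Qed.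

Lemma differentiable_P (w : l.-tuple 'I_d) :
  differentiable (fun s => regsum tl mu (fun=> l) (Pterm (ratios w) s)) q.
Proof.
have [D [N1 [hex hok]]] := l_ok; have [hN _ _ _] := hok.
have hex' K : Sym eps B K (W (fun=> D)) (fun s => pows s) by apply: Sym_reparam (hex K).
have hw : (N1 <= size w)%N by rewrite size_tuple.
have [c c0 hc] := ratio_le_gain.
apply: (differentiable_deriv (F := fun f _ => Pterm f) (decays_summable_exp hok)
  (fun K => Sym_ratios_gain B K D'_ge0 c0 hc hw) (@eul_ratios w)) => [f th hf _ K|*].
  exact: (LatSym_P (g := id) hex' hok K hf).
exact: cder_Pterm.
Qed.

End Differentiability.

(** The quotient by this common denominator has a numerator that is holomorphic at the zeros
    of the denominator as well. *)
Definition denom (l : nat) : {poly C} :=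
  \prod_(r < l.+1) \prod_(w : r.-tuple 'I_d) (gam R a w).2.

Definition cof (l : nat) (x : {poly C} * {poly C}) : {poly C} := x.1 * (denom l %/ x.2).

Lemma denom_neq0 l : denom l != 0.
Proof. by apply/prodf_neq0 => r _; apply/prodf_neq0 => w _; exact: gam_den_neq0. Qed.

Lemma gam_dvd_denom l w : (size w <= l)%N -> (gam R a w).2 %| denom l.
Proof.
move=> hw; rewrite /denom (bigD1 (Ordinal (hw : (size w < l.+1)%N)))//=.
rewrite (bigD1 (in_tuple w))//= -mulrA; exact: dvdp_mulr.
Qed.

Lemma del_dvd_denom l w : (size w <= l)%N -> (del R a w).2 %| denom l.
Proof.
move=> hw; apply: dvdp_trans (gam_dvd_denom hw).
by rewrite gamE; case: ifP => _ //=; exact: dvdp_mulr.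
Qed.

Lemma cofE l x s : x.2 %| denom l -> (denom l).[s] != 0 ->
  x.1.[s] / x.2.[s] = (cof l x).[s] / (denom l).[s].
Proof.
move=> h h0; rewrite /cof hornerM -mulrA; congr (_ * _).
move: h0; rewrite -{1 3}(divpK h) hornerM mulf_eq0 negb_or => /andP[h1 h2].
by rewrite invfM mulrA divff// mul1r.
Qed.

Lemma gam_neq0_of_denom l w s : (size w <= l)%N -> (denom l).[s] != 0 -> (gam R a w).2.[s] != 0.
Proof.
by move=> hw; rewrite -{1}(divpK (gam_dvd_denom hw)) hornerM mulf_eq0 negb_or => /andP[].
Qed.

Definition numer (l : nat) (s : V) : C :=
  \sum_(r < l) \sum_(w : r.-tuple 'I_d)
    (cof l (gam R a w)).[s ord0 ord_max] * regsum tl mu (fun=> l) (Eterm l (ratios w) (eul_of_ratios w) s) +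
  \sum_(w : l.-tuple 'I_d)
    (cof l (del R a w)).[s ord0 ord_max] * regsum tl mu (fun=> l) (Pterm (ratios w) s).

Lemma zeta_of_order_quotient l s : order_suffices s l -> (denom l).[s ord0 ord_max] != 0 ->
  zeta_of_order l s = numer l s / (denom l).[s ord0 ord_max].
Proof.
move=> [D [N1 [h1 h2]]] h0; rewrite (zeta_of_orderE h1 h2) /numer mulrDl mulr_suml.
congr (_ + _).
  apply: eq_bigr => r _; rewrite mulr_suml; apply: eq_bigr => w _.
  rewrite [RHS]mulrAC; congr (_ * _); apply: cofE => //; apply: gam_dvd_denom.
  by rewrite size_tuple ltnW.
rewrite mulr_suml; apply: eq_bigr => w _; rewrite [RHS]mulrAC; congr (_ * _).
by apply: cofE => //; apply: del_dvd_denom; rewrite size_tuple.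
Qed.

Lemma differentiable_numer M l q : cpolydisc M q -> uniform_order (M + 1) l ->
  differentiable (numer l) q.
Proof.
move=> hq hl; apply: diffble_add; apply: diffble_sum => i.
  apply: diffble_sum => w; apply: diffble_mul; first exact: diffble_horner.
  exact: differentiable_E hq hl _.
apply: diffble_mul; first exact: diffble_horner.
exact: differentiable_P hq hl _.
Qed.

Lemma order_suffices_ex s : exists l, `[< order_suffices s l >].
Proof.
have M0 : 0 <= \sum_t N (s ord0 t) by apply: sumr_ge0 => t _; exact: N_ge0.
have [l hl] := uniform_order_ex M0; exists l; apply/asboolP; apply: uniform_order_suffices hl _.
by move=> t; apply: (ler_sum_term t) => u; exact: N_ge0.
Qed.

(** The continuation uses the least order that suffices at [s], so that order 0,
    hence the series itself, is used wherever the series converges well. *)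
Definition continuation (s : V) : C := zeta_of_order (ex_minn (order_suffices_ex s)) s.

Lemma continuationE s l : order_suffices s l ->
  (forall w, (size w < l)%N -> (gam R a w).2.[s ord0 ord_max] != 0) -> continuation s = zeta_of_order l s.
Proof.
move=> hl hg; rewrite /continuation; case: ex_minnP => l0 /asboolP h0 hmin.
by apply: zeta_of_order_leq => //; apply: hmin; exact/asboolP.
Qed.

Lemma continuation_local (p : V) : exists l,
  (\forall q \near p, differentiable (numer l) q) /\
  (\forall q \near p, (denom l).[(q : V) ord0 ord_max] != 0 ->
     continuation q = numer l q / (denom l).[(q : V) ord0 ord_max]).
Proof.
pose M := \sum_t N (p ord0 t) + 1.
have s0 : 0 <= \sum_t N (p ord0 t) by apply: sumr_ge0 => t _; exact: N_ge0.
have [l hl] : exists l, uniform_order (M + 1) l.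
  by apply: uniform_order_ex; rewrite !addr_ge0.
have hball : \forall q \near p, cpolydisc M q.
  apply: filterS (near_polydisc p ltr01) => q hq t.
  have -> : q ord0 t = p ord0 t + (q ord0 t - p ord0 t) by rewrite addrC subrK.
  rewrite (le_trans (ND _ _))// lerD ?(ltW (hq t))//.
  by apply: (ler_sum_term t) => u; exact: N_ge0.
exists l; split; apply: filterS hball => q hq; first exact: differentiable_numer hq hl.
move=> h0; have hgood : order_suffices q l.
  apply: uniform_order_suffices hl _ => t; by rewrite (le_trans (hq t))// lerDl.
rewrite -zeta_of_order_quotient//; apply: continuationE => // w hw.
exact: gam_neq0_of_denom (ltnW hw) h0.
Qed.

(** A polynomial that vanishes near a point has more roots than its degree allows. *)
Lemma poly_near_neq0 (h : {poly C}) (p : V) : h != 0 ->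
  ~ (\forall q \near p, h.[(q : V) ord0 ord_max] = 0).
Proof.
move=> h0 /nbhs_normP[e /= e0 he].
have [e' [e'0 ee]] : exists e' : R, 0 < e' /\ e = (e'%:C)%C.
  exists (complex.Re e); case: e e0 {he} => x y; rewrite ltcE /= => /andP[/eqP -> hx].
  by [].
have [r [r0 er]] := norm_real (\row_t (t == ord_max)%:R : V).
(* Distinct points on the axis of the last coordinate, all within [e] of [p]. *)
pose z (k : nat) : C := ((e' / (r + 1) / k.+2%:R)%:C)%C.
pose rs := [seq p ord0 ord_max + z k | k <- iota 0 (size h)].
have r1 : 0 < r + 1 by rewrite ltr_pwDr.
have z0 k : 0 < e' / (r + 1) / k.+2%:R by rewrite !divr_gt0.
have hr : all (root h) rs.
  apply/allP => _ /mapP[k _ ->]; apply/eqP.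
  pose q : V := p + z k *: \row_t (t == ord_max)%:R.
  have : h.[q ord0 ord_max] = 0.
    apply: he => /=; rewrite -[X in `|X|]opprK normrN opprB /q addrAC subrr add0r.
    rewrite normrZ er /z ger0_norm ?lecR ?(ltW (z0 k))// -rmorphM ee ltcR /=.
    have h1 : r / (r + 1) <= 1 by rewrite ler_pdivrMr// mul1r lerDl.
    rewrite (_ : _ * r = e' * (r / (r + 1)) / k.+2%:R); last first.
      by ring.
    rewrite ltr_pdivrMr ?ltr0n//; apply: (@le_lt_trans _ _ (e' * 1)).
      by rewrite ler_wpM2l// ltW.
    by rewrite ltr_pM2l// ltr1n.
  by rewrite !mxE eqxx mulr1.
have hu : uniq rs.
  rewrite map_inj_uniq ?iota_uniq// => i j /addrI /(congr1 (@complex.Re R)) /=.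
  move=> /(mulfI (lt0r_neq0 (divr_gt0 e'0 r1))) /invr_inj /eqP; rewrite eqr_nat => /eqP.
  by case.
have := max_poly_roots h0 hr hu.
by rewrite size_map size_iota ltnn.
Qed.

Lemma continuation_meromorphic : meromorphic continuation.
Proof.
move=> p; have [l [h1 h2]] := continuation_local p.
exists (numer l), (fun q => (denom l).[q ord0 ord_max]); split=> //.
- by apply: filterE => q; exact: diffble_horner.
- exact: poly_near_neq0 (denom_neq0 l).
Qed.

Lemma continuation_regular (p : V) : (forall w, (gam R a w).2.[p ord0 ord_max] != 0) ->
  holomorphic_near continuation p.
Proof.
move=> hp; have [l [h1 h2]] := continuation_local p.
have h0 : (denom l).[p ord0 ord_max] != 0.
  rewrite /denom horner_prod; apply/prodf_neq0 => r _; rewrite horner_prod.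
  by apply/prodf_neq0 => w _.
have hc := differentiable_continuous (diffble_horner (denom l) ord_max p).
have h3 : \forall q \near p, (denom l).[(q : V) ord0 ord_max] != 0.
  exact: (cvgr_neq0 _ hc h0).
have h4 : \forall q \near p, continuation q = numer l q / (denom l).[(q : V) ord0 ord_max].
  by apply: filterS2 h2 h3 => q hq /hq.
rewrite /holomorphic_near; have h5 := nbhs_interior h4.
apply: filterS3 h1 h3 h5 => q d1 d3 d4.
have d5 : differentiable (fun v : V => numer l v / (denom l).[v ord0 ord_max]) q.
  exact: (diffble_mul d1 (diffble_inv (diffble_horner (denom l) ord_max q) d3)).
move: d5; apply: differentiable_near; exact: d4.
Qed.

Lemma W_exp (al : 'I_n'.+1 -> R) (x : X) : ge1 x -> W al x = expR (\sum_i al i * ln (x i)).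
Proof.
move=> hx; rewrite /W expR_sum; apply: eq_bigr => i _.
by rewrite /powR gt_eqF// (lt_le_trans ltr01).
Qed.

Lemma cpowE (x : R) (s : C) : cpow x s = cexp (s * (ln x)%:C%C).
Proof. by case: s => u v; rewrite /cpow /cexp /= !mulr0 subr0 add0r. Qed.

(** * The half-space of convergence *)

Hypothesis var_low : forall i : 'I_n'.+1, exists (t : 'I_T'.+1) (c e : R),
  [/\ 0 < c, 0 < e & forall x, ge1 x -> c * x i `^ e <= pf t x].

(** Every variable is bounded by a power of some polynomial, so large real parts of all the
    exponents make the product of the powers decay in all the variables. *)
Lemma pows_decay : exists sigma0 : R, forall s : V,
  (forall t, sigma0 < complex.Re (s ord0 t)) ->
  dominated (fun _ : unit => True) (W (fun=> - 4)) (fun _ => pows s).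
Proof.
have /choice[f hf] : forall i : 'I_n'.+1, exists tce : 'I_T'.+1 * (R * R),
    [/\ 0 < tce.2.1, 0 < tce.2.2 &
        forall x, ge1 x -> tce.2.1 * x i `^ tce.2.2 <= pf tce.1 x].
  by move=> i; have [t [c [e h]]] := var_low i; exists (t, (c, e)).
have fe0 i : 0 < (f i).2.2 by have [] := hf i.
have [e e0 he] := min_pos fe0.
have [c c0 hc] := pf_low.
pose b := `|ln c|.
have hb t x : ge1 x -> 0 <= Lg t x + b.
  move=> hx; rewrite -lerBlDr sub0r (le_trans _ (_ : ln c <= _))//.
    by rewrite lerNl /b -normrN ler_norm.
  by rewrite ler_ln ?posrE ?pf_gt0// hc.
pose S x := \sum_t (Lg t x + b).
have S0 x : ge1 x -> 0 <= S x by move=> hx; apply: sumr_ge0 => t _; exact: hb.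
have ln0 x (i : 'I_n'.+1) : ge1 x -> 0 <= ln (x i) by move=> hx; rewrite ln_ge0// hx.
have key x i : ge1 x -> ln (f i).2.1 + e * ln (x i) <= S x.
  move=> hx; have [ci ei h] := hf i; have xi : 0 < x i by exact: lt_le_trans ltr01 (hx i).
  apply: (@le_trans _ _ (Lg (f i).1 x + b)); last first.
    by apply: (ler_sum_term (f i).1) => t; exact: hb.
  rewrite -[leLHS]addr0 lerD ?normr_ge0//.
  apply: (@le_trans _ _ (ln ((f i).2.1 * x i `^ (f i).2.2))); last first.
    by rewrite ler_ln ?posrE ?pf_gt0 ?h// mulr_gt0 ?powR_gt0.
  by rewrite lnM ?posrE ?powR_gt0// ln_powR lerD2l ler_wpM2r ?ln0 ?he.
pose A := \sum_i ln (f i).2.1.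
have keyS x : ge1 x -> A + e * \sum_i ln (x i) <= n'.+1%:R * S x.
  move=> hx; rewrite mulr_sumr /A -big_split /=.
  apply: (@le_trans _ _ (\sum_(i < n'.+1) S x)); first by apply: ler_sum => i _; exact: key.
  by rewrite sumr_const card_ord mulr_natl.
(* [key] is added over the [n] variables, and the exponent 4 is what [order_ok0] needs. *)
exists (4 / e * n'.+1%:R) => s hs.
pose B := b * \sum_t complex.Re (s ord0 t).
exists (2 * expR (B - 4 / e * A)); first by rewrite mulr_ge0// expR_ge0.
move=> _ x _ hx; rewrite (le_trans (N_pows _ _))// -mulrA ler_wpM2l// W_exp// -expRD ler_expR.
have e4 : 0 <= 4 / e by rewrite divr_ge0 ?(ltW e0).
have h1 : 4 / e * (n'.+1%:R * S x) <= \sum_t complex.Re (s ord0 t) * (Lg t x + b).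
  rewrite mulrA /S mulr_sumr; apply: ler_sum => t _.
  by rewrite ler_wpM2r ?hb// ltW.
have h2 := ler_wpM2l e4 (keyS x hx).
have h3 : \sum_t complex.Re (s ord0 t) * (Lg t x + b) =
    \sum_t complex.Re (s ord0 t) * Lg t x + B.
  by rewrite /B mulr_sumr -big_split; apply: eq_bigr => t _ /=; rewrite mulrDr [b * _]mulrC.
rewrite -mulr_sumr.
have h4 : 4 / e * (A + e * \sum_i ln (x i)) = 4 / e * A + 4 * \sum_i ln (x i).
  by rewrite mulrDr mulrA divfK// lt0r_neq0.
by lra.
Qed.

Lemma order0_suffices : exists sigma0 : R, forall s : V,
  (forall t, sigma0 < complex.Re (s ord0 t)) -> order_suffices s 0.
Proof.
have [sigma0 h] := pows_decay; exists sigma0 => s /h hd; exists (- 4), 0%N.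
split; last exact: order_ok0.
have s0 : 0 <= \sum_t N (s ord0 t) by apply: sumr_ge0 => t _; exact: N_ge0.
move=> K; apply: (Sym_pows (g := fun=> s) s0 _ hd) => _ _ t.
by apply: (ler_sum_term t) => u; exact: N_ge0.
Qed.

Lemma expansion0E s m : expansion 0 s m = pows s (pt R m).
Proof.
rewrite /expansion big_ord0 add0r (big_pred1 (nil_tuple 'I_d)); last first.
  by move=> w; apply/esym/eqP/val_inj; case: w => -[].
by rewrite /= delv_nil mul1r /Pterm /Phi /ratios big_nil mul1r.
Qed.

Lemma zeta_termE s (m : Lat) :
  zeta_term P Q a mu0 s m = (\prod_(j <- tl) mu j ^+ (m j).+1) * pows s (pt R m).
Proof.
rewrite /zeta_term /tl big_map big_enum /=; congr (_ * _).
  by apply: eq_bigr => j _; rewrite mu_wd.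
rewrite /pows cexpN cexp_sum big_ord_recr /=; congr (_^-1); congr (_ * _).
  by apply: eq_bigr => j _; rewrite cpowE /Lg pf_wd.
by rewrite cpowE /Lg pf_max meval_polyT.
Qed.

Lemma zeta_of_order0 s : order_suffices s 0 -> zeta_is P Q a mu0 s (zeta_of_order 0 s).
Proof.
move=> [D [N1 [h1 h2]]].
have h2' : order_ok (D + 0) 0 N1 by rewrite addr0.
have := regsum_isum eps_gt0 tl_uniq mu_bd (LatSymU_expansion h1 h2) (decays_summable_exp h2').
move=> h; rewrite /zeta_is; have := isum_cvg h.
rewrite (_ : by_parts _ _ _ _ _ = zeta_term P Q a mu0 s)//.
by apply/funext => m; rewrite (by_parts_order0 _ _ _ tl_uniq) expansion0E zeta_termE.
Qed.

Lemma continuation_zeta : exists sigma0 : R, forall s : V,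
  (forall t, sigma0 < complex.Re (s ord0 t)) -> zeta_is P Q a mu0 s (continuation s).
Proof.
have [sigma0 h] := order0_suffices; exists sigma0 => s /h hs.
by rewrite (continuationE hs)//; exact: zeta_of_order0.
Qed.

End Zeta.

(** * Location of the singularities *)

Lemma word_gap_count (d : nat) (a : 'I_d.+1 -> nat) w :
  word_gap a w = (\sum_j count_mem j w * gap a j)%N.
Proof.
elim: w => [|i w ih]; first by rewrite /word_gap big_nil big1.
rewrite word_gap_cons ih /=; under [in RHS]eq_bigr do rewrite mulnDl.
rewrite [RHS]big_split /=; congr (_ + _)%N.
rewrite (bigD1 i)//= eqxx mul1n big1 ?addn0// => j.
by rewrite eq_sym => /negbTE ->.
Qed.

(** The numbers of occurrences of the letters of the word are the [l_j] and, for the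
    letter 0, the opposite of the value of [gtilde]. *)
Lemma root_S2 (R : realType) (T' d : nat) (a : 'I_d.+1 -> nat) (d_ge1 : (1 <= d)%N)
    (a_incr : forall i j : 'I_d.+1, (i < j)%N -> (a i < a j)%N)
    (s : 'rV[R[i]]_T'.+1) (w : seq 'I_d) :
  (a ord_max)%:R * s ord0 ord_max = 1 - (word_gap a w)%:R -> exists l, S2 a l s.
Proof.
case: d a d_ge1 a_incr w => [//|d] a _ a_incr w e.
have gapC j : (gap a j)%:R = (a ord_max)%:R - (a (wd j))%:R :> R[i].
  by rewrite natrB//; exact/ltnW/(a_lt_max a_incr).
exists (fun j => count_mem (lift ord0 j) w), (count_mem ord0 w).
rewrite /gtilde e word_gap_count big_ord_recl natrD natrM natr_sum.
have -> : (a ord_max)%:R - (a ord0)%:R = (gap a ord0)%:R :> R[i].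
  by rewrite gapC; congr (_ - (a _)%:R); exact: val_inj.
have -> : \sum_(j < d.+1.-1) ((a ord_max)%:R - (a (mid j))%:R) *
     - (count_mem (lift ord0 j) w)%:R =
   - \sum_(i < d) (count_mem (lift ord0 i) w * gap a (lift ord0 i))%:R :> R[i].
  rewrite -sumrN; apply: eq_bigr => j _; rewrite mulrN natrM gapC mulrC; congr (- (_ * (_ - (a _)%:R))).
  exact: val_inj.
have g0 : (gap a ord0)%:R != 0 :> R[i] by rewrite pnatr_eq0 -lt0n (gap_gt0 a_incr).
by field.
Qed.

(** A variable other than the last one occurs in some polynomial because of the growth
    hypothesis, and the HDF condition bounds that polynomial from below. The last one is
    bounded by [Q_d X_n ^ a_d], since [a_d > 0]. *)
Lemma HDF_var_low (R : realType) (T' n' d : nat) (d_ge1 : (1 <= d)%N)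
    (a : 'I_d.+1 -> nat) (a_incr : forall i j : 'I_d.+1, (i < j)%N -> (a i < a j)%N)
    (P : 'I_T' -> mpoly n' R) (Q : 'I_d.+1 -> mpoly n' R)
    (P_HDF : forall j, HDF (P j)) (Q_HDF : forall j, HDF (Q j))
    (PQ_infty : (2 <= n'.+1)%N -> tends_to_infty P Q) (i : 'I_n'.+1) :
  exists (t : 'I_T'.+1) (c e : R),
    [/\ 0 < c, 0 < e & forall x, ge1 x -> c * x i `^ e <= pf a P Q t x].
Proof.
have Q_low j : bounded_below (Q j) by exact: HDF_lower.
have [->|[j ->]] := ord_max_or_wd i.
  have [c c0 hc] := Q_low ord_max; exists ord_max, c, 1; split=> // x hx.
  have x0 : 0 < x ord_max by exact: ge1_gt0.
  rewrite pf_max (le_trans _ (PTterm_le_pT a Q_low ord_max hx))// powRr1 ?(ltW x0)//.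
  apply: ler_pM; rewrite ?(ltW c0) ?(ltW x0) ?hc//; first exact: prj_ge1.
  by rewrite ler_eXnr ?hx// (amax_gt0 d_ge1 a_incr).
have n0 : (2 <= n'.+1)%N by rewrite ltnS (leq_ltn_trans (leq0n j)).
have [[t ht]|[t ht]] := tends_to_infty_occurs j (PQ_infty n0).
  have [c [e [c0 e0 h]]] := HDF_lower_var (P_HDF t) ht.
  by exists (wd t), c, e; split=> // x hx; rewrite pf_wd; apply: h; exact: prj_ge1.
have [c [e [c0 e0 h]]] := HDF_lower_var (Q_HDF t) ht.
exists ord_max, c, e; split=> // x hx.
rewrite pf_max (le_trans _ (PTterm_le_pT a Q_low t hx))// (le_trans (h _ (prj_ge1 hx)))//.
rewrite ler_peMr ?exprn_ege1 ?hx//.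
by case: (Q_HDF t) => Q0 _; exact/ltW/Q0/prj_ge1.
Qed.

Theorem corollary23 (R : realType) (T' n' d : nat) (d_ge1 : (1 <= d)%N)
    (mu : 'I_n' -> R[i])
    (mu_norm : forall j, `|mu j| = 1) (mu_neq1 : forall j, mu j <> 1)
    (a : 'I_d.+1 -> nat)
    (a_incr : forall i j : 'I_d.+1, (i < j)%N -> (a i < a j)%N)
    (P : 'I_T' -> mpoly n' R) (Q : 'I_d.+1 -> mpoly n' R)
    (P_HDF : forall j, HDF (P j)) (Q_HDF : forall j, HDF (Q j))
    (PQ_infty : (2 <= n'.+1)%N -> tends_to_infty P Q) :
  exists Z : 'rV[R[i]]_T'.+1 -> R[i],
    [/\ meromorphic Z,
        exists sigma0 : R, forall s : 'rV[R[i]]_T'.+1,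
          (forall t, sigma0 < complex.Re (s ord0 t)) ->
          zeta_is P Q a mu s (Z s),
        [set s | singular_point Z s] `<=`
          \bigcup_(l in [set: 'I_d.-1 -> nat]) S1 a l `|`
          \bigcup_(l in [set: 'I_d.-1 -> nat]) S2 a l `|`
          \bigcup_(k in [set: 'I_d -> nat]) S3 a k
      & forall N : 'I_T'.+1 -> nat,
          ~ singular_point Z (\row_t - (N t)%:R)].

Proof.
have [eps eps01 [P_symb Q_symb]] : exists2 eps : R, 0 < eps <= 1 &
    (forall j, symbolic eps (P j)) /\ (forall j, symbolic eps (Q j)).
  have /choice[f hf] j : exists e : R, 0 < e /\ forall eps, 0 < eps <= e -> symbolic eps (P j).
    by have [e e0 h] := HDF_symbol (P_HDF j); exists e.
  have /choice[g hg] j : exists e : R, 0 < e /\ forall eps, 0 < eps <= e -> symbolic eps (Q j).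
    by have [e e0 h] := HDF_symbol (Q_HDF j); exists e.
  have [e1 e10 h1] := min_pos (fun j => (hf j).1).
  have [e2 e20 h2] := min_pos (fun j => (hg j).1).
  exists (Num.min 1 (Num.min e1 e2)).
    by rewrite !lt_min ltr01 e10 e20 ge_min lexx.
  split=> j; [apply: (hf j).2 | apply: (hg j).2]; rewrite !lt_min ltr01 e10 e20 /=.
    by rewrite (le_trans _ (h1 j))// !ge_min lexx orbT.
  by rewrite (le_trans _ (h2 j))// !ge_min lexx !orbT.
have P_low j : bounded_below (P j) by exact: HDF_lower.
have Q_low j : bounded_below (Q j) by exact: HDF_lower.
have [D' D'0 hD'] := ratio_gain a_incr Q_low.
have [D1 D10 hD1] := Sym_Lg a eps01 P_symb Q_symb P_low Q_low (fun _ : unit => True).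
have low := HDF_var_low d_ge1 a_incr P_HDF Q_HDF PQ_infty.
have regular := continuation_regular eps01 a_incr P_symb Q_symb P_low Q_low mu_norm mu_neq1
  d_ge1 D'0 hD' D10 hD1.
exists (continuation a eps01 P_symb Q_symb P_low Q_low mu D'0 D10); split.
- exact: continuation_meromorphic.
- exact: continuation_zeta.
- move=> s hs; have [w hw] : exists w, (gam R a w).2.[s ord0 ord_max] = 0.
    apply: contrapT => h; apply: hs; apply: regular => w.
    by apply/eqP => e; apply: h; exists w.
  have [w' _ e] := gam_den_root hw; have [l hl] := root_S2 d_ge1 a_incr e.
  by left; right; exists l.
- by move=> N; apply; apply: regular => w; rewrite mxE; exact: gam_den_nonpos.
Qed.
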